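(* Let $n\ge 2$ be an integer, $m=2n$, $\gamma=2n+2$, let $\delta,\eta$ be fixed scalars with $0<\delta<1-\frac{n}{m-n+1}$ and $\frac{m-n+1}{m+1}\delta+\frac{2n}{m+1}\le\eta<1$, and let $C>0$. Let $c_0(1),c_1(1),c_2(1)>0$ be constants with the univariate approximation property (Y) stated in the context. Let $f\in K_C([0,1]^n;\mathbb{R})$ (defined in the context) satisfy $\|f\|_{L^\infty([0,1]^n)}\le 1$. Then, for any scalar $0<\epsilon<1$, there is a deep ReLU network $\tilde f_r:[0,1]^n\to\mathbb{R}$ that has depth $$L\le c_0(1)\,\tilde c_3(n,r(\epsilon))\,\epsilon^{-[1+\log_2(n+1)]/2}+c_0(1)\,\tilde c_4(n,r(\epsilon))\,\epsilon^{-1/2}$$ and size $$W\le n(2n+1)\,\tilde c_3(n,r(\epsilon))\,\epsilon^{-[1+\log_2(n+1)]/2}+(2n+1)\,\tilde c_4(n,r(\epsilon))\,\epsilon^{-1/2},$$ such that $\|f-\tilde f_r\|_{L^\infty([0,1]^n)}\le\epsilon$, where $$r(\epsilon)=\left\lceil \frac{\log(2\epsilon^{-1})}{\log(\eta^{-1})}\right\rceil,$$ $$\tilde c_3(n,r)=\left[\frac{4n+2}{n}\,r\,(2n+2)^{2n^C}\right]^{[1+\log_2(n+1)]/2}c_3(n),\qquad \tilde c_4(n,r)=[8n+4]^{1/2}\,c_4(n,r),$$ $$c_3(n)=\left[(2n+5)c_1(1)\right]^{[1+\log_2(n+1)]/2}c_2(1)^{1/2},\qquad c_4(n,r)=\l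eft[\frac{c_1(1)c_2(1)}{n}\,r\,(2n+2)^{2n^C}\right]^{1/2}.$$
   Context: **Networks.** A deep ReLU network is a feedforward neural network with activation $x\mapsto\max(x,0)$ (linear output), in which connections between units in non-neighboring layers are allowed. Its depth is the number of layers and its size is the total number of weights. **Property (Y) of the constants.** For every continuous $g:[0,1]\to\mathbb{R}$ with modulus of continuity $\omega_g$ and every real $W\ge1$, there is a deep ReLU network $\tilde g$ of size at most $W$ and depth at most $c_0(1)W$ such that $\|g-\tilde g\|_{L^\infty([0,1])}\le c_1(1)\,\omega_g(c_2(1)W^{-2})$. Here a modulus of continuity of $g$ is a nondecreasing function $\omega:[0,\infty)\to[0,\infty)$ with $\lim_{t\to0+}\omega(t)=\omega(0)=0$ and $|g(x)-g(x')|\le\omega(|x-x'|)$ for all $x,x'$. **Parameters.** For integers $n\ge2$, $m\ge2n$, $\gamma\ge m+2$ put $a=\frac{1}{\gamma(\gamma-1)}$, $\beta_n(\ell)=1+n+\dots+n^{\ell-1}$, $\lambda_1=1$ and $\lambda_i=\sum_{\ell=1}^\infty\gamma^{-(i-1)\beta_n(\ell)}$ for $2\le i\le n$. **Inner function.** Let $D_k=\{i\gamma^{-k}:0\le i\le\gamma^k-1\}$, and write $d\in D_k$ in base $\gamma$ as $d=\sum_{\ell=1}^k i_\ell\gamma^{-\ell}$, $i_\ell\in\{0,\dots,\gamma-1\}$. Define recursively $\psi_1(d)=d$ on $D_1$ and, for $k>1$, $d\in D_k$, $$\psi_k(d)=\begin{cases}\psi_{k-1}(d-i_k\gamma^{-k})+i_k\gamma^{-\beta_n(k)},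 & i_k<\gamma-1,\\ \frac12\left[\psi_k(d-\gamma^{-k})+\psi_{k-1}(d+\gamma^{-k})\right], & i_k=\gamma-1,\end{cases}$$ with the convention $\psi_{k}(1)=1$. For $x=\sum_{\ell\ge1}i_\ell\gamma^{-\ell}\in[0,1)$ set $\psi(x)=\lim_{k\to\infty}\psi_k(\sum_{\ell=1}^k i_\ell\gamma^{-\ell})$, and for $x\in[1,2)$ set $\psi(x)=\psi(x-1)+1$. This gives the inner function $\psi:[0,2)\to[0,2)$. **Outer functions.** For $0\le j\le m$ let $D_k^j=D_k+j\sum_{\ell=2}^k\gamma^{-\ell}$. For $\boldsymbol d=(d_1,\dots,d_n)\in(D_k^j)^n$ let $\xi(\boldsymbol d)=\sum_{i=1}^n\lambda_i\psi(d_i)$, let $b_k=\left(\sum_{\ell=k+1}^\infty\gamma^{-\beta_n(\ell)}\right)\left(\sum_{i=1}^n\lambda_i\right)$, and let $$\theta(\boldsymbol d;x)=\sigma\left(\gamma^{\beta_n(k+1)}[x-\xi(\boldsymbol d)]+1\right)-\sigma\left(\gamma^{\beta_n(k+1)}[x-\xi(\boldsymbol d)-(\gamma-2)b_k]\right),$$ where $\sigma(x)=0$ for $x\le0$, $\sigma(x)=x$ for $0\le x\le1$, $\sigma(x)=1$ for $x\ge1$. Given a continuous $f:[0,1]^n\to\mathbb{R}$, start with $f_0=0$, $e_0=f$. At iteration $r\ge1$, an integer $k_r=k_r(f)\ge1$ is chosen such that $\|\boldsymbol x-\boldsymbol x'\|_\infty\le\gamma^{-k_r}$ implies $|e_{r-1}(\boldsymbol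 x)-e_{r-1}(\boldsymbol x')|\le\delta\|e_{r-1}\|_{L^\infty([0,1]^n)}$, and one sets, for $0\le j\le m$, $$\phi_j^r(x)=\frac1{m+1}\sum_{\ell=1}^r\ \sum_{\boldsymbol d\in(D_{k_\ell})^n}e_{\ell-1}(\boldsymbol d)\,\theta\left(\boldsymbol d+j\sum_{i=2}^{k_\ell}\gamma^{-i};x\right),$$ (the scalar $j\sum_{i=2}^{k_\ell}\gamma^{-i}$ is added to every coordinate, and $\theta$ is taken with $k=k_\ell$), $f_r(x_1,\dots,x_n)=\sum_{j=0}^m\phi_j^r\left(\sum_{i=1}^n\lambda_i\psi(x_i+ja)\right)$ and $e_r=f-f_r$. **The class $K_C$.** For given $n,m,\gamma,\delta,\eta$ and $C>0$, $K_C([0,1]^n;\mathbb{R})$ is the set of continuous $f:[0,1]^n\to\mathbb{R}$ for which the integers $k_r(f)$ of the construction can be chosen with $k_r(f)\le C$ for all $r\ge1$. *)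

(* Defs.v *)
From HB Require Import structures.
From mathcomp Require Import all_boot all_order all_algebra.
From mathcomp Require Import all_classical all_reals all_analysis.

Set Implicit Arguments.
Unset Strict Implicit.
Unset Printing Implicit Defensive.

Import Order.TTheory GRing.Theory Num.Theory.
Import numFieldNormedType.Exports.

Local Open Scope classical_set_scope.
Local Open Scope ring_scope.

(** * Deep ReLU networks *)

(* The argument [d] is the number of values available to the next layer: the
   inputs together with the outputs of all the units of the earlier layers.
   A unit may thus be connected to any unit of any earlier layer; an absent
   connection is a zero weight. The last layer is one affine unit. *)
Inductive relu_net (R : realType) (d : nat) : Type :=
| OutputLayer of 'rV[R]_d & R
| HiddenLayer (k : nat) of 'M[R]_(k, d) & 'cV[R]_k & relu_net R (d + k).

Definition relu {R : realType} (x : R) : R := Num.max x 0.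

Fixpoint net_eval {R : realType} {d : nat} (N : relu_net R d) :
    'cV[R]_d -> R :=
  match N with
  | OutputLayer w b => fun x => (w *m x) ord0 ord0 + b
  | HiddenLayer _ A b N' =>
      fun x => net_eval N' (col_mx x (map_mx relu (A *m x + b)))
  end.

(* The input is not counted as a layer; the output layer is. *)
Fixpoint net_depth {R : realType} {d : nat} (N : relu_net R d) : nat :=
  match N with
  | OutputLayer _ _ => 1
  | HiddenLayer _ _ _ N' => (net_depth N').+1
  end.

Definition nonzeros {R : realType} {p q : nat} (A : 'M[R]_(p, q)) : nat :=
  #|[pred ij : 'I_p * 'I_q | A ij.1 ij.2 != 0]|.

(* Biases are counted as weights. *)
Fixpoint net_size {R : realType} {d : nat} (N : relu_net R d) : nat :=
  match N with
  | OutputLayer w b => nonzeros w + (b != 0)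
  | HiddenLayer _ A b N' => nonzeros A + nonzeros b + net_size N'
  end.

(** * Norms, moduli of continuity, univariate approximation *)

(* For functions that are continuous on [D], with [D] an interval or a cube,
   this is the L^oo norm. With values in the extended reals it is meaningful
   for unbounded functions too. *)
Definition supnorm {R : realType} {T : Type} (D : set T) (f : T -> R) : \bar R :=
  ereal_sup [set `|f x|%:E | x in D].

Definition unit_interval {R : realType} : set R := `[0, 1]%classic.

Definition unit_cube {R : realType} {n : nat} : set 'cV[R]_n :=
  [set x | forall i, 0 <= x i ord0 <= 1].

Definition is_modulus {R : realType} (g omega : R -> R) : Prop :=
  [/\ forall t : R, 0 <= t -> 0 <= omega t,
      forall s t : R, 0 <= s -> s <= t -> omega s <= omega t,
      omega 0 = 0,
      omega t @[t --> 0^'+] --> 0 &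
      forall x x', unit_interval x -> unit_interval x' ->
        `|g x - g x'| <= omega `|x - x'|].

Definition univariate_approx {R : realType} (c0 c1 c2 : R) : Prop :=
  forall g omega : R -> R,
    {within unit_interval, continuous g} -> is_modulus g omega ->
    forall W : R, 1 <= W ->
      exists N : relu_net R 1,
        [/\ (net_size N)%:R <= W,
            (net_depth N)%:R <= c0 * W &
            (supnorm (unit_interval)
               (fun x => (g x - net_eval N (const_mx x))%R)
             <= (c1 * omega (c2 * W ^- 2))%:E)%E].

(** * The inner function *)

Definition beta (n l : nat) : nat := \sum_(i < l) n ^ i.

Definition shift (R : realType) (gam : nat) : R :=
  (gam%:R * (gam%:R - 1))^-1.

(* The index [i : 'I_n] starts at 0, hence [i] in place of [i - 1]; the term of
   rank [l] of the series is the one for l + 1. *)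
Definition lambda (R : realType) (n gam : nat) (i : 'I_n) : R :=
  if i == 0%N :> nat then 1
  else limn (series (fun l : nat => gam%:R ^- (i * beta n l.+1) : R)).

(* [psi_grid R n gam k i] is psi_k (i gam^-k) for k >= 1 and 0 <= i <= gam ^ k.
   With i = q gam + c, the last digit of d = i gam^-k is c, and
   d - c gam^-k = q gam^-(k-1). When c = gam - 1, the last digit of d - gam^-k
   is gam - 2, so that psi_k (d - gam^-k) is given by the first case, and
   d + gam^-k = (q + 1) gam^-(k-1). The value for k = 0 is not used. *)
Fixpoint psi_grid (R : realType) (n gam k i : nat) : R :=
  match k with
  | 0 => i%:R
  | 1 => i%:R / gam%:R
  | k'.+1 =>
      if i == (gam ^ k)%N then 1 else
      let q := (i %/ gam)%N in
      let c := (i %% gam)%N in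
      let low_digit (b : nat) : R :=
        psi_grid R n gam k' q + b%:R * gam%:R ^- beta n k in
      if (c < gam - 1)%N then low_digit c
      else (low_digit (gam - 2)%N + psi_grid R n gam k' q.+1) / 2
  end.

(* The truncation to k digits of x is floor(x gam^k) gam^-k. *)
Definition psi01 (R : realType) (n gam : nat) (x : R) : R :=
  limn (fun k => psi_grid R n gam k (Num.truncn (x * gam%:R ^+ k))).

(* Meaningful for x in [0, 2). *)
Definition psi (R : realType) (n gam : nat) (x : R) : R :=
  if x < 1 then psi01 n gam x else psi01 n gam (x - 1) + 1.

(** * The outer functions *)

Definition sigma {R : realType} (x : R) : R := Num.min (Num.max x 0) 1.

Definition xi (R : realType) (n gam : nat) (d : 'cV[R]_n) : R :=
  \sum_(i < n) lambda R gam i * psi n gam (d i ord0).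

Definition bgap (R : realType) (n gam k : nat) : R :=
  limn (series (fun l : nat => gam%:R ^- beta n (k + l.+1) : R))
  * \sum_(i < n) lambda R gam i.

Definition theta (R : realType) (n gam k : nat) (d : 'cV[R]_n) (x : R) : R :=
  sigma (gam%:R ^+ beta n k.+1 * (x - xi gam d) + 1)
  - sigma (gam%:R ^+ beta n k.+1
           * (x - xi gam d - (gam%:R - 2) * bgap R n gam k)).

Definition grid_point (R : realType) (n gam k : nat)
    (d : {ffun 'I_n -> 'I_(gam ^ k)}) : 'cV[R]_n :=
  \col_i ((d i)%:R / gam%:R ^+ k).

(* j sum_(i = 2)^k gam^-i *)
Definition grid_shift (R : realType) (gam j k : nat) : R :=
  j%:R * \sum_(2 <= i < k.+1) gam%:R ^- i.

Definition superpose (R : realType) (n m gam : nat) (phi : nat -> R -> R)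
    (x : 'cV[R]_n) : R :=
  \sum_(j < m.+1) phi j (xi gam (x + const_mx (j%:R * shift R gam))).

(* In what follows, [ks r] is k_(r + 1), the integer that is chosen at
   iteration r + 1 from e_r, and [outer r j] is phi_j^r. *)
Fixpoint outer (R : realType) (n m gam : nat) (f : 'cV[R]_n -> R)
    (ks : nat -> nat) (r : nat) : nat -> R -> R :=
  match r with
  | 0 => fun _ _ => 0
  | r'.+1 => fun j x =>
      outer m gam f ks r' j x
      + (m%:R + 1)^-1 *
        \sum_(d : {ffun 'I_n -> 'I_(gam ^ ks r')})
          (f (grid_point R d)
           - superpose m gam (outer m gam f ks r') (grid_point R d))
          * theta gam (ks r')
              (grid_point R d + const_mx (grid_shift R gam j (ks r'))) x
  end.

Definition approximant (R : realType) (n m gam : nat) (f : 'cV[R]_n -> R)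
    (ks : nat -> nat) (r : nat) : 'cV[R]_n -> R :=
  superpose m gam (outer m gam f ks r).

Definition residual (R : realType) (n m gam : nat) (f : 'cV[R]_n -> R)
    (ks : nat -> nat) (r : nat) (x : 'cV[R]_n) : R :=
  f x - approximant m gam f ks r x.

Definition admissible (R : realType) (n m gam : nat) (delta : R)
    (f : 'cV[R]_n -> R) (ks : nat -> nat) : Prop :=
  forall r : nat,
    (1 <= ks r)%N /\
    forall x x' : 'cV[R]_n, unit_cube x -> unit_cube x' ->
      (forall i, `|x i ord0 - x' i ord0| <= gam%:R ^- ks r) ->
      (`|residual m gam f ks r x - residual m gam f ks r x'|%R%:E
       <= delta%:E * supnorm (unit_cube) (residual m gam f ks r))%E.

Definition KC (R : realType) (n m gam : nat) (delta C : R) :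
    set ('cV[R]_n -> R) :=
  [set f | {within unit_cube, continuous f} /\
           exists ks : nat -> nat,
             admissible m gam delta f ks /\ forall r, (ks r)%:R <= C].

(** * The constants of the error bound *)

Definition log2 {R : realType} (x : R) : R := ln x / ln 2.

Definition hexp (R : realType) (n : nat) : R := (1 + log2 (n%:R + 1)) / 2.

Definition rsteps {R : realType} (eta eps : R) : int :=
  Num.ceil (ln (2 * eps^-1) / ln (eta^-1)).

(* (2 n + 2) ^ (2 n ^ C) *)
Definition growth {R : realType} (n : nat) (C : R) : R :=
  (2 * n%:R + 2) `^ (2 * n%:R `^ C).

Definition const3 {R : realType} (c1 c2 : R) (n : nat) : R :=
  ((2 * n%:R + 5) * c1) `^ hexp R n * c2 `^ (1 / 2).

Definition const4 {R : realType} (c1 c2 C : R) (n : nat) (r : int) : R :=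
  (c1 * c2 / n%:R * r%:~R * growth n C) `^ (1 / 2).

Definition tconst3 {R : realType} (c1 c2 C : R) (n : nat) (r : int) : R :=
  ((4 * n%:R + 2) / n%:R * r%:~R * growth n C) `^ hexp R n * const3 c1 c2 n.

Definition tconst4 {R : realType} (c1 c2 C : R) (n : nat) (r : int) : R :=
  (8 * n%:R + 4) `^ (1 / 2) * const4 c1 c2 C n r.

(* Main.v *)
(* If the integers k_r stay bounded, then k_(r+1) <= k_r for some r. The bumps
   theta of one layer have almost disjoint supports, so that e_(r+1) vanishes on
   the grid of level k_r; its oscillation on the cells of that grid is at most
   delta times its norm, hence e_(r+1) = 0. Conversely, if k_r >= 2, then
   e_(r+1) = 0 forces e_r = 0: in the cell of a grid point where |e_r| is maximal
   there is a point at which two of the m + 1 outer functions vanish, and there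
   |e_r| has lost the fraction 2 / (m + 1) of its maximum, more than delta allows.
   Descending, f is on the cube equal to its own layer of level 1.
   The outer functions of this layer are Lipschitz and psi is Hoelder continuous
   with exponent ln 2 / ln (2 n + 2). Property (Y), applied to these 2 n + 1 outer
   and n (2 n + 1) inner functions, gives networks that compose without any
   further weight, as each inner sum is computed by a single ReLU unit. *)

Require Import Defs.
From HB Require Import structures.
From mathcomp Require Import all_boot all_order all_algebra.
From mathcomp Require Import all_classical all_reals all_analysis.
From mathcomp Require Import zify ring lra.
Import Order.TTheory GRing.Theory Num.Theory.
Import numFieldNormedType.Exports.
Local Open Scope classical_set_scope.
Local Open Scope ring_scope.

Set Implicit Arguments.
Unset Strict Implicit.
Unset Printing Implicit Defensive.

(** * The inner function on the grids *)

(** On a shifted grid of level k, two values of xi differ by an integer multiple [lat] of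
    [g ^- (n * beta n k)], up to the tails of the series lambda. A bump with its two flanks is at
    least as long as this unit, so injectivity of xi on the grid does not separate the bumps: a
    difference of one unit has to be excluded. For k >= 2 it is, because the last [n ^ (k - 1)]
    digits of psi_k encode, up to a halving, a number below [g - 1], and congruences modulo powers
    of g contradict one unit. At level 1 this block is a single digit and one unit occurs; there the
    sign of the largest tail decides, which is why the second coordinate is special. Property (Y)
    asks for W >= 1 and for functions on [0, 1]. The budgets of the statement reach 1 because (Y)
    itself bounds c1 and c2 from below; the inner sums, which range up to 3/2, are halved. The
    Hoelder exponent of psi is the inverse of [2 * hexp R n], hence the power of epsilon. The factor
    [growth n C] dominates the inverse flank [(2 n + 2) ^ (n + 1)] of level 1, since k_r >= 1 forces
    C >= 1. *)

Section InnerFunctionIntegers.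
Local Open Scope nat_scope.

(* [psi_k (i g^-k) = psiN n g k i / g ^ beta n k]; the half is exact for even [g]. *)
Fixpoint psiN (n g k i : nat) : nat :=
  if k is k'.+1 then
    let q := i %/ g in
    let c := i %% g in
    if c < g - 1 then psiN n g k' q * g ^ (n ^ k') + c
    else ((psiN n g k' q + psiN n g k' q.+1) * g ^ (n ^ k') + (g - 2))./2
  else i.

Lemma betaS n k : beta n k.+1 = beta n k + n ^ k.
Proof. by rewrite /beta big_ord_recr. Qed.

Lemma betaSl n k : beta n k.+1 = (n * beta n k).+1.
Proof.
rewrite /beta big_ord_recl expn0 big_distrr /= add1n; congr _.+1.
by apply: eq_bigr => i _; rewrite /bump /= add1n expnS.
Qed.

Lemma beta0 n : beta n 0 = 0.
Proof. by rewrite /beta big_ord0. Qed.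

Lemma beta1 n : beta n 1 = 1.
Proof. by rewrite betaS beta0 expn0. Qed.

Lemma beta_geD n k l : 2 <= n -> beta n k + n ^ k * l <= beta n (k + l).
Proof.
move=> n2; elim: l => [|l IHl]; first by rewrite muln0 !addn0.
rewrite addnS betaS mulnS.
have : n ^ k <= n ^ (k + l) by rewrite leq_exp2l // leq_addr.
lia.
Qed.

Variables (n g : nat).
Hypotheses (n2 : 2 <= n) (g6 : 6 <= g) (g_even : ~~ odd g).

Lemma g_leq_expn k : g <= g ^ (n ^ k).
Proof. by rewrite -{1}(expn1 g) leq_exp2l ?expn_gt0; lia. Qed.

Lemma psiN_low k q c : c < g - 1 ->
  psiN n g k.+1 (q * g + c) = psiN n g k q * g ^ (n ^ k) + c.
Proof.
move=> cg; rewrite /= divnMDl ?modnMDl; last lia.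
by rewrite divn_small ?modn_small ?addn0 ?cg; lia.
Qed.

Lemma psiN_high k q :
  2 * psiN n g k.+1 (q * g + (g - 1)) =
    (psiN n g k q + psiN n g k q.+1) * g ^ (n ^ k) + (g - 2).
Proof.
rewrite /= divnMDl ?modnMDl; last lia.
rewrite divn_small ?modn_small ?addn0 ?ltnn; try lia.
rewrite mul2n halfK (_ : odd _ = false) ?subn0 //.
rewrite oddD oddM oddX expn_eq0 (negbTE g_even) /=.
by rewrite (_ : n == 0 = false) /= ?andbF ?oddB ?(negbTE g_even) //; lia.
Qed.

Lemma psiN_refine k i : psiN n g k.+1 (i * g) = psiN n g k i * g ^ (n ^ k).
Proof. by rewrite -[i * g]addn0 psiN_low ?addn0; lia. Qed.

(** Integer form of psi(x + 1) = psi(x) + 1. It lets the indices of shifted grids run past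
    [g ^ k]. *)
Lemma psiN_period k i : psiN n g k (i + g ^ k) = psiN n g k i + g ^ beta n k.
Proof.
elim: k i => [|k IHk] i; first by rewrite beta0 !expn0.
have g0 : 0 < g by lia.
rewrite (divn_eq i g); set q := i %/ g; set c := i %% g.
have cg : c < g by rewrite ltn_mod.
have -> : q * g + c + g ^ k.+1 = (q + g ^ k) * g + c by rewrite expnS; lia.
have [cl|cl] := ltnP c (g - 1).
  by rewrite !psiN_low // IHk betaS expnD; lia.
have -> : c = g - 1 by lia.
apply/eqP; rewrite -(eqn_pmul2l (isT : 0 < 2)) mulnDr !psiN_high.
by rewrite -addSn !IHk betaS expnD; apply/eqP; lia.
Qed.

(** The delicate steps are those into and out of the digit [g - 1]: twice such a step is the gap of
    the parents times [g ^ (n ^ k)], minus [g - 2], and this is positive because the parents differ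
    by at least 1 and [g <= g ^ (n ^ k)]. *)
Lemma psiN_ltS k i : psiN n g k i < psiN n g k i.+1.
Proof.
elim: k i => [|k IHk] i //.
have g0 : 0 < g by lia.
rewrite (divn_eq i g); set q := i %/ g; set c := i %% g.
have cg : c < g by rewrite ltn_mod.
have gg := g_leq_expn k.
have [cl|cl] := ltnP c.+1 (g - 1).
  by rewrite -addnS !psiN_low //; lia.
have IHq := IHk q.
have Hq : (psiN n g k q).+1 * g ^ (n ^ k) <= psiN n g k q.+1 * g ^ (n ^ k).
  by rewrite leq_mul2r IHq orbT.
have [cl2|cl2] := ltnP c (g - 1).
  rewrite -addnS (_ : c.+1 = g - 1); last lia.
  rewrite psiN_low //; have := psiN_high k q; lia.
have -> : c = g - 1 by lia.
have -> : (q * g + (g - 1)).+1 = q.+1 * g by lia.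
rewrite psiN_refine; have := psiN_high k q; lia.
Qed.

Lemma psiN_mono k : {mono psiN n g k : i j / i <= j}.
Proof.
apply: leq_mono => i j; elim: j => // j IHj.
rewrite ltnS leq_eqVlt => /predU1P[->|/IHj]; first exact: psiN_ltS.
by move=> /ltn_trans; apply; exact: psiN_ltS.
Qed.

Lemma psiN_inj k : injective (psiN n g k).
Proof. exact: (incn_inj (psiN_mono k)). Qed.

(** Refining by one level appends a block of [n ^ k] digits that is almost empty: it holds the small
    number [nu]. The doubling removes the half of the averaging rule, for which [nu] is half of
    [g - 2]. *)
Lemma psiN_half_mod k i : exists nu t,
  nu <= g - 2 /\ 2 * psiN n g k.+1 i = 2 * nu + t * g ^ (n ^ k).
Proof.
have g0 : 0 < g by lia.
rewrite (divn_eq i g); set q := i %/ g; set c := i %% g.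
have cg : c < g by rewrite ltn_mod.
have [cl|cl] := ltnP c (g - 1).
  exists c, (2 * psiN n g k q); split; first lia.
  by rewrite psiN_low //; lia.
exists (g - 2)./2, (psiN n g k q + psiN n g k q.+1).
split; first by rewrite leq_half_double; lia.
have -> : c = g - 1 by lia.
rewrite psiN_high mul2n halfK oddB ?(negbTE g_even) //=; lia.
Qed.

End InnerFunctionIntegers.

(** * Integer combinations of digits in base [B] *)

Section IntegerCombinations.

Lemma dvdz_quotient (d m : int) : (d %| m)%Z -> exists q : int, m = q * d.
Proof. by case/dvdzP => q ->; exists q. Qed.

Lemma dvdz_norm_lt (d x : int) : (d %| x)%Z -> `|x| < d -> x = 0.
Proof.
case/dvdz_quotient => q ->; have [-> _|q0] := eqVneq q 0; first by rewrite mul0r.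
rewrite normrM => qd; have d0 : 0 < d by apply: le_lt_trans qd; rewrite mulr_ge0.
have q1 : 1 <= `|q| by lia.
move: qd; rewrite (gtr0_norm d0) ltNge -{1}[d]mul1r ler_pM2r //.
by rewrite q1.
Qed.

(** Modulo [B] only the last term survives; its unit is invertible, so its digit is a multiple of
    [B] smaller than [B], hence 0. Dividing by [B] gives the induction. *)
Lemma coprimez_digit_sum_eq0 (p : nat) (D U : nat -> int) (B : int) :
  (forall i, (i < p)%N -> coprimez B (U i)) ->
  (forall i, (i < p)%N -> `|D i| < B) ->
  \sum_(i < p) D i * U i * B ^+ (p.-1 - i) = 0 ->
  forall i, (i < p)%N -> D i = 0.
Proof.
elim: p => [|p IHp] // cop Dlt.
rewrite big_ord_recr /= subnn expr0 mulr1.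
have -> : \sum_(i < p) D i * U i * B ^+ (p - i) =
    B * \sum_(i < p) D i * U i * B ^+ (p.-1 - i).
  rewrite big_distrr /=; apply: eq_bigr => i _.
  have -> : (p - i = (p.-1 - i).+1)%N by have := ltn_ord i; lia.
  by rewrite exprS; ring.
move=> sum0.
have B0 : 0 < B by apply: le_lt_trans (Dlt p (ltnSn p)).
have Dp0 : D p = 0.
  have : (B %| D p * U p)%Z.
    apply/dvdzP; exists (- \sum_(i < p) D i * U i * B ^+ (p.-1 - i)); move: sum0.
    set S := \sum_(i < p) _ => sum0.
    by rewrite mulNr [_ * B]mulrC; apply/eqP; rewrite -addr_eq0 addrC sum0.
  rewrite Gauss_dvdzl ?cop // => /dvdz_quotient[q Dq].
  have := Dlt p (ltnSn p); rewrite Dq normrM (gtr0_norm B0).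
  rewrite -[ltRHS]mul1r ltr_pM2r // => q1.
  have -> : q = 0 by lia.
  by rewrite mul0r.
move: sum0; rewrite Dp0 mul0r addr0 => /eqP.
rewrite mulf_eq0 (gt_eqF B0) /= => /eqP sum0 i.
rewrite ltnS leq_eqVlt => /predU1P[-> //|ip].
by apply: IHp => // j jp; [apply: cop|apply: Dlt]; apply: ltnW.
Qed.

Lemma norm_digit_sum_lt (p : nat) (D : nat -> int) (B : int) :
  (forall i, (i < p)%N -> `|D i| < B) ->
  `|\sum_(i < p) D i * B ^+ (p.-1 - i)| < B ^+ p.
Proof.
elim: p => [|p IHp] Dlt; first by rewrite big_ord0 normr0.
have Dp := Dlt p (ltnSn p).
rewrite big_ord_recr /= subnn expr0 mulr1.
have -> : \sum_(i < p) D i * B ^+ (p - i) =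
    B * \sum_(i < p) D i * B ^+ (p.-1 - i).
  rewrite big_distrr /=; apply: eq_bigr => i _.
  have -> : (p - i = (p.-1 - i).+1)%N by have := ltn_ord i; lia.
  by rewrite exprS; ring.
have {IHp} := IHp (fun i ip => Dlt i (ltnW ip)).
set S := \sum_(i < p) _; rewrite exprS; set C := B ^+ p => SC.
have := ler_normD (B * S) (D p).
have B0 : 0 < B by apply: le_lt_trans Dp.
have : B * `|S| <= B * (C - 1) by rewrite ler_pM2l // lerBrDr; lia.
by rewrite normrM (gtr0_norm B0); lia.
Qed.

(* The number of units at the place [B ^ (n - 1)] is read off modulo
   [B ^ (n - 2) g ^ (b1 + 2)]: besides [D 1] and a carry, only the digit
   [g ^ (b1 + 1)] coming from [D (n - 1) * U (n - 1)] survives there. *)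
Lemma digit_sum_neq_unit (m g b1 : nat) (D U V : nat -> int) (s nu t : int) :
  let n := m.+3 in
  let B : int := (g%:Z) ^+ (n * b1).+1 in
  let a := (n.-1 * b1).+1 in
  (6 <= g)%N -> (1 <= b1)%N ->
  (forall i, (1 <= i)%N -> (i < n)%N ->
     U i = 1 + g%:Z ^+ (i * a) * (1 + g%:Z * V i)) ->
  (forall i, (i < n)%N -> `|D i| < B) ->
  `|nu| <= g%:Z - 2 -> 2 * D 1%N = 2 * nu + t * g%:Z ^+ a ->
  `|s| = 1 -> \sum_(i < n) D i * U i * B ^+ (n.-1 - i) != s.
Proof.
move=> n B a g6 b1_gt0 U_eq Dlt nu_le D1_eq s1; apply/eqP => sum_s.
set Z := g%:Z in B U_eq Dlt nu_le D1_eq sum_s.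
have Z6 : 6 <= Z by rewrite /Z lez_nat.
have B0 : 0 < B by apply: exprn_gt0; lia.
(* The exponent is [(n - 1) * a - (n - 2) * (n * b1 + 1) = b1 + 1]: the leading correction in the
   last unit is [Z ^ t0 * B ^ m.+1], just below the modulus. *)
pose t0 := b1.+1.
pose T := \sum_(i < m.+1) D i.+2 * B ^+ (m - i).
have Mdvd : (B ^+ m.+1 * Z ^+ t0.+1 %|
    D 1%N * B ^+ m.+1 + T + D m.+2 * Z ^+ t0 * B ^+ m.+1 - s)%Z.
  rewrite -sum_s big_ord_recl big_ord_recl big_ord_recr /= subnn expr0 mulr1.
  rewrite /bump /= !add1n subn1 /= /T big_ord_recr /= subnn expr0 mulr1.
  rewrite (U_eq 1%N) // (U_eq m.+2) //.
  have -> : \sum_(i < m) D (1 + (1 + i))%N * U (1 + (1 + i))%N * B ^+ (m.+2 - (1 + (1 + i)))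
    = \sum_(i < m) D i.+2 * B ^+ (m - i)
     + \sum_(i < m) D i.+2 * (U i.+2 - 1) * B ^+ (m - i).
    rewrite -big_split; apply: eq_bigr => i _ /=; rewrite !add1n.
    by rewrite !subSS; ring.
  set S1 := \sum_(i < m) _; set S2 := \sum_(i < m) _.
  have S2dvd : (B ^+ m.+1 * Z ^+ t0.+1 %| S2)%Z.
    apply: rpred_sum => i _.
    rewrite (U_eq i.+2) //; last by have := ltn_ord i; lia.
    rewrite addrAC subrr add0r.
    have -> : D i.+2 * (Z ^+ (i.+2 * a) * (1 + Z * V i.+2)) * B ^+ (m - i) =
      (D i.+2 * (1 + Z * V i.+2)) * (Z ^+ (i.+2 * a) * B ^+ (m - i)) by ring.
    apply: dvdz_mull; rewrite /B -!exprM -!exprD; apply: dvdz_exp2l.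
    have := ltn_ord i; rewrite /a /n /t0 /= => im.
    have : (b1 <= (m - i) * b1)%N by rewrite leq_pmull //; lia.
    by rewrite mulnBl; nia.
  have -> : D 0 * U 0 * B ^+ m.+2 +
      (D 1%N * (1 + Z ^+ (1 * a) * (1 + Z * V 1%N)) * B ^+ m.+1 +
       (S1 + S2 + D m.+2 * (1 + Z ^+ (m.+2 * a) * (1 + Z * V m.+2)))) =
    D 1%N * B ^+ m.+1 + (S1 + D m.+2) + D m.+2 * Z ^+ (m.+2 * a) +
     (S2 + (D 0 * U 0 * B ^+ m.+2 + D 1%N * (1 + Z * V 1%N) * (B ^+ m.+1 * Z ^+ a)
      + D m.+2 * V m.+2 * (Z ^+ (m.+2 * a) * Z))) by rewrite mul1n; ring.
  have -> : Z ^+ (m.+2 * a) = Z ^+ t0 * B ^+ m.+1.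
    rewrite /B -exprM -exprD; congr (_ ^+ _); rewrite /t0 /a /n /=; nia.
  rewrite mulrA; set X := _ + (S1 + _) + _; rewrite opprD addrA subrr sub0r rpredN.
  apply: rpredD => //; apply: rpredD; first apply: rpredD.
  - apply: dvdz_mull; rewrite (exprS _ m.+1) mulrC; apply: dvdz_mul => //.
    by apply: dvdz_exp2l; rewrite /t0 /n; nia.
  - apply: dvdz_mull; apply: dvdz_mul => //; apply: dvdz_exp2l.
    by rewrite /t0 /a /n /=; nia.
  - apply: dvdz_mull; rewrite mulrAC -exprSr mulrC; exact: dvdzz.
have Tlt : `|T| < B ^+ m.+1.
  by apply: (@norm_digit_sum_lt m.+1 (fun i => D i.+2)) => i im; apply: Dlt.
(* The digits of index at least 2 must sum to [s] up to a carry [q0] into the place of [D 1]; since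
   [T] is smaller than [B ^ m.+1], this carry is -1, 0 or 1. *)
have /dvdz_quotient[q0 q0E] : (B ^+ m.+1 %| T - s)%Z.
  have := dvdz_trans (dvdz_mulr _ (dvdzz _)) Mdvd.
  have -> : D 1%N * B ^+ m.+1 + T + D m.+2 * Z ^+ t0 * B ^+ m.+1 - s =
    (T - s) + (D 1%N + D m.+2 * Z ^+ t0) * B ^+ m.+1 by ring.
  by rewrite rpredDr //; apply: dvdz_mull.
have Bm0 : 0 < B ^+ m.+1 by apply: exprn_gt0.
have q1 : `|q0| <= 1.
  have : `|q0| * B ^+ m.+1 <= 1 * B ^+ m.+1.
    rewrite -{1}(gtr0_norm Bm0) -normrM -q0E mul1r.
    by have := ler_normB T s; lia.
  by rewrite ler_pM2r.
(* Modulo [Z] all of [T] but its last digit vanishes, so that the last digit is congruent to [s]. *)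
have /dvdz_quotient[q2 q2E] : (Z %| D m.+2 - s)%Z.
  have ZB : (Z %| B)%Z by rewrite /B exprS dvdz_mulr ?dvdzz.
  have : (Z %| T - s)%Z by rewrite q0E exprSr mulrA dvdz_mull.
  rewrite /T big_ord_recr /= subnn expr0 mulr1 -addrA rpredDl //.
  apply: rpred_sum => i _.
  apply: dvdz_mull; apply: dvdz_trans ZB _.
  by rewrite -subnSK ?ltn_ord // exprS dvdz_mulr ?dvdzz.
move: Mdvd.
have -> : D 1%N * B ^+ m.+1 + T + D m.+2 * Z ^+ t0 * B ^+ m.+1 - s =
  B ^+ m.+1 * (D 1%N + q0 + D m.+2 * Z ^+ t0).
  have -> : T = s + q0 * B ^+ m.+1 by rewrite -q0E; ring.
  by ring.
rewrite dvdz_mul2l; last by rewrite gt_eqF.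
case/dvdz_quotient => q3 q3E.
have a_eq : Z ^+ a = Z ^+ t0.+1 * Z ^+ (a - t0.+1).
  by rewrite -exprD subnKC // /a /t0 /n /=; nia.
have t2 : Z ^+ 2 <= Z ^+ t0 by rewrite ler_eXn2l ?/t0; lia.
have DE : D m.+2 = s + q2 * Z by rewrite -q2E; ring.
move: q3E a_eq t2 D1_eq; rewrite DE.
rewrite exprS; set G := Z ^+ t0; set E := Z ^+ (a - _) => q3E -> t2 D1_eq.
have key : 2 * nu + 2 * q0 + 2 * s * G = (2 * q3 - t * E - 2 * q2) * (Z * G).
  have : 2 * D 1%N + 2 * q0 + 2 * ((s + q2 * Z) * G) = 2 * q3 * (Z * G).
    by rewrite -mulrA -q3E; ring.
  by rewrite D1_eq => key; rewrite !mulrBl -key; ring.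
move: key; set q := _ - _ - _ => key.
have Z0 : 0 < Z by lia.
have G1 : Z * 6 <= G by rewrite (le_trans _ t2) // expr2 ler_pM2l.
have G0 : 0 < G by lia.
have ZG : 6 * G <= Z * G by rewrite ler_pM2r.
have sG : `|s * G| = G by rewrite normrM s1 mul1r gtr0_norm.
(* The left side is a multiple of [Z * G] but smaller than it, hence 0. This is absurd, as
   [2 * s * G] has size at least [12 * Z], while the other two terms together stay below [2 * Z]. *)
have : 2 * nu + 2 * q0 + 2 * (s * G) = 0.
  apply: (@dvdz_norm_lt (Z * G)); first by rewrite mulrA key dvdz_mull ?dvdzz.
  by move: q1 nu_le Z6 G1 sG ZG; clear; set W := s * G; set K := Z * G; lia.
by move: q1 nu_le Z6 G1 sG; clear; set W := s * G; lia.
Qed.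

(** The case n = 2, where the carry goes into the digit of index 0. Modulo [g ^ a], [D1] is [s], so
    [D1 = s - X * g ^ a]; a second reduction gives [X = s * V + Y * g ^ (a - 1)] with [Y] in {-1, 0,
    1}. As [V] is 1 modulo g, this makes [D0] congruent to [Y + s * g] modulo [g ^ 2], whereas the
    half-digit hypothesis makes [2 * D0] congruent to [2 * nu]: the term [2 * s * g] is too large
    for that. *)
Lemma digit_sum2_neq_unit (g a : nat) (D0 D1 V s nu t Y' : int) :
  (6 <= g)%N -> (2 <= a)%N ->
  `|D1| < g%:Z ^+ a.*2.-1 -> 0 <= V -> V < g%:Z ^+ a.-1 ->
  V = 1 + g%:Z * Y' ->
  `|nu| <= g%:Z - 2 -> 2 * D0 = 2 * nu + t * g%:Z ^+ a ->
  `|s| = 1 ->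
  D0 * g%:Z ^+ a.*2.-1 + D1 * (1 + g%:Z ^+ a * V) != s.
Proof.
move=> g6 a2 D1lt V0 Vlt V_eq nu_le D0_eq s1; apply/eqP => sum_s.
set Z := g%:Z in D1lt Vlt V_eq nu_le D0_eq sum_s.
have Z6 : 6 <= Z by rewrite /Z lez_nat.
case: a a2 => [//|[//|a]] _ in D1lt Vlt D0_eq sum_s *.
have e1 : (a.+2.*2.-1 = a.+2 + a.+1)%N by lia.
rewrite e1 /= in D1lt Vlt D0_eq sum_s.
have /dvdz_quotient[X X_eq] : (Z ^+ a.+2 %| s - D1)%Z.
  apply/dvdzP; exists (D0 * Z ^+ a.+1 + D1 * V).
  by rewrite -sum_s exprD; ring.
have Z0 : 0 < Z by lia.
have Za0 : 0 < Z ^+ a.+2 by apply: exprn_gt0.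
have Zb0 : 0 < Z ^+ a.+1 by apply: exprn_gt0.
have D1_eq : D1 = s - X * Z ^+ a.+2 by rewrite -X_eq; ring.
have X_eq2 : X = s * V + (D0 - X * Z * V) * Z ^+ a.+1.
  apply: (mulIf (lt0r_neq0 Za0)).
  have : D0 * Z ^+ (a.+2 + a.+1) + D1 * (1 + Z ^+ a.+2 * V) - s = 0.
    by rewrite sum_s subrr.
  rewrite {1}D1_eq exprD => sum0; apply/eqP; rewrite eq_sym -subr_eq0 -sum0.
  by apply/eqP; rewrite [Z ^+ a.+2]exprS; ring.
have [Y Y_eq] : exists Y : int, Y = D0 - X * Z * V by eexists.
rewrite -Y_eq in X_eq2.
have Xle : `|X| <= Z ^+ a.+1.
  have : `|X| * Z ^+ a.+2 < (Z ^+ a.+1 + 1) * Z ^+ a.+2.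
    rewrite -{1}(gtr0_norm Za0) -normrM -X_eq mulrDl mul1r -exprD addnC.
    have := ler_normB s D1; lia.
  by rewrite ltr_pM2r //; lia.
have Y1 : `|Y| <= 1.
  have : `|Y| * Z ^+ a.+1 < 2 * Z ^+ a.+1.
    rewrite -{1}(gtr0_norm Zb0) -normrM.
    have -> : Y * Z ^+ a.+1 = X - s * V by rewrite {1}X_eq2; ring.
    by have := ler_normB X (s * V); rewrite normrM s1 mul1r (ger0_norm V0); lia.
  by rewrite ltr_pM2r //; lia.
have D0_eq2 : D0 = Y + s * Z +
    Z ^+ 2 * (s * Y' * (1 + V) + Y * Z ^+ a * V).
  have -> : D0 = Y + X * V * Z by rewrite Y_eq; ring.
  by rewrite {1}X_eq2 [Z ^+ a.+1]exprS V_eq; ring.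
move: D0_eq; rewrite D0_eq2 (_ : Z ^+ a.+2 = Z ^+ a * Z ^+ 2); last first.
  by rewrite -exprD addn2.
move: (_ + Y * _ * V) => w D0_eq.
have key : 2 * Y + 2 * (s * Z) - 2 * nu = (t * Z ^+ a - 2 * w) * Z ^+ 2.
  have -> : 2 * Y + 2 * (s * Z) - 2 * nu =
    2 * (Y + s * Z + Z ^+ 2 * w) - 2 * nu - 2 * (Z ^+ 2 * w) by ring.
  by rewrite D0_eq; ring.
have sZ : `|s * Z| = Z by rewrite normrM s1 mul1r gtr0_norm.
have ZZ : 6 * Z <= Z ^+ 2 by rewrite expr2 ler_pM2r.
have ZZ0 : 0 < Z ^+ 2 by apply: exprn_gt0.
have : 2 * Y + 2 * (s * Z) - 2 * nu = 0.
  apply: (@dvdz_norm_lt (Z ^+ 2)); first by rewrite key dvdz_mull ?dvdzz.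
  by move: Y1 nu_le Z6 sZ ZZ; clear; set W := s * Z; set K := Z ^+ 2; lia.
by move: Y1 nu_le Z6 sZ; clear; set W := s * Z; lia.
Qed.

End IntegerCombinations.

(** * Lattice differences of two grid points *)

Section GridLattice.

(** A negative second digit needs a positive leading one to compensate it; a total as small as 1
    then requires the full borrow [1 - B], since the remaining digits contribute less than one unit
    of the second place. *)
Lemma digit_sum_unit_second (m : nat) (D : nat -> int) (B : int) :
  (forall i, (i < m.+2)%N -> `|D i| < B) -> D 1%N < 0 ->
  \sum_(i < m.+2) D i * B ^+ (m.+1 - i) = 1 -> D 1%N = 1 - B.
Proof.
move=> Dlt D1_lt0; rewrite big_ord_recl big_ord_recl /bump /= subn1 subn0 /=.
have := @norm_digit_sum_lt m (fun i => D i.+2) B.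
have -> : \sum_(i < m) D (1 + (1 + i))%N * B ^+ (m.+1 - (1 + (1 + i))) =
    \sum_(i < m) D i.+2 * B ^+ (m.-1 - i).
  apply: eq_bigr => i _; rewrite !add1n !subSS; congr (_ * _ ^+ _).
  by have := ltn_ord i; lia.
set T := \sum_(i < m) _ => /(_ (fun i im => Dlt i.+2 im)) Tlt sum1.
have D1 := Dlt 1%N isT; have B0 : 0 < B by lia.
have Bm : 0 < B ^+ m by apply: exprn_gt0.
have D0_gt0 : 0 < D 0.
  rewrite -(pmulr_lgt0 _ (exprn_gt0 m.+1 B0)).
  have : D 1%N * B ^+ m <= -1 * B ^+ m by rewrite ler_pM2r //; lia.
  by move: sum1 Tlt; set u := _ * B ^+ m.+1; set v := _ * B ^+ m; lia.
have : B ^+ m.+1 <= D 0 * B ^+ m.+1.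
  by rewrite -[leLHS]mul1r ler_pM2r ?exprn_gt0 //; lia.
have [//|D1_neq] := eqVneq (D 1%N) (1 - B).
have : (2 - B) * B ^+ m <= D 1%N * B ^+ m by rewrite ler_pM2r //; lia.
move: sum1; rewrite exprS mulrBl.
by set u := D 0 * _; set v := D 1%N * _; set w := B * _; lia.
Qed.

(** Numerator, over [g ^ (i * beta n k)], of the first [k] terms of the series lambda of index [i],
    written in Horner form so that it is visibly 1 modulo g for positive [i] and [k]. *)
Fixpoint latU (n g k i : nat) : nat :=
  if k is k'.+1 then (1 + g ^ (i * n ^ k') * latU n g k' i)%N else 0%N.

Definition lat_unit (n g k i : nat) : int :=
  if i is 0 then 1 else (latU n g k i)%:Z.

(* When each series lambda_i is cut after k terms, the difference of
   [sum_i lambda_i psi_k(d_i)] at two grid points is [g ^- (n * beta n k)] times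
   [lat n g k D], where [D] is the difference of the integers [psiN]. *)
Definition lat (n g k : nat) (D : nat -> int) : int :=
  \sum_(i < n) D i * lat_unit n g k i * (g ^ beta n k)%:Z ^+ (n.-1 - i).

Lemma latU_lt n g k : (0 < n)%N -> (2 <= g)%N -> (latU n g k 1 < g ^ beta n k)%N.
Proof.
move=> n0 g2; elim: k => [|k IHk]; first by rewrite expn_gt0; lia.
rewrite /= mul1n betaS expnD.
have G2 : (2 <= g ^ (n ^ k))%N.
  by rewrite (leq_trans g2) // -{1}(expn1 g) leq_exp2l // expn_gt0 n0.
rewrite [ltnRHS]mulnC.
have : (g ^ (n ^ k) * (latU n g k 1).+1 <= g ^ (n ^ k) * g ^ beta n k)%N.
  by rewrite leq_mul2l IHk orbT.
move: G2; set G := (g ^ (n ^ k))%N; set B := (g ^ beta n k)%N.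
by rewrite mulnS; set u := (G * latU _ _ _ _)%N; set v := (G * B)%N; lia.
Qed.

(** Starting the recursion from the identity at level 0 agrees with psi_1(d) = d also at the digit
    [g - 1], which is the midpoint of the digit [g - 2] and of the next multiple of g. *)
Lemma psiN1 n g i : (2 <= g)%N -> psiN n g 1 i = i.
Proof.
move=> g2; rewrite /= expn0 expn1.
have := divn_eq i g; set q := (i %/ g)%N; set c := (i %% g)%N => i_eq.
have clt : (c < g)%N by rewrite ltn_mod; lia.
case: ltnP => cg; first by lia.
have -> : ((q + q.+1) * g + (g - 2) = i.*2)%N by lia.
by rewrite doubleK.
Qed.

Lemma lat_unit_coprime n g k i : (0 < n)%N -> (0 < k)%N ->
  coprimez (g ^ beta n k)%:Z (lat_unit n g k i).
Proof.
move=> n0; case: i => [|i]; first by rewrite coprimezE coprimen1.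
case: k => [//|k] _; rewrite /lat_unit coprimezE /= coprimeXl //.
have -> : (g ^ (i.+1 * n ^ k) = g * g ^ (i.+1 * n ^ k).-1)%N.
  by rewrite -expnS prednK // muln_gt0 expn_gt0 n0.
by rewrite -mulnA /coprime addnC mulnC gcdnMDl gcdn1.
Qed.

Arguments latU : simpl never.
Arguments psiN : simpl never.

Section GridDifference.

Variables (n g k : nat) (I J : nat -> nat) (w : nat).
Hypotheses (n2 : (2 <= n)%N) (g6 : (6 <= g)%N) (g_even : ~~ odd g).
Hypothesis Iw : forall i, (w <= I i < w + g ^ k)%N.
Hypothesis Jw : forall i, (w <= J i < w + g ^ k)%N.

Definition gridD (i : nat) : int := (psiN n g k (J i))%:Z - (psiN n g k (I i))%:Z.

(** All indices lie in one window of length [g ^ k], over which [psiN] grows by exactly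
    [g ^ beta n k]. *)
Lemma gridD_lt i : `|gridD i| < (g ^ beta n k)%:Z.
Proof.
have B0 : (0 < g ^ beta n k)%N by rewrite expn_gt0; lia.
have mono x y : (x <= y)%N -> (psiN n g k x <= psiN n g k y)%N.
  by rewrite (psiN_mono n2).
have wI := mono _ _ (proj1 (andP (Iw i))); have wJ := mono _ _ (proj1 (andP (Jw i))).
have lt_top x : (x < w + g ^ k)%N ->
    (psiN n g k x < psiN n g k w + g ^ beta n k)%N.
  by rewrite -(psiN_period n2) // ltnNge -(psiN_mono n2 g6 g_even k) -ltnNge.
have := lt_top _ (proj2 (andP (Iw i))); have := lt_top _ (proj2 (andP (Jw i))).
by rewrite /gridD; lia.
Qed.

Lemma lat_gridD_neq0 i0 : (0 < k)%N -> (i0 < n)%N -> I i0 != J i0 ->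
  lat n g k gridD != 0.
Proof.
move=> k0 i0n IJ; apply/eqP => sum0.
have := @coprimez_digit_sum_eq0 n gridD (lat_unit n g k) _
  (fun i _ => lat_unit_coprime g i (ltnW n2) k0) (fun i _ => gridD_lt i) sum0 i0 i0n.
move/eqP; rewrite subr_eq0 eqz_nat => /eqP /(psiN_inj n2 g6 g_even) JI.
by rewrite JI eqxx in IJ.
Qed.

Lemma gridD_half_mod i : (0 < k)%N -> exists nu t : int,
  `|nu| <= g%:Z - 2 /\ 2 * gridD i = 2 * nu + t * g%:Z ^+ (n ^ k.-1).
Proof.
rewrite /gridD; case: (k) => [//|k'] _; rewrite -[k'.+1.-1]/k'.
have [nu1 [t1 [nu1_le e1]]] := psiN_half_mod n2 g6 g_even k' (I i).
have [nu2 [t2 [nu2_le e2]]] := psiN_half_mod n2 g6 g_even k' (J i).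
exists (nu2%:Z - nu1%:Z), (t2%:Z - t1%:Z); split; first by lia.
have -> : g%:Z ^+ (n ^ k') = (g ^ (n ^ k'))%:Z by rewrite -!natz natrX.
move: e1 e2; set G := (g ^ (n ^ k'))%N => e1 e2; rewrite mulrBl.
by move: e1 e2; set x := psiN _ _ _ _; set y := psiN _ _ _ _; lia.
Qed.

(** From level 2 on, the last block of [n ^ (k - 1)] digits is long enough to be sparse, and the two
    congruence lemmas apply, with [b1] the value of [beta] one level below and
    [n ^ (k - 1) = (n - 1) * b1 + 1]. *)
Lemma lat_gridD_neq_unit (s : int) : (2 <= k)%N -> `|s| = 1 -> lat n g k gridD != s.
Proof.
move=> k2 s1.
have Dlt i : `|gridD i| < (g ^ beta n k)%:Z := gridD_lt i.
have [nu1 [t1 [nu1_le e1]]] := gridD_half_mod 1 (ltnW k2).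
have [nu0 [t0 [nu0_le e0]]] := gridD_half_mod 0 (ltnW k2).
rewrite /lat; move: gridD Dlt e1 e0 => D Dlt e1 e0.
case: k k2 => [//|[//|k']] _ in Dlt e1 e0 *.
set b1 := beta n k'.+1.
have b1_gt0 : (0 < b1)%N by rewrite /b1 betaSl.
have b_eq : beta n k'.+2 = (n * b1).+1 by rewrite betaSl.
have a_eq : (n ^ k'.+1 = (n.-1 * b1).+1)%N.
  have := betaS n k'.+1; rewrite b_eq -/b1; move: n2.
  by case: (n) => [//|n'] _ /=; rewrite mulSn; lia.
have BE : (g ^ beta n k'.+2)%:Z = g%:Z ^+ (n * b1).+1 by rewrite b_eq -!natz -natrX.
rewrite BE; rewrite BE in Dlt; rewrite /= a_eq in e1 e0.
have natX (x y : nat) : (x ^ y)%N%:Z = x%:Z ^+ y by rewrite -!natz natrX.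
have UE1 i : latU n g k'.+1 i.+1 =
    (1 + g * (g ^ (i.+1 * n ^ k').-1 * latU n g k' i.+1))%N.
  rewrite mulnA -expnS prednK // muln_gt0 expn_gt0.
  by rewrite (ltnW n2).
have UE i : latU n g k'.+2 i.+1 = (1 + g ^ (i.+1 * n ^ k'.+1) *
    (1 + g * (g ^ (i.+1 * n ^ k').-1 * latU n g k' i.+1)))%N.
  by rewrite -UE1.
(* For n = 2 the index 1 is also the last one, so that the digit receiving the carry and the digit
   producing the contradiction coincide; this case has its own lemma. *)
have [n3|n3] := leqP 3 n; last first.
  have n_eq : n = 2%N by lia.
  have V_lt := latU_lt k'.+1 (ltnW n2) (leq_trans (isT : (2 <= 6)%N) g6).
  rewrite -/b1 in V_lt.
  rewrite a_eq in UE; rewrite n_eq in e1 e0 Dlt UE *.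
  rewrite /= in e1 e0 UE.
  have -> : \sum_(i < 2) D i * lat_unit 2 g k'.+2 i * g%:Z ^+ (2 * b1).+1 ^+ (2.-1 - i)
     = D 0%N * g%:Z ^+ (2 * b1).+1 + D 1%N * (latU 2 g k'.+2 1)%:Z.
    by rewrite !big_ord_recl big_ord0 /= /bump /= addr0 subn0 subnn expr0 !mulr1.
  rewrite UE; set Y := (g ^ (1 * 2 ^ k').-1 * latU 2 g k' 1)%N.
  rewrite PoszD PoszM natX !mul1n.
  have -> : (2 * b1).+1 = b1.+1.*2.-1 by lia.
  apply: (@digit_sum2_neq_unit g b1.+1 (D 0%N) (D 1%N) _ s nu0 t0 Y%:Z) => //.
  - by have := Dlt 1%N; rewrite (_ : (2 * b1).+1 = b1.+1.*2.-1) //; lia.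
  - have := V_lt; rewrite /= -natX ltz_nat; apply: leq_ltn_trans.
    by rewrite UE1 n_eq.
  - by rewrite e0 ?mul1n.

have [m n_eq] : exists m, n = m.+3.
  by exists (n - 3)%N; clear -n3; lia.
have UZ i : (1 <= i)%N -> lat_unit n g k'.+2 i = 1 +
    g%:Z ^+ (i * (n.-1 * b1).+1) *
      (1 + g%:Z * (g ^ (i * n ^ k').-1 * latU n g k' i)%N%:Z).
  by case: i => [//|i] _; rewrite /lat_unit UE a_eq PoszD PoszM natX PoszD PoszM.
move: UZ e1 Dlt; move: (lat_unit n g k'.+2) => U; rewrite n_eq => UZ e1 Dlt.
apply: (@digit_sum_neq_unit m g b1 D U
  (fun i => (g ^ (i * n ^ k').-1 * latU n g k' i)%N%:Z) s nu1 t1) => // i i1 _.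
by rewrite UZ // n_eq.
Qed.

End GridDifference.
End GridLattice.

(** * The inner function on the reals *)

Section GeometricDomination.
Variable R : realType.

Lemma sum_geometric_le (x : R) (N : nat) : 0 <= x < 1 ->
  \sum_(0 <= l < N) x ^+ l <= (1 - x)^-1.
Proof.
move=> /andP[x0 x1]; have x10 : 0 < 1 - x by rewrite subr_gt0.
rewrite -[leRHS]mul1r ler_pdivlMr // big_mkord mulrC.
have -> : (1 - x) * \sum_(i < N) x ^+ i = 1 - x ^+ N.
  by rewrite -opprB mulNr -subrX1 opprB.
by rewrite lerBlDr lerDl exprn_ge0.
Qed.

Section Dominated.
Variables (u : nat -> R) (c x : R).
Hypotheses (x01 : 0 <= x < 1) (u_dom : forall l, 0 <= u l <= c * x ^+ l).

Let c0 : 0 <= c.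
Proof. by have /andP[u0 /(le_trans u0)] := u_dom 0; rewrite expr0 mulr1. Qed.

Let u0 l : 0 <= u l. Proof. by have /andP[] := u_dom l. Qed.

Lemma series_dominated_le N : series u N <= c / (1 - x).
Proof.
apply: le_trans (_ : \sum_(0 <= l < N) c * x ^+ l <= _).
  by apply: ler_sum => l _; have /andP[] := u_dom l.
by rewrite -big_distrr ler_wpM2l // sum_geometric_le.
Qed.

Let series_nd : nondecreasing_seq (series u).
Proof. exact: nondecreasing_series. Qed.

Lemma is_cvg_series_dominated : cvgn (series u).
Proof.
apply: nondecreasing_is_cvgn => //; exists (c / (1 - x)) => _ [N _ <-].
exact: series_dominated_le.
Qed.

Lemma series_le_lim_dominated N : series u N <= limn (series u).
Proof. exact: nondecreasing_cvgn_le is_cvg_series_dominated N. Qed.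

Lemma lim_series_dominated_le : limn (series u) <= c / (1 - x).
Proof.
apply: limr_le; first exact: is_cvg_series_dominated.
by near=> N; exact: series_dominated_le.
Unshelve. all: by end_near. Qed.

End Dominated.

End GeometricDomination.

(** * Tails of the series lambda *)

Section BetaSeries.
Variables (R : realType) (n g : nat).
Hypotheses (n2 : (2 <= n)%N) (g6 : (6 <= g)%N).

Let gR : R := g%:R.

Let gR6 : 6 <= gR. Proof. by rewrite /gR ler_nat. Qed.
Let gR0 : 0 < gR. Proof. by apply: lt_le_trans gR6. Qed.

Definition beta_term (i k l : nat) : R := g%:R ^- (i * beta n (k + l.+1)).

(** Remainder after [k] terms of the series lambda of index [i], counted from 0. For i = 1 it is
    also the series in the definition of b_k. *)
Definition beta_tail (i k : nat) : R := limn (series (beta_term i k)).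

(** The exponents grow at least linearly with slope [n ^ k.+1]. The ratio is left free through [s]:
    1 is enough for convergence, 2 gives the bound on lambda and 4 the bound on the tails from level
    1 on. *)
Lemma beta_term_dom s i k l : (s <= n ^ k.+1)%N -> (0 < i)%N ->
  0 <= beta_term i k l <= g%:R ^- (i * beta n k.+1) * (gR ^- s) ^+ l.
Proof.
move=> sk i0; rewrite /beta_term; apply/andP; split.
  by rewrite invr_ge0 exprn_ge0 // ltW.
rewrite exprVn -exprM -invfM -exprD lef_pV2 ?posrE ?exprn_gt0 //.
rewrite ler_weXn2l //; first by rewrite (le_trans _ gR6) // ler1n.
have := beta_geD k.+1 l n2; rewrite -addSnnS => bk.
have : (s * l <= n ^ k.+1 * l)%N by rewrite leq_mul2r sk orbT.
have : (i * (beta n k.+1 + n ^ k.+1 * l) <= i * beta n (k.+1 + l))%N.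
  by rewrite leq_mul2l bk orbT.
have : (n ^ k.+1 * l <= i * (n ^ k.+1 * l))%N by rewrite leq_pmull.
by rewrite mulnDr; lia.
Qed.

Let powV_lt1 s : (0 < s)%N -> 0 <= gR ^- s < 1.
Proof.
move=> s0; rewrite invr_ge0 exprn_ge0 ?ltW //=.
rewrite invf_lt1 ?exprn_gt0 // exprn_egt1 -?lt0n //.
by rewrite (lt_le_trans _ gR6) // ltr1n.
Qed.

Let nS_gt0 k : (0 < n ^ k.+1)%N. Proof. by rewrite expn_gt0 (ltnW n2). Qed.

Lemma is_cvg_beta_tail i k : (0 < i)%N -> cvgn (series (beta_term i k)).
Proof.
move=> i0; apply: is_cvg_series_dominated (powV_lt1 (isT : (0 < 1)%N)) _ => l.
exact: beta_term_dom.
Qed.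

Lemma beta_tail_ge i k : (0 < i)%N -> gR ^- (i * beta n k.+1) <= beta_tail i k.
Proof.
move=> i0; have dom l := beta_term_dom l (nS_gt0 k) i0.
have := series_le_lim_dominated (powV_lt1 (isT : (0 < 1)%N)) dom 1.
by rewrite /series /= big_nat1 /beta_term addn1.
Qed.

Lemma beta_tail_gt0 i k : (0 < i)%N -> 0 < beta_tail i k.
Proof.
by move=> /beta_tail_ge => /(_ k); apply: lt_le_trans; rewrite invr_gt0 exprn_gt0.
Qed.

Lemma beta_tail_le s i k : (0 < s)%N -> (s <= n ^ k.+1)%N -> (0 < i)%N ->
  beta_tail i k <= gR ^- (i * beta n k.+1) * (1 - gR ^- s)^-1.
Proof.
move=> s0 sk i0.
exact: lim_series_dominated_le (powV_lt1 s0) (fun l => beta_term_dom l sk i0).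
Qed.

Lemma beta_tail_split i k : (0 < i)%N ->
  beta_tail i 0 = \sum_(l < k) gR ^- (i * beta n l.+1) + beta_tail i k.
Proof.
move=> i0; apply: cvg_lim => //.
rewrite -(cvg_shiftn k).
have -> : (fun N => series (beta_term i 0) (N + k)) =
   (fun N => \sum_(l < k) gR ^- (i * beta n l.+1) + series (beta_term i k) N).
  apply/funext => N; rewrite /series /= (@big_cat_nat _ _ _ k 0%N (N + k)%N) ?leq_addl //=.
  rewrite big_mkord; congr (_ + _); rewrite -{1}[k]add0n big_addn addnK.
  by apply: eq_bigr => l _; rewrite /beta_term add0n addnC addnS addnC.
apply: cvgD; first exact: cvg_cst.
exact: is_cvg_beta_tail.
Qed.

Lemma lambda_tail (i : 'I_n) : (0 < i)%N -> lambda R g i = beta_tail i 0.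
Proof. by move=> i0; rewrite /lambda gtn_eqF. Qed.

End BetaSeries.

Section InnerFunction.
Variables (R : realType) (n g : nat).
Hypotheses (n2 : (2 <= n)%N) (g6 : (6 <= g)%N) (g_even : ~~ odd g).

Let gR : R := g%:R.

Let gR6 : 6 <= gR. Proof. by rewrite /gR ler_nat. Qed.
Let gR0 : 0 < gR. Proof. by apply: lt_le_trans gR6. Qed.
Let gX0 k : 0 < gR ^+ k. Proof. by rewrite exprn_gt0. Qed.

Definition psi_val (k i : nat) : R := (psiN n g k i)%:R / g%:R ^+ beta n k.

Lemma psi_val_refine k i : psi_val k.+1 (i * g) = psi_val k i.
Proof.
rewrite /psi_val psiN_refine // betaS natrM natrX exprD invfM mulrA.
by rewrite -!mulrA [_ ^+ (_ ^ _) * _]mulrC -mulrA mulVf ?mulr1 // gt_eqF.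
Qed.

Lemma psi_val_low k q c : (c < g - 1)%N ->
  psi_val k.+1 (q * g + c) = psi_val k q + c%:R * g%:R ^- beta n k.+1.
Proof.
move=> cg; rewrite -(psi_val_refine k q) /psi_val psiN_low // -psiN_refine //.
by rewrite natrD mulrDl.
Qed.

Lemma psi_val_high k q : psi_val k.+1 (q * g + (g - 1)) =
  (psi_val k q + (g - 2)%:R * g%:R ^- beta n k.+1 + psi_val k q.+1) / 2.
Proof.
have /(congr1 (fun m => m%:R : R)) := psiN_high n2 g6 g_even k q.
rewrite natrM => e; apply: (mulfI (lt0r_neq0 (ltr0Sn R 1))).
rewrite [RHS]mulrC mulfVK ?pnatr_eq0 // -!(psi_val_refine k) /psi_val.
rewrite mulrA e natrD natrM natrD mulrDl mulrDl.
by rewrite !psiN_refine // !natrM; ring.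
Qed.

Lemma psi_val_period k i : psi_val k (i + g ^ k) = psi_val k i + 1.
Proof.
by rewrite /psi_val psiN_period // natrD mulrDl natrX divff // gt_eqF.
Qed.

Lemma psi_val0 k : psi_val k 0 = 0.
Proof.
by elim: k => [|k IHk]; [rewrite /psi_val mul0r|rewrite -(mul0n g) psi_val_refine].
Qed.

Lemma psi_val_top k : psi_val k (g ^ k) = 1.
Proof. by rewrite -[(g ^ k)%N]add0n psi_val_period psi_val0 add0r. Qed.

Lemma psi_gridE k i : psi_grid R n g k i = psi_val k i.
Proof.
have val0 j : psi_val 0 j = j%:R by rewrite /psi_val beta0 divr1.
elim: k i => [|k IHk] i; first by rewrite val0.
have g0 : (0 < g)%N by lia.
rewrite {2}(divn_eq i g); set q := (i %/ g)%N; set c := (i %% g)%N.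
have cg : (c < g)%N by rewrite ltn_mod.
have step : (if (c < g - 1)%N then psi_grid R n g k q + c%:R * gR ^- beta n k.+1
  else (psi_grid R n g k q + (g - 2)%:R * gR ^- beta n k.+1
        + psi_grid R n g k q.+1) / 2) = psi_val k.+1 (q * g + c).
  rewrite !IHk; case: ltnP => cl; first by rewrite psi_val_low.
  by rewrite -psi_val_high; congr psi_val; lia.
case: k IHk step => [|k] IHk step.
  by rewrite /psi_val psiN1 ?beta1 ?expr1 -?divn_eq //; lia.
(* The test for the top index agrees with the recursion, whose value there is 1 as well. *)
rewrite -step /=; case: eqP => // i_top.
by rewrite step -divn_eq i_top psi_val_top.
Qed.

Lemma psi_val_le k : {mono psi_val k : i j / (i <= j)%N >-> i <= j}.
Proof.
move=> i j; rewrite /psi_val ler_pM2r ?invr_gt0 // ler_nat.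
by rewrite (psiN_mono n2 g6 g_even).
Qed.

(** One refinement at least halves the largest step: steps between small digits have length
    [g ^- beta n k.+1], and the two steps around the digit [g - 1] are at most half of the parent
    step. This rate 2 against the mesh ratio g is the origin of the exponent ln 2 / ln g. *)
Lemma psi_val_width k i : psi_val k i.+1 - psi_val k i <= 2 ^- k.
Proof.
elim: k i => [|k IHk] i.
  by rewrite /psi_val beta0 expr0 !divr1 -natrB // subSnn invr1.
have g0 : (0 < g)%N by lia.
have unit_le : g%:R ^- beta n k.+1 <= 2 ^- k.+1 :> R.
  rewrite lef_pV2 ?posrE ?exprn_gt0 //.
  apply: le_trans (_ : 2 ^+ beta n k.+1 <= _).
    rewrite ler_eXn2l ?ltr1n //.
    have := beta_geD 1 k n2; rewrite beta1 expn1 !add1n; apply: leq_ltn_trans.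
    by rewrite leq_pmull // (ltnW n2).
  by apply: lerXn2r; rewrite ?nnegrE ?ler0n // ler_nat; lia.
rewrite (divn_eq i g); set q := (i %/ g)%N; set c := (i %% g)%N.
have cg : (c < g)%N by rewrite ltn_mod.
have half : (psi_val k q.+1 - psi_val k q) / 2 <= 2 ^- k.+1.
  by rewrite exprSr invfM ler_pM2r ?invr_gt0.
have G0 : 0 <= (g - 2)%:R * g%:R ^- beta n k.+1 :> R.
  by rewrite mulr_ge0 // invr_ge0 exprn_ge0 // ltW.
have [cl|cl] := ltnP c.+1 (g - 1).
  rewrite -addnS !psi_val_low //; last by lia.
  by rewrite -natr1 mulrDl mul1r; lra.
have [cl2|cl2] := ltnP c (g - 1).
  rewrite -addnS (_ : c.+1 = g - 1)%N; last by lia.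
  rewrite psi_val_high psi_val_low // (_ : c = g - 2)%N; last by lia.
  by move: half G0; set u := _%:R * _; lra.
rewrite (_ : c = g - 1)%N; last by lia.
have -> : ((q * g + (g - 1)).+1 = q.+1 * g)%N by lia.
rewrite psi_val_refine psi_val_high.
by move: half G0; set u := _%:R * _; lra.
Qed.

Definition trunc (x : R) (k : nat) : nat := Num.truncn (x * g%:R ^+ k).

Lemma trunc_bounds x k : 0 <= x ->
  (trunc x k)%:R <= x * gR ^+ k < (trunc x k).+1%:R.
Proof. by move=> x0; apply: truncn_itv; rewrite mulr_ge0 // ltW. Qed.

Lemma truncS_bounds x k : 0 <= x ->
  (trunc x k * g <= trunc x k.+1 < (trunc x k).+1 * g)%N.
Proof.
move=> x0; have /andP[lo hi] := trunc_bounds k x0.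
have x0' : 0 <= x * g%:R ^+ k.+1 by rewrite mulr_ge0 // ltW.
rewrite /trunc truncn_ge_nat // truncn_lt_nat // !natrM exprSr mulrA.
by rewrite ler_pM2r // ltr_pM2r // lo hi.
Qed.

Lemma trunc_le x y k : x <= y -> (trunc x k <= trunc y k)%N.
Proof. by move=> xy; apply: le_truncn; rewrite ler_pM2r. Qed.

Let lower x k := psi_val k (trunc x k).
Let upper x k := psi_val k (trunc x k).+1.

Let lower_nd x : 0 <= x -> nondecreasing_seq (lower x).
Proof.
move=> x0; apply/nondecreasing_seqP => k; rewrite /lower -psi_val_refine psi_val_le.
by have /andP[] := truncS_bounds k x0.
Qed.

Let upper_ni x : 0 <= x -> nonincreasing_seq (upper x).
Proof.
move=> x0; apply/nonincreasing_seqP => k; rewrite /upper.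
rewrite -(psi_val_refine k) psi_val_le.
by have /andP[] := truncS_bounds k x0.
Qed.

Let lower_upper x k l : 0 <= x -> lower x k <= upper x l.
Proof.
move=> x0; apply: (@le_trans _ _ (lower x (maxn k l))).
  by apply: lower_nd => //; exact: leq_maxl.
apply: (@le_trans _ _ (upper x (maxn k l))); first by rewrite psi_val_le.
by apply: upper_ni => //; exact: leq_maxr.
Qed.

Lemma psi01E (x : R) : psi01 n g x = limn (fun k => psi_val k (trunc x k)).
Proof. by rewrite /psi01; congr (limn _); apply/funext => k; exact: psi_gridE. Qed.

Lemma is_cvg_psi01 x : 0 <= x -> cvgn (fun k => psi_val k (trunc x k)).
Proof.
move=> x0; apply: nondecreasing_is_cvgn; first exact: lower_nd.
by exists (upper x 0) => _ [k _ <-]; exact: lower_upper.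
Qed.

Lemma psi01_bounds (x : R) k : 0 <= x ->
  psi_val k (trunc x k) <= psi01 n g x <= psi_val k (trunc x k).+1.
Proof.
move=> x0; rewrite psi01E; apply/andP; split.
  exact: (nondecreasing_cvgn_le (lower_nd x0) (is_cvg_psi01 x0) k).
apply: limr_le; first exact: is_cvg_psi01.
by near=> N; exact: lower_upper.
Unshelve. all: by end_near. Qed.

Lemma psiE (x : R) : 0 <= x -> psi n g x = psi01 n g x.
Proof.
rewrite /psi => x0; case: ltP => // x1.
have x10 : 0 <= x - 1 by rewrite subr_ge0.
apply/esym; rewrite psi01E; apply: cvg_lim => //.
have -> : (fun k => psi_val k (trunc x k)) = (fun k => psi_val k (trunc (x - 1) k) + 1).
  apply/funext => k; rewrite -psi_val_period; congr psi_val.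
  apply: truncn_def; have := trunc_bounds k x10.
  by rewrite -addSn !natrD natrX mulrBl mul1r -lerBrDr -ltrBlDr.
apply: cvgD; last exact: cvg_cst.
by rewrite psi01E; exact: is_cvg_psi01.
Qed.

Lemma psi_bounds (x : R) k : 0 <= x ->
  psi_val k (trunc x k) <= psi n g x <= psi_val k (trunc x k).+1.
Proof. by move=> x0; rewrite psiE //; exact: psi01_bounds. Qed.

Lemma psi_le (x y : R) : 0 <= x -> x <= y -> psi n g x <= psi n g y.
Proof.
move=> x0 xy; have y0 := le_trans x0 xy.
rewrite !psiE // !psi01E; apply: ler_lim; [exact: is_cvg_psi01..|].
by near=> k; rewrite psi_val_le trunc_le.
Unshelve. all: by end_near. Qed.

(** The truncation of the larger argument is at most one cell further, so that both values lie
    within two adjacent cells of level k. *)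
Lemma psi_modulus (x y : R) k : 0 <= x -> 0 <= y -> `|x - y| <= g%:R ^- k ->
  `|psi n g x - psi n g y| <= 2 * 2 ^- k.
Proof.
wlog xy : x y / x <= y => [th x0 y0|x0 y0].
  have [xy|/ltW yx] := leP x y; first exact: th.
  by rewrite distrC => yxk; rewrite distrC; exact: th.
rewrite distrC => yx; rewrite distrC ger0_norm ?subr_ge0 ?psi_le //.
rewrite ger0_norm ?subr_ge0 // in yx.
have /andP[xl _] := psi_bounds k x0; have /andP[_ yu] := psi_bounds k y0.
have : (trunc y k <= (trunc x k).+1)%N.
  rewrite -ltnS /trunc truncn_lt_nat; last by rewrite mulr_ge0 // ltW.
  have /andP[_ xt] := trunc_bounds k x0.
  have : (y - x) * gR ^+ k <= 1.
    by apply: le_trans (_ : g%:R ^- k * gR ^+ k <= _); rewrite ?ler_pM2r ?mulVf ?gt_eqF.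
  by move: xt; rewrite -!natr1 mulrBl -/(trunc x k) -/gR; lra.
rewrite -ltnS -[X in (X <= _)%N]/((trunc y k).+1) -(psi_val_le k) => yx2.
have := psi_val_width k (trunc x k); have := psi_val_width k (trunc x k).+1.
by lra.
Qed.

(** The number 11...1 with [N] digits in base g. The shift j a is 0.0jjj... in this base, so its
    truncations are multiples of repunits. *)
Definition repunit (N : nat) : nat := \sum_(l < N) g ^ l.

Lemma repunitS N : repunit N.+1 = (repunit N * g + 1)%N.
Proof.
rewrite /repunit big_ord_recl expn0 addnC big_distrl /=; congr (_ + _)%N.
by apply: eq_bigr => l _; rewrite /bump /= add1n expnSr.
Qed.

Lemma repunit_eq N : (g%:R - 1) * (repunit N)%:R = g%:R ^+ N - 1 :> R.
Proof.
elim: N => [|N IHN]; first by rewrite /repunit big_ord0 mulr0 subrr.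
rewrite repunitS natrD natrM mulrDr mulrA IHN exprSr; ring.
Qed.

Lemma psi_val_repunit k i c N : (c < g - 1)%N ->
  psi_val (k + N) (i * g ^ N + c * repunit N) =
  psi_val k i + c%:R * \sum_(0 <= l < N) g%:R ^- beta n (k + l.+1).
Proof.
move=> cg; elim: N => [|N IHN].
  by rewrite /repunit big_ord0 muln0 !addn0 expn0 muln1 big_nil mulr0 addr0.
have -> : (i * g ^ N.+1 + c * repunit N.+1 = (i * g ^ N + c * repunit N) * g + c)%N.
  by rewrite repunitS expnSr; ring.
by rewrite addnS psi_val_low // IHN big_nat_recr //= mulrDr addrA addnS.
Qed.

(** In base g the fraction c / (g - 1) is 0.ccc...; as [c] is not [g - 1], the averaging rule never
    applies and each further digit adds c times the next term of the tail. *)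
Lemma psi_cell k i c : (c < g - 1)%N ->
  psi n g ((i%:R + c%:R / (g%:R - 1)) / g%:R ^+ k : R) =
  psi_val k i + c%:R * beta_tail R n g 1 k.
Proof.
move=> cg; have g10 : 0 < gR - 1 by move: gR6; lra.
have x0 : 0 <= (i%:R + c%:R / (gR - 1)) / gR ^+ k.
  by rewrite divr_ge0 ?addr_ge0 ?divr_ge0 // ltW.
rewrite psiE // psi01E; apply: cvg_lim => //; rewrite -(cvg_shiftn k).
have -> : (fun N => psi_val (N + k) (trunc ((i%:R + c%:R / (gR - 1)) / gR ^+ k) (N + k))) =
  (fun N => psi_val k i + c%:R * series (beta_term R n g 1 k) N).
  apply/funext => N; rewrite addnC /series /= /beta_term.
  under eq_bigr do rewrite mul1n.
  rewrite -psi_val_repunit //; congr psi_val; apply: truncn_def.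
  rewrite exprD mulrA mulfVK ?gt_eqF // -addn1 !natrD natrM natrM natrX.
  have -> : (i%:R + c%:R / (gR - 1)) * gR ^+ N =
     i%:R * gR ^+ N + c%:R * (repunit N)%:R + c%:R / (gR - 1).
    have -> : gR ^+ N = (gR - 1) * (repunit N)%:R + 1 by rewrite repunit_eq subrK.
    by field; rewrite gt_eqF.
  rewrite -/gR; set z := i%:R * _ + _.
  have : c%:R / (gR - 1) < 1.
    by rewrite ltr_pdivrMr // mul1r ltrBrDr natr1 ltr_nat; lia.
  have : 0 <= c%:R / (gR - 1) by rewrite divr_ge0 // ltW.
  by lra.
apply: cvgD; first exact: cvg_cst.
by apply: cvgMr; exact: is_cvg_beta_tail.
Qed.

End InnerFunction.

(** * Separation of the grid values *)

Section Separation.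
Variables (R : realType) (n g : nat).
Hypotheses (n2 : (2 <= n)%N) (g6 : (6 <= g)%N) (g_even : ~~ odd g).

Let gR : R := g%:R.
Let gR6 : 6 <= gR. Proof. by rewrite /gR ler_nat. Qed.
Let gR0 : 0 < gR. Proof. by apply: lt_le_trans gR6. Qed.
Let gX0 k : 0 < gR ^+ k. Proof. by rewrite exprn_gt0. Qed.
Let y := gR^-1.
Let y0 : 0 < y. Proof. by rewrite invr_gt0. Qed.
Let y6 : y <= 6^-1. Proof. by rewrite lef_pV2 ?posrE. Qed.

(** Length of each sloped flank of a bump of level k. By [betaSl], [g * ramp k] is the lattice unit
    [g ^- (n * beta n k)]. *)
Definition ramp (k : nat) : R := g%:R ^- beta n k.+1.

Lemma ramp_gt0 k : 0 < ramp k. Proof. by rewrite invr_gt0. Qed.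

Let ramp_le k : (0 < k)%N -> ramp k <= y ^+ 3.
Proof.
move=> k0; rewrite /ramp /y exprVn lef_pV2 ?posrE //.
rewrite ler_weXn2l //; first by rewrite (le_trans _ gR6) // ler1n.
rewrite betaSl ltnS; apply: leq_trans n2 _; rewrite leq_pmulr //.
by case: (k) k0 => // k' _; rewrite betaSl.
Qed.

Let q_le (x : R) : 0 < x -> x <= 36^-1 -> (1 - x)^-1 <= 1 + 36 / 35 * x.
Proof.
move=> x0 x1; have x10 : 0 < 1 - x by lra.
rewrite -[leLHS]mul1r ler_pdivrMr //.
have x2 : 0 <= 1 - 36 * x by lra.
have := mulr_ge0 (ltW x0) x2; lra.
Qed.

Let ys_le s : (2 <= s)%N -> 0 < y ^+ s <= 36^-1.
Proof.
move=> s2; rewrite exprn_gt0 //=.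
have -> : 36^-1 = 6^-1 ^+ 2 :> R by field.
apply: le_trans (_ : y ^+ 2 <= _); last first.
  by rewrite ler_pXn2r ?nnegrE ?invr_ge0 // ltW.
have yy0 := y0; have yy6 := y6.
by rewrite ler_wiXn2l //; lra.
Qed.

Lemma beta_tail_le_ramp i k : (0 < i)%N -> (0 < k)%N ->
  beta_tail R n g i k <= (1 + 36 / 35 * y ^+ 4) * ramp k ^+ i.
Proof.
move=> i0 k0; have k4 : (4 <= n ^ k.+1)%N.
  apply: (@leq_trans (2 ^ 2)) => //; apply: (@leq_trans (2 ^ k.+1)).
    by rewrite leq_exp2l.
  by rewrite leq_exp2r.
apply: le_trans (@beta_tail_le R n g n2 g6 _ _ _ (isT : (0 < 4)%N) k4 i0) _.
have -> : ramp k ^+ i = gR ^- (i * beta n k.+1).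
  by rewrite /ramp -exprVn -exprM mulnC exprVn.
rewrite mulrC ler_pM2r ?invr_gt0 //.
have /andP[ys0 ys1] := ys_le (isT : (2 <= 4)%N).
by have := q_le ys0 ys1; rewrite /y !exprVn.
Qed.

Lemma beta_tail1_bounds k : (0 < k)%N ->
  0 < beta_tail R n g 1 k <= 3 / 2 * ramp k.
Proof.
move=> k0; rewrite beta_tail_gt0 //=.
apply: le_trans (beta_tail_le_ramp (isT : (0 < 1)%N) k0) _.
rewrite expr1 ler_pM2r ?ramp_gt0 //.
by have /andP[] := ys_le (isT : (2 <= 4)%N); lra.
Qed.

Lemma lambda_le (i : 'I_n) : (0 < i)%N ->
  lambda R g i <= (1 + 36 / 35 * y ^+ 2) * y ^+ i.
Proof.
move=> i0; rewrite lambda_tail //.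
apply: le_trans (@beta_tail_le R n g n2 g6 _ _ _ (isT : (0 < 2)%N) _ i0) _; first by rewrite expn1.
rewrite beta1 muln1 -exprVn -/gR -/y mulrC ler_pM2r ?exprn_gt0 //.
have /andP[ys0 ys1] := ys_le (isT : (2 <= 2)%N).
by have := q_le ys0 ys1; rewrite /y !exprVn.
Qed.

Lemma lambda_gt0 (i : 'I_n) : 0 < lambda R g i.
Proof.
case: (posnP i) => [i0|i0]; first by rewrite /lambda i0.
by rewrite lambda_tail // beta_tail_gt0.
Qed.

Let geo_le (x : R) m : 0 < x -> x < 1 -> \sum_(i < m) x ^+ i <= (1 - x)^-1.
Proof.
by move=> x0 x1; have := @sum_geometric_le _ x m; rewrite big_mkord (ltW x0) x1; apply.
Qed.

Lemma sum_lambda_le :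
  \sum_(i < n) lambda R g i <= 1 + (1 + 36 / 35 * y ^+ 2) * (y / (1 - y)).
Proof.
case: n n2 lambda_le => [//|m] _ lambda_le.
rewrite big_ord_recl {1}/lambda /= lerD2l.
apply: le_trans (_ : \sum_(i < m) (1 + 36 / 35 * y ^+ 2) * (y * y ^+ i) <= _).
  by apply: ler_sum => i _; rewrite -exprS; exact: (lambda_le (lift ord0 i)).
rewrite -!big_distrr /= ler_pM2l; last first.
  by have /andP[] := ys_le (isT : (2 <= 2)%N); lra.
by rewrite ler_pM2l // geo_le //; move: y6; lra.
Qed.

Lemma sum_lambda_ge1 : 1 <= \sum_(i < n) lambda R g i.
Proof.
have := lambda_gt0; case: n n2 => [//|m] _ lambda_gt0.
rewrite big_ord_recl {1}/lambda /= lerDl.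
by apply: sumr_ge0 => i _; rewrite ltW.
Qed.

Lemma sum_lambda_le_const : \sum_(i < n) lambda R g i <= 5 / 4.
Proof.
apply: le_trans sum_lambda_le _.
have y1 : y / (1 - y) <= 5^-1 by rewrite ler_pdivrMr; move: y6; lra.
have y1' : 0 < y / (1 - y) by rewrite divr_gt0 //; move: y6; lra.
have /andP[ys0 ys1] := ys_le (isT : (2 <= 2)%N).
apply: le_trans (_ : 1 + (1 + 36 / 35 * 36^-1) * 5^-1 <= _); last by lra.
by rewrite lerD2l ler_pM //; try lra.
Qed.

Lemma bgapE k : bgap R n g k = beta_tail R n g 1 k * \sum_(i < n) lambda R g i.
Proof.
rewrite /bgap /beta_tail (_ : beta_term R n g 1 k =
  (fun l : nat => g%:R ^- beta n (k + l.+1))) //.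
by apply/funext => l; rewrite /beta_term mul1n.
Qed.

(** Length of the interval on which a bump of level k equals 1. It has to contain the points at
    distance j b_k from its left end, for all j up to [m = g - 2]. *)
Definition plateau (k : nat) : R := (g%:R - 2) * bgap R n g k.

Lemma plateau_ge0 k : 0 <= plateau k.
Proof.
rewrite /plateau bgapE mulr_ge0 ?mulr_ge0 //.
- by move: gR6; rewrite -/gR; lra.
- by rewrite ltW // beta_tail_gt0.
- exact: le_trans sum_lambda_ge1.
Qed.

(** With y = 1/g, the plateau is about g (1 - 2 y) (1 + y / (1 - y)) = g (1 - y - y^2 - ...) flanks
    long. Of the gain y from the quadratic term one half is kept: it pays for the tails of index at
    least 2 when grid values differ by a single unit. *)
Lemma plateau_le k : (0 < k)%N -> plateau k <= (gR - 1 - y / 2) * ramp k.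
Proof.
move=> k0; rewrite /plateau bgapE.
have T := beta_tail_le_ramp (isT : (0 < 1)%N) k0.
have L := sum_lambda_le; have L1 := sum_lambda_ge1.
rewrite expr1 in T; have r0 := ramp_gt0 k.
have gy : gR = y^-1 by rewrite invrK.
have y1 : 0 < 1 - y by move: y6; lra.
set Lam := \sum_(i < n) _ in L L1 *.
have main : (gR - 2) * Lam * (1 + 36 / 35 * y ^+ 4) <= gR - 1 - y / 2.
  have yL : (1 - 2 * y) * Lam <= 1 - y - y ^+ 2 + 36 / 35 * y ^+ 3.
    apply: le_trans (_ : (1 - 2 * y) * (1 + (1 + 36 / 35 * y ^+ 2) * (y / (1 - y))) <= _).
      by rewrite ler_pM2l //; move: y6; lra.
    have -> : (1 - 2 * y) * (1 + (1 + 36 / 35 * y ^+ 2) * (y / (1 - y))) =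
      ((1 - 2 * y) * (1 - y + (1 + 36 / 35 * y ^+ 2) * y)) / (1 - y).
      by field; rewrite gt_eqF.
    rewrite ler_pdivrMr //.
    have : 0 <= y ^+ 3 * (1 - y) by rewrite mulr_ge0 ?exprn_ge0 // ltW.
    have : 0 <= y ^+ 4 by rewrite exprn_ge0 // ltW.
    have : 0 <= y ^+ 3 by rewrite exprn_ge0 // ltW.
    by rewrite !expr2 !exprS expr0; lra.
  have -> : (gR - 2) * Lam * (1 + 36 / 35 * y ^+ 4) =
     y^-1 * ((1 - 2 * y) * Lam * (1 + 36 / 35 * y ^+ 4)).
    by rewrite gy; field; rewrite gt_eqF.
  have -> : gR - 1 - y / 2 = y^-1 * (1 - y - y ^+ 2 / 2).
    by rewrite gy; field; rewrite gt_eqF.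
  rewrite ler_pM2l ?invr_gt0 //.
  have y4 : 0 <= y ^+ 4 <= y ^+ 3 / 6.
    rewrite (exprn_ge0 _ (ltW y0)) /= exprSr ler_pM2l ?exprn_gt0 //.
  have y3 : 0 <= y ^+ 3 <= y ^+ 2 / 6.
    by rewrite (exprn_ge0 _ (ltW y0)) /= exprSr ler_pM2l ?exprn_gt0.
  have y2 : 0 <= y ^+ 2 <= y / 6.
    by rewrite (exprn_ge0 _ (ltW y0)) /= expr2 ler_pM2l.
  have yL0 : 0 <= (1 - 2 * y) * Lam by rewrite mulr_ge0 //; move: y6; lra.
  have yL1 : (1 - 2 * y) * Lam <= 1.
    by move: yL y2 y3 => ? /andP[? ?] /andP[? ?]; lra.
  apply: le_trans (_ : (1 - 2 * y) * Lam + 36 / 35 * y ^+ 4 <= _).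
    rewrite mulrDr mulr1 lerD2l -[leRHS]mul1r ler_pM2r //.
    by rewrite mulr_gt0 ?exprn_gt0 //; lra.
  by move: yL y2 y3 y4 => ? /andP[? ?] /andP[? ?] /andP[? ?]; lra.
apply: le_trans (_ : (gR - 2) * ((1 + 36 / 35 * y ^+ 4) * ramp k * Lam) <= _).
  rewrite ler_pM2l; last by move: gR6; rewrite -/gR; lra.
  by rewrite ler_pM2r //; lra.
rewrite (_ : _ * _ = (gR - 2) * Lam * (1 + 36 / 35 * y ^+ 4) * ramp k); last by ring.
by rewrite ler_pM2r.
Qed.

(** From index 2 on the tails are of order [ramp k ^+ 2], and [ramp k] is at most y / 36. The bound
    matches the slack left in [plateau_le]. *)
Lemma sum_tail_ge2_le k m : (0 < k)%N ->
  \sum_(i < m) beta_tail R n g i.+2 k <= y / 2 * ramp k.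
Proof.
move=> k0; have r0 := ramp_gt0 k; have r3 := ramp_le k0.
have y4 := andP (ys_le (isT : (2 <= 4)%N)); have y2 := andP (ys_le (isT : (2 <= 2)%N)).
have r1 : ramp k <= y / 36.
  apply: le_trans r3 _; rewrite exprS ler_pM2l //; lra.
apply: le_trans (_ : \sum_(i < m) 2 * ramp k ^+ 2 * ramp k ^+ i <= _).
  apply: ler_sum => i _; rewrite -mulrA -exprD.
  apply: le_trans (beta_tail_le_ramp _ k0) _ => //.
  by rewrite ler_pM2r ?exprn_gt0 //; lra.
rewrite -big_distrr /=.
have r1' : ramp k < 1 / 2 by move: y6; lra.
have r1'' : ramp k < 1 by lra.
have G := geo_le m r0 r1''.
apply: le_trans (_ : 2 * ramp k ^+ 2 * 2 <= _).
  rewrite ler_pM2l ?mulr_gt0 ?exprn_gt0 //; apply: le_trans G _.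
  by rewrite -[leLHS]mul1r ler_pdivrMr; lra.
have : ramp k * ramp k <= y / 36 * ramp k by rewrite ler_pM2r.
have : 0 < y * ramp k by rewrite mulr_gt0.
by rewrite expr2; lra.
Qed.

End Separation.

Lemma int_norm_lt2 (z : int) : z != 0 -> `|z| < 2%:Z -> z = 1 \/ z = -1.
Proof. lia. Qed.

Section GridSeparation.
Variables (R : realType) (n g k : nat) (I J : nat -> nat) (w : nat).
Hypotheses (n2 : (2 <= n)%N) (g6 : (6 <= g)%N) (g_even : ~~ odd g).
Hypothesis k0 : (0 < k)%N.
Hypothesis Iw : forall i, (w <= I i < w + g ^ k)%N.
Hypothesis Jw : forall i, (w <= J i < w + g ^ k)%N.

Let gR : R := g%:R.
Let gR6 : 6 <= gR. Proof. by rewrite /gR ler_nat. Qed.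
Let gR0 : 0 < gR. Proof. by apply: lt_le_trans gR6. Qed.
Let gX0 m : 0 < gR ^+ m. Proof. by rewrite exprn_gt0. Qed.

Definition xi_val (K : nat -> nat) : R :=
  \sum_(i < n) lambda R g i * psi_val R n g k (K i).

Let D := gridD n g k I J.
Let B : R := gR ^+ beta n k.
Let DB i : R := (D i)%:~R / B.

Let DB_lt1 i : `|DB i| < 1.
Proof.
rewrite /DB normrM normfV [`|B|]gtr0_norm ?gX0 // ltr_pdivrMr ?gX0 // mul1r.
have := gridD_lt n2 g6 g_even Iw Jw i.
rewrite -(ltr_int R) -intr_norm; congr (_ < _).
by rewrite /B /gR -natrX.
Qed.

Let tail_sum := \sum_(i < n | (0 < i)%N) DB i * beta_tail R n g i k.

Lemma latU_tail i : \sum_(l < k) gR ^- (i * beta n l.+1) =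
  gR ^- (i * beta n k) * (latU n g k i)%:R.
Proof.
elim: k => [|m IHm]; first by rewrite big_ord0 mulr0.
rewrite big_ord_recr /= IHm betaS mulnDr /latU -/latU natrD natrM natrX exprD.
by rewrite invfM mulrDr mulr1 addrC; congr (_ + _); field; rewrite !gt_eqF.
Qed.

(** Each lambda is split after k terms. The heads combine to the integer [lat] over a common
    denominator; the tails remain, weighted by the differences [DB] of the psi values, which are
    below 1. *)
Lemma xi_val_diff : xi_val J - xi_val I =
  (lat n g k D)%:~R * (gR * ramp R n g k) + tail_sum.
Proof.
have unitE : gR * ramp R n g k = B ^- n.
  rewrite /ramp betaSl exprS invfM mulrA divff ?gt_eqF // mul1r /B.
  by rewrite -exprM mulnC.
rewrite unitE /xi_val -sumrB /tail_sum [X in _ = _ + X]big_mkcond /=.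
rewrite /lat rmorph_sum /= mulr_suml -big_split /=; apply: eq_bigr => i _.
have -> : lambda R g i * psi_val R n g k (J i) - lambda R g i * psi_val R n g k (I i)
    = lambda R g i * DB i.
  rewrite -mulrBr /psi_val -mulrBl /DB /D /gridD rmorphB /=.
  by rewrite -!pmulrn.
have BnE : B ^- n = (B * B ^+ i * B ^+ (n.-1 - i))^-1.
  rewrite -exprS -exprD; congr (_ ^-1); congr (_ ^+ _); have := ltn_ord i; lia.
have B0 : B != 0 by rewrite gt_eqF // gX0.
rewrite 2!rmorphM rmorphXn /= BnE.
have -> : (g ^ beta n k)%:Z%:~R = B by rewrite /B /gR -natrX pmulrn.
have cancelB (c : R) : (D i)%:~R * c * B ^+ (n.-1 - i) / (B * B ^+ i * B ^+ (n.-1 - i))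
   = DB i * (c / B ^+ i).
  by rewrite /DB; field; rewrite !(expf_neq0 _ B0) B0.
rewrite cancelB; case: posnP => [i0|i0].
  by rewrite /lambda i0 /lat_unit expr0 divr1 /= addr0 mulr1 mul1r.
rewrite lambda_tail // (beta_tail_split _ n2 g6 k i0) latU_tail mulrDl.
rewrite mulrC mulrC -/gR; congr (_ + _); last by rewrite mulrC.
rewrite mulrC; congr (_ * _).
have -> : lat_unit n g k i = (latU n g k i)%:Z by case: (nat_of_ord i) i0.
by rewrite mulrC pmulrn /B -exprM mulnC.
Qed.

Let r0 : 0 < ramp R n g k. Proof. exact: ramp_gt0. Qed.

Let tail_sum_split : exists2 e : R, `|e| <= gR^-1 / 2 * ramp R n g k &
  tail_sum = DB 1 * beta_tail R n g 1 k + e.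
Proof.
have T := @sum_tail_ge2_le R n g n2 g6 k (n - 2) k0.
have gen m (t : nat -> R) :
    \sum_(i < m.+2 | (0 < i)%N) t i = t 1%N + \sum_(i < m) t i.+2.
  by rewrite big_mkcond !big_ord_recl /= add0r.
exists (\sum_(i < n - 2) DB i.+2 * beta_tail R n g i.+2 k).
  apply: le_trans (ler_norm_sum _ _ _) (le_trans _ T); apply: ler_sum => i _.
  have t0 := beta_tail_gt0 R n2 g6 k (isT : (0 < i.+2)%N).
  rewrite normrM [`|beta_tail _ _ _ _ _|]gtr0_norm // -[leRHS]mul1r.
  by rewrite ler_pM2r // ltW.
have := gen (n - 2)%N (fun i => DB i * beta_tail R n g i k).
by rewrite (_ : (n - 2).+2 = n) //; lia.
Qed.

Let yr : 0 < gR^-1 / 2 * ramp R n g k <= 1 / 12 * ramp R n g k.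
Proof.
rewrite mulr_gt0 ?divr_gt0 ?invr_gt0 //= ler_pM2r //.
have : gR^-1 <= 6^-1 by rewrite lef_pV2 ?posrE.
lra.
Qed.

Let tail_sum_le : `|tail_sum| <= 2 * ramp R n g k.
Proof.
have [e e_le ->] := tail_sum_split; apply: le_trans (ler_normD _ _) _.
move: (beta_tail1_bounds R n2 g6 k0) yr => /andP[b0 b1] /andP[_ yr1].
have : `|DB 1 * beta_tail R n g 1 k| <= 1 * beta_tail R n g 1 k.
  by rewrite normrM [`|beta_tail _ _ _ _ _|]gtr0_norm // ler_pM2r // ltW.
lra.
Qed.

Lemma xi_val_separated_ge (N : nat) : (N%:Z <= `|lat n g k D|) ->
  (N%:R * gR - 2) * ramp R n g k <= `|xi_val J - xi_val I|.
Proof.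
move=> a_ge; rewrite xi_val_diff.
have := lerB_normD ((lat n g k D)%:~R * (gR * ramp R n g k)) tail_sum.
apply: le_trans; rewrite normrM [`|gR * _|]gtr0_norm ?mulr_gt0 //.
have : N%:R * (gR * ramp R n g k) <= `|(lat n g k D)%:~R| * (gR * ramp R n g k).
  by rewrite ler_pM2r ?mulr_gt0 // -intr_norm -[N%:R]/(N%:Z%:~R) ler_int.
by have := tail_sum_le; lra.
Qed.

Lemma xi_val_separated i : (i < n)%N -> I i != J i ->
  (gR - 2) * ramp R n g k <= `|xi_val J - xi_val I|.
Proof.
move=> iN IJ; rewrite -{1}[gR]mul1r; apply: (@xi_val_separated_ge 1).
by rewrite -gtz0_ge1 normr_gt0 (lat_gridD_neq0 n2 g6 g_even Iw Jw k0 iN IJ).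
Qed.

(** The values 0, 1 and -1 of [lat] being excluded, the distance is two units up to the tails, that
    is [2 * g - 2] flanks. *)
Lemma xi_val_separated_level2 i : (2 <= k)%N -> (i < n)%N -> I i != J i ->
  plateau R n g k + 5 * ramp R n g k <= `|xi_val J - xi_val I|.
Proof.
move=> k2 iN IJ; apply: le_trans (_ : (2%:R * gR - 2) * ramp R n g k <= _).
  have := plateau_le R n2 g6 k0; rewrite -/gR.
  have : 6 * ramp R n g k <= gR * ramp R n g k by rewrite ler_pM2r.
  by have /andP[? _] := yr; lra.
apply: xi_val_separated_ge.
have a0 := lat_gridD_neq0 n2 g6 g_even Iw Jw k0 iN IJ.
have a1 := lat_gridD_neq_unit n2 g6 g_even Iw Jw k2 (normr1 _ : `|1 : int| = 1).
have am1 := lat_gridD_neq_unit n2 g6 g_even Iw Jw k2 (normrN1 _ : `|-1 : int| = 1).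
by rewrite -/D in a0 a1 am1; lia.
Qed.

(** A single unit is just enough, provided that the tail of index 1, the only one comparable to a
    flank, does not work against it. The condition on [I 1] ensures this. *)
Lemma xi_val_separated_level1 i : k = 1%N -> w = 0%N -> (i < n)%N -> I i != J i ->
  (0 < I 1 < g - 1)%N ->
  plateau R n g k + ramp R n g k <= `|xi_val J - xi_val I|.
Proof.
move=> k1 w0 iN IJ /andP[I1 I2].
have P := plateau_le R n2 g6 k0; rewrite -/gR in P.
have G6 : 6 * ramp R n g k <= gR * ramp R n g k by rewrite ler_pM2r.
have /andP[Y0 Y1] := yr.
have a0 := lat_gridD_neq0 n2 g6 g_even Iw Jw k0 iN IJ.
have [a2|a2] := leP 2%:Z `|lat n g k D|.
  by apply: le_trans (xi_val_separated_ge a2); lra.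
have a1 := int_norm_lt2 a0 a2.
have [s s1 sa] : exists2 s : int, `|s| = 1 & s * lat n g k D = 1.
  case: a1 => ->.
    by exists 1; rewrite ?normr1.
  by exists (-1); rewrite ?normrN1 ?mulrNN.
(* If the signs disagreed, the digits would sum to 1 with a full borrow, [s * D 1 = 1 - g]; then
   [I 1] would be 0 or [g - 1]. *)
have D1 : 0 <= s * D 1%N.
  rewrite leNgt; apply/negP => D1_lt0.
  have Dlt j : `|s * D j| < g%:Z.
    rewrite normrM s1 mul1r; apply: lt_le_trans (gridD_lt n2 g6 g_even Iw Jw j) _.
    by rewrite k1 beta1 expn1.
  have DE : D 1%N = (J 1)%:Z - (I 1)%:Z.
    by rewrite /D /gridD k1 !psiN1 // (leq_trans _ g6).
  have [m n_eq] : exists m, n = m.+2.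
    by exists (n - 2)%N; clear -n2; lia.
  have unit1 i' : lat_unit n g 1 i' = 1.
    by case: i' => // i'; rewrite /lat_unit /latU muln0.
  have := @digit_sum_unit_second m (fun j => s * D j) g%:Z (fun j _ => Dlt j) D1_lt0.
  move: sa; rewrite /lat k1 mulr_sumr; under eq_bigr do rewrite unit1 beta1 expn1 mulr1 mulrA.
  rewrite n_eq => -> /(_ erefl).
  have := Iw 1; have := Jw 1; rewrite k1 w0 expn1 DE.
  have : `|s * ((J 1)%:Z - (I 1)%:Z)| = `|(J 1)%:Z - (I 1)%:Z|.
    by rewrite normrM s1 mul1r.
  by move: I1 I2; clear; set z := s * _; lia.
have [e e_le tail_eq] := tail_sum_split.
have sR : `|s%:~R| = 1 :> R by rewrite -intr_norm s1.
rewrite -[leRHS]mul1r -sR -normrM xi_val_diff tail_eq.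
rewrite !mulrDr mulrA -rmorphM sa mul1r.
apply: le_trans (ler_norm _).
have : 0 <= s%:~R * (DB 1 * beta_tail R n g 1 k).
  rewrite mulrA mulr_ge0 //; last by have /andP[/ltW] := beta_tail1_bounds R n2 g6 k0.
  by rewrite /DB mulrA -rmorphM; apply: divr_ge0; [rewrite ler0z|exact: ltW (gX0 _)].
have : `|s%:~R * e| <= gR^-1 / 2 * ramp R n g k by rewrite normrM sR mul1r.
by rewrite ler_norml => /andP[+ _]; lra.
Qed.

End GridSeparation.

(** * Hoelder continuity and intermediate values of the inner function *)

Section InnerFunctionRegularity.
Variables (R : realType) (n g : nat).
Hypotheses (n2 : (2 <= n)%N) (g6 : (6 <= g)%N) (g_even : ~~ odd g).

Let gR : R := g%:R.
Let gR6 : 6 <= gR. Proof. by rewrite /gR ler_nat. Qed.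
Let gR0 : 0 < gR. Proof. by apply: lt_le_trans gR6. Qed.

Definition holder_exp : R := ln 2 / ln g%:R.

Lemma holder_exp_gt0 : 0 < holder_exp.
Proof. by rewrite divr_gt0 // ln_gt0 // ?ltr1n //; lia. Qed.

Lemma psi_holder (x y : R) : 0 <= x -> 0 <= y -> `|x - y| <= 1 ->
  `|psi n g x - psi n g y| <= 4 * `|x - y| `^ holder_exp.
Proof.
move=> x0 y0; have [->|xy] := eqVneq x y.
  by rewrite !subrr normr0 => _; rewrite mulr_ge0 // powR_ge0.
set t := `|x - y| => t1; have t0 : 0 < t by rewrite normr_gt0 subr_eq0.
have lng : 0 < ln gR by rewrite ln_gt0 // ltr1n; lia.
have ln2 : 0 < ln 2 :> R by rewrite ln_gt0 // ltr1n.
(* Here t = g^-L, so the integer part k of L is the last level with [t <= g ^- k]. Rounding L down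
   costs a factor 2, hence the constant 4 = 2 * 2. *)
pose L := ln t^-1 / ln gR.
have L0 : 0 <= L by rewrite divr_ge0 ?(ltW lng) // ln_ge0 // invf_ge1.
have /andP[kL Lk] := truncn_itv L0; set k := Num.truncn L in kL Lk.
have tk : t <= gR ^- k.
  rewrite -ler_ln ?posrE ?invr_gt0 ?exprn_gt0 // lnV ?posrE ?exprn_gt0 //.
  rewrite lnXn // -mulr_natl lerNr -lnV ?posrE // -ler_pdivlMr //.
apply: le_trans (psi_modulus n2 g6 g_even x0 y0 tk) _.
rewrite -[4]/((2 * 2)%:R) natrM -mulrA ler_pM2l //.
rewrite /powR gt_eqF // -ler_pdivrMl // -invfM -exprS -[2 ^- k.+1]lnK; last first.
  by rewrite posrE invr_gt0 exprn_gt0.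
rewrite ler_expR lnV ?posrE ?exprn_gt0 // lnXn // -[_ *+ k.+1]mulr_natl lerNl.
rewrite -mulrN -lnV ?posrE // /holder_exp mulrAC -mulrA -/gR -/L mulrC.
by rewrite ler_pM2r // ltW.
Qed.

Lemma psi_ivt (a b v : R) : 0 <= a -> a <= b -> psi n g a <= v <= psi n g b ->
  exists2 c, a <= c <= b & psi n g c = v.
Proof.
move=> a0 ab vab; have b0 := le_trans a0 ab.
(* Extended by a constant to the negative axis, psi becomes continuous on the whole line, where the
   intermediate value theorem applies directly. *)
pose F (x : R) := psi n g (Num.max x 0).
have FE x : 0 <= x -> F x = psi n g x by move=> x0; rewrite /F max_l.
have contF : continuous F.
  move=> x; apply/cvgrPdist_le => e e0.
  have [k ke] : exists k, 2 * 2 ^- k <= e :> R.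
    exists (Num.truncn (2 / e)); set k := Num.truncn _.
    rewrite ler_pdivrMr ?exprn_gt0 // mulrC -ler_pdivrMr //.
    apply: le_trans (ltW (truncnS_gt _)) _; rewrite -/k -natrX ler_nat.
    exact: ltn_expl.
  near=> z; apply: le_trans ke; apply: psi_modulus => //; rewrite ?le_max ?lexx ?orbT //.
  apply: le_trans (_ : `|x - z| <= _).
    have N1 := ler_norm (x - z); have N2 := ler_norm (z - x).
    rewrite [`|z - x|]distrC in N2; move: N1 N2; set N := `|x - z| => N1 N2.
    by apply/ler_normlP; rewrite /Num.max; case: (ltP x 0); case: (ltP z 0); split; lra.
  near: z.
  have dk : 0 < gR ^- k by rewrite invr_gt0 exprn_gt0.
  by have /cvgrPdist_le := @cvg_id R (nbhs x); exact.
have FabE : F a = psi n g a /\ F b = psi n g b by rewrite !FE.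
have [c /itvP cab Fc] : exists2 c, c \in `[a, b] & F c = v.
  apply: IVT => //; first by apply: continuous_subspaceT.
  have [-> ->] := FabE; have pab := psi_le n2 g6 g_even a0 ab.
  by rewrite min_l // max_r.
by exists c; rewrite ?cab // -FE // (le_trans a0) // cab.
Unshelve. all: by end_near. Qed.

End InnerFunctionRegularity.

(** * Layers *)

Section OuterBumps.
Variables (R : realType) (n g k : nat).
Hypotheses (n2 : (2 <= n)%N) (g6 : (6 <= g)%N).

Let gR : R := g%:R.
Let gR6 : 6 <= gR. Proof. by rewrite /gR ler_nat. Qed.
Let gR0 : 0 < gR. Proof. by apply: lt_le_trans gR6. Qed.

Lemma sigma_le (x y : R) : x <= y -> sigma x <= sigma y.
Proof.
by move=> xy; rewrite /sigma /Num.min /Num.max; case: (ltP x 0) => ?; case: (ltP y 0) => ?;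
  do 2 case: ltP => ?; lra.
Qed.

Lemma sigma_itv (x : R) : 0 <= sigma x <= 1.
Proof.
rewrite /sigma /Num.min /Num.max.
by case: (ltP x 0) => ?; case: ltP => ?; apply/andP; split; lra.
Qed.

Lemma sigma0 (x : R) : x <= 0 -> sigma x = 0.
Proof. by rewrite /sigma /Num.min /Num.max => x0; case: (ltP x 0) => ?; case: ltP => ?; lra. Qed.

Lemma sigma1 (x : R) : 1 <= x -> sigma x = 1.
Proof. by rewrite /sigma /Num.min /Num.max => x1; case: (ltP x 0) => ?; case: ltP => ?; lra. Qed.

Lemma sigma_lipschitz (x y : R) : `|sigma x - sigma y| <= `|x - y|.
Proof.
have N1 := ler_norm (x - y); have N2 := ler_norm (y - x).
rewrite [`|y - x|]distrC in N2; move: N1 N2; set N := `|x - y| => N1 N2.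
apply/ler_normlP; rewrite /sigma /Num.min /Num.max.
by case: (ltP x 0) => ?; case: (ltP y 0) => ?; do 2 case: ltP => ?; split; lra.
Qed.

Variable d : 'cV[R]_n.
Let s := xi g d.
Let r := ramp R n g k.
Let P := plateau R n g k.

Let r0 : 0 < r. Proof. exact: ramp_gt0. Qed.

Let P0 : 0 <= P. Proof. exact: plateau_ge0. Qed.

Lemma thetaE (x : R) : theta g k d x =
  sigma ((x - s) / r + 1) - sigma ((x - s - P) / r).
Proof.
rewrite /theta -/s /r /ramp invrK [_ * gR ^+ _]mulrC.
by rewrite [X in _ - sigma X]mulrC.
Qed.

Lemma theta_itv (x : R) : 0 <= theta g k d x <= 1.
Proof.
rewrite thetaE; have : sigma ((x - s - P) / r) <= sigma ((x - s) / r + 1).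
  apply: sigma_le; rewrite mulrBl; have : 0 <= P / r by rewrite divr_ge0 // ltW.
  lra.
have /andP[? ?] := sigma_itv ((x - s) / r + 1); have /andP[? ?] := sigma_itv ((x - s - P) / r).
by move=> ?; apply/andP; split; lra.
Qed.

Let ri0 : 0 < r^-1. Proof. by rewrite invr_gt0. Qed.

Lemma theta_eq1 (x : R) : s <= x <= s + P -> theta g k d x = 1.
Proof.
move=> /andP[sx xs]; rewrite thetaE sigma1; last first.
  by rewrite lerDr (pmulr_lge0 _ ri0) subr_ge0.
by rewrite sigma0 ?subr0 // (pmulr_lle0 _ ri0); lra.
Qed.

Lemma theta_eq0l (x : R) : x <= s - r -> theta g k d x = 0.
Proof.
move=> xs; have rs : (x - s) / r <= -1 by rewrite ler_pdivrMr // mulN1r; lra.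
rewrite thetaE !sigma0 ?subrr //; last by lra.
by rewrite (pmulr_lle0 _ ri0); move: r0 P0; lra.
Qed.

Lemma theta_eq0r (x : R) : s + P + r <= x -> theta g k d x = 0.
Proof.
move=> xs; have rs : 1 <= (x - s - P) / r by rewrite ler_pdivlMr // mul1r; lra.
rewrite thetaE !sigma1 ?subrr //.
by rewrite lerDr (pmulr_lge0 _ ri0); move: r0 P0; lra.
Qed.

Lemma theta_lipschitz (x y : R) :
  `|theta g k d x - theta g k d y| <= 2 / r * `|x - y|.
Proof.
rewrite !thetaE.
set a := sigma _; set b := sigma _; set a' := sigma _; set b' := sigma _.
have -> : a - b - (a' - b') = (a - a') - (b - b') by ring.
apply: le_trans (ler_normB _ _) _.
have -> : 2 / r * `|x - y| = `|x - y| / r + `|x - y| / r by ring.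
have E : `|x - y| / r = `|(x - y) / r|.
  by rewrite normrM normfV [`|r|]gtr0_norm.
rewrite E; apply: lerD; apply: le_trans (sigma_lipschitz _ _) _;
  rewrite le_eqVlt; apply/orP; left; apply/eqP; congr (`| _ |); ring.
Qed.

End OuterBumps.

(** * Digits of grid points and of the shifts *)

Section GridPoints.
Variables (R : realType) (n g k : nat).
Hypotheses (n2 : (2 <= n)%N) (g6 : (6 <= g)%N) (g_even : ~~ odd g).
Hypothesis k0 : (0 < k)%N.

Let gR : R := g%:R.
Let gR6 : 6 <= gR. Proof. by rewrite /gR ler_nat. Qed.
Let gR0 : 0 < gR. Proof. by apply: lt_le_trans gR6. Qed.
Let g1 : 0 < gR - 1. Proof. by move: gR6; lra. Qed.

Implicit Types d : {ffun 'I_n -> 'I_(g ^ k)}.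

Definition grid_index d (j i : nat) : nat :=
  (oapp (fun i' : 'I_n => d i' : nat) 0 (insub i) + j * repunit g k.-1)%N.

Lemma grid_index_ord d j (i : 'I_n) :
  grid_index d j i = (d i + j * repunit g k.-1)%N.
Proof. by rewrite /grid_index insubT //= => lt; congr (d _ + _)%N; apply: val_inj. Qed.

Lemma grid_index_window d j i :
  (j * repunit g k.-1 <= grid_index d j i < j * repunit g k.-1 + g ^ k)%N.
Proof.
rewrite /grid_index leq_addl /= addnC ltn_add2l; case: insub => [i'|] /=.
  exact: ltn_ord.
by rewrite expn_gt0; lia.
Qed.

Lemma grid_shiftE j : grid_shift R g j k = (j * repunit g k.-1)%:R / gR ^+ k.
Proof.
rewrite /grid_shift natrM -mulrA; congr (_ * _); rewrite -/gR.
case: k k0 => // k' _; rewrite -[k'.+1.-1]/k'.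
elim: k' => [|k' IHk]; first by rewrite big_geq // /repunit big_ord0 mul0r.
rewrite big_nat_recr //= IHk repunitS natrD natrM -/gR mulrDl mul1r; congr (_ + _).
by rewrite [gR ^+ k'.+2]exprS invfM mulrA mulfK ?gt_eqF.
Qed.

(** Cuts 0.0jjj... after [k] digits: the first part is the grid shift, the rest is 0.jjj... at the
    scale of a cell. *)
Lemma shift_eq j : j%:R * Defs.shift R g =
  ((j * repunit g k.-1)%:R + j%:R / (gR - 1)) / gR ^+ k.
Proof.
have := @repunit_eq R g k.-1; rewrite -/gR => e.
have -> : gR ^+ k = gR * gR ^+ k.-1 by rewrite -exprS prednK.
have -> : gR ^+ k.-1 = (gR - 1) * (repunit g k.-1)%:R + 1 by rewrite e subrK.
have e1 : (gR - 1) * (repunit g k.-1)%:R + 1 != 0 by rewrite e subrK expf_neq0 // gt_eqF.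
by rewrite /Defs.shift -/gR natrM; field; rewrite e1 !gt_eqF.
Qed.

(** A displacement by (c - j) / (g - 1) of a cell replaces the repeated digit j by c. The same
    displacement thus leads to different digits in different translates. *)
Lemma grid_point_cell d j c (i : 'I_n) :
  (d i)%:R / gR ^+ k + j%:R * Defs.shift R g + (c%:R - j%:R) / (gR - 1) / gR ^+ k
  = ((grid_index d j i)%:R + c%:R / (gR - 1)) / gR ^+ k.
Proof.
rewrite shift_eq grid_index_ord natrD; field.
by rewrite expf_neq0 ?gt_eqF.
Qed.

Lemma xi_grid d j :
  xi g (grid_point R d + const_mx (grid_shift R g j k)) =
  xi_val R n g k (grid_index d j).
Proof.
apply: eq_bigr => i _; congr (_ * _).
have := psi_cell R n2 g6 g_even k (grid_index d j i) (_ : (0 < g - 1)%N).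
rewrite mul0r mul0r !addr0 => <-; last by lia.
by rewrite !mxE grid_shiftE -mulrDl -natrD grid_index_ord.
Qed.

Lemma xi_grid_shift d j : (j < g - 1)%N ->
  xi g (grid_point R d + const_mx (j%:R * Defs.shift R g)) =
  xi_val R n g k (grid_index d j) + j%:R * bgap R n g k.
Proof.
move=> jg; rewrite /xi bgapE // mulrA mulr_sumr -big_split /=; apply: eq_bigr => i _.
rewrite !mxE; have := grid_point_cell d j j i; rewrite subrr !mul0r addr0 => ->.
by rewrite psi_cell // mulrDr [_ * lambda _ _ _]mulrC.
Qed.

Lemma grid_point_cube d : unit_cube (grid_point R d).
Proof.
move=> i; have G0 : 0 < gR ^+ k by rewrite exprn_gt0.
rewrite mxE (divr_ge0 (ler0n _ _) (ltW G0)) /= ler_pdivrMr //.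
by rewrite mul1r -natrX ler_nat ltnW.
Qed.

Lemma grid_index_neq d d' j : d != d' ->
  exists2 i, (i < n)%N & grid_index d j i != grid_index d' j i.
Proof.
move=> dd'; have [i di] : exists i, d i != d' i.
  apply/existsP; rewrite -negb_forall; apply: contra dd' => /forallP e.
  by apply/eqP/ffunP => i; apply/eqP.
by exists i; rewrite // !grid_index_ord eqn_add2r.
Qed.

End GridPoints.

Section Layers.
Variables (R : realType) (n m g : nat).
Hypotheses (n2 : (2 <= n)%N) (g6 : (6 <= g)%N) (g_even : ~~ odd g).
Hypothesis gm : g = m.+2.

Implicit Types (e f : 'cV[R]_n -> R) (x : 'cV[R]_n) (ks : nat -> nat).

Let gR : R := g%:R.
Let gR6 : 6 <= gR. Proof. by rewrite /gR ler_nat. Qed.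
Let gR0 : 0 < gR. Proof. by apply: lt_le_trans gR6. Qed.

Let m10 : 0 < m%:R + 1 :> R. Proof. by rewrite natr1. Qed.

Let sum_mean (c : R) : \sum_(j < m.+1) (m%:R + 1)^-1 * c = c.
Proof.
by rewrite sumr_const card_ord -[LHS]mulr_natl -natr1 mulrA divff ?mul1r // gt_eqF.
Qed.

Definition outer_layer k e (j : nat) (y : R) : R :=
  (m%:R + 1)^-1 * \sum_(d : {ffun 'I_n -> 'I_(g ^ k)})
    e (grid_point R d) * theta g k (grid_point R d + const_mx (grid_shift R g j k)) y.

Definition layer k e : 'cV[R]_n -> R := superpose m g (outer_layer k e).

Lemma residual0 f ks x : residual m g f ks 0 x = f x.
Proof.
by rewrite /residual /approximant /superpose big1 ?subr0.
Qed.

Lemma residualS f ks r x :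
  residual m g f ks r.+1 x =
  residual m g f ks r x - layer (ks r) (residual m g f ks r) x.
Proof.
rewrite /residual /approximant /layer {1}/superpose /= big_split /=.
by rewrite opprD addrA.
Qed.

Lemma layer_bounded k e A : 0 <= A ->
  (forall d : {ffun 'I_n -> 'I_(g ^ k)}, `|e (grid_point R d)| <= A) ->
  exists2 A', 0 <= A' & forall x, `|layer k e x| <= A'.
Proof.
move=> A0 eA; pose N : R := #|{ffun 'I_n -> 'I_(g ^ k)}|%:R.
have N0 : 0 <= N by [].
exists (N * A) => [|x]; first exact: mulr_ge0.
apply: le_trans (ler_norm_sum _ _ _) _.
apply: le_trans (_ : \sum_(j < m.+1) (m%:R + 1)^-1 * (N * A) <= _); last first.
  by rewrite sum_mean.
apply: ler_sum => j _; rewrite normrM gtr0_norm ?invr_gt0 // ler_pM2l ?invr_gt0 //.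
apply: le_trans (ler_norm_sum _ _ _) _.
have -> : N * A = \sum_(d : {ffun 'I_n -> 'I_(g ^ k)}) A.
  by rewrite sumr_const -[RHS]mulr_natl.
apply: ler_sum => d _; rewrite normrM -[leRHS]mulr1; apply: ler_pM => //.
have /andP[t0 t1] := @theta_itv R n g k n2 g6
  (grid_point R d + const_mx (grid_shift R g j k)) (xi g (x + const_mx (j%:R * Defs.shift R g))).
by rewrite ger0_norm.
Qed.

Section Level.
Variable k : nat.
Hypothesis k0 : (0 < k)%N.

Let r := ramp R n g k.
Let r0 : 0 < r. Proof. exact: ramp_gt0. Qed.
Let P := plateau R n g k.
Let P0 : 0 <= P. Proof. exact: plateau_ge0. Qed.
Let s (d : {ffun 'I_n -> 'I_(g ^ k)}) j := xi_val R n g k (grid_index d j).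

Lemma theta_far_eq0 d j y :
  (y <= s d j - r) || (s d j + P + r <= y) ->
  theta g k (grid_point R d + const_mx (grid_shift R g j k)) y = 0.
Proof.
by case/orP => ?; [rewrite theta_eq0l|rewrite theta_eq0r] => //; rewrite xi_grid.
Qed.

(** At a grid point the argument of the outer function j is xi plus j b_k, on the plateau of the
    point's own bump. Distance [P + r] keeps this plateau clear of the other supports, even where
    the flanks overlap; the m + 1 equal terms then average to the value of [e]. *)
Lemma layer_grid e d :
  (forall d' j, d' != d -> P + r <= `|s d j - s d' j|) ->
  layer k e (grid_point R d) = e (grid_point R d).
Proof.
move=> sep; rewrite /layer /superpose.
rewrite (eq_bigr (fun=> (m%:R + 1)^-1 * e (grid_point R d))) => [|j _].
  exact: sum_mean.
rewrite /outer_layer; congr (_ * _); rewrite xi_grid_shift //; last first.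
  by rewrite gm; have := ltn_ord j; lia.
have b0 : 0 <= bgap R n g k.
  rewrite bgapE // mulr_ge0 //; first by rewrite ltW // beta_tail_gt0.
  exact: le_trans (sum_lambda_ge1 R n2 g6).
have jP : 0 <= j%:R * bgap R n g k <= P.
  rewrite mulr_ge0 //= ler_wpM2r // gm -natrB // ler_nat.
  by have := ltn_ord j; lia.
rewrite (bigD1 d) //= theta_eq1 //; last first.
  by rewrite xi_grid //; move: jP => /andP[j0 jP]; rewrite lerDl j0 lerD2l.
rewrite mulr1 big1 ?addr0 // => d' d'd; rewrite theta_far_eq0 ?mulr0 //.
have := sep d' j d'd; move: jP => /andP[? ?]; rewrite ler_normr -/(s d j).
by move=> /orP[?|?]; apply/orP; [right|left]; lra.
Qed.

Hypothesis sep : forall d d' j, d' != d -> P + 2 * r <= `|s d j - s d' j|.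

(** Under the stronger separation [P + 2 * r] the supports are disjoint, so at most one bump
    contributes at each argument. *)
Lemma outer_layer_le e A j y : 0 <= A ->
  (forall d : {ffun 'I_n -> 'I_(g ^ k)}, `|e (grid_point R d)| <= A) ->
  `|outer_layer k e j y| <= (m%:R + 1)^-1 * A.
Proof.
move=> A0 eA; rewrite normrM gtr0_norm ?invr_gt0 // ler_pM2l ?invr_gt0 //.
have [/forallP all0|/forallPn[d td]] := boolP [forall d : {ffun 'I_n -> 'I_(g ^ k)},
  theta g k (grid_point R d + const_mx (grid_shift R g j k)) y == 0].
  by rewrite big1 ?normr0 // => d _; rewrite (eqP (all0 d)) mulr0.
rewrite (bigD1 d) //= big1 ?addr0 => [|d' d'd]; last first.
  rewrite theta_far_eq0 ?mulr0 //.
  have : ~~ ((y <= s d j - r) || (s d j + P + r <= y)).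
    by apply: contra td => /theta_far_eq0 ->.
  rewrite negb_or -!ltNge => /andP[? ?].
  have := sep j d'd; rewrite ler_normr.
  by move=> /orP[?|?]; apply/orP; [right|left]; lra.
rewrite normrM -[leRHS]mulr1; apply: ler_pM => //.
have /andP[t0 t1] := @theta_itv R n g k n2 g6
  (grid_point R d + const_mx (grid_shift R g j k)) y.
by rewrite ger0_norm.
Qed.

End Level.

End Layers.

Section HighLevels.
Variables (R : realType) (n m g : nat).
Hypotheses (n2 : (2 <= n)%N) (g6 : (6 <= g)%N) (g_even : ~~ odd g).
Hypothesis gm : g = m.+2.

Let gR : R := g%:R.
Let gR6 : 6 <= gR. Proof. by rewrite /gR ler_nat. Qed.
Let gR0 : 0 < gR. Proof. by apply: lt_le_trans gR6. Qed.

Lemma grid_separated_level1 (d d' : {ffun 'I_n -> 'I_(g ^ 1)}) j :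
  d' != d -> (0 < d (Ordinal n2) < g - 1)%N ->
  plateau R n g 1 + ramp R n g 1 <=
    `|xi_val R n g 1 (grid_index d j) - xi_val R n g 1 (grid_index d' j)|.
Proof.
move=> d'd d1; rewrite distrC.
have r0' : (j * repunit g 1.-1 = 0)%N by rewrite /repunit big_ord0 muln0.
rewrite eq_sym in d'd; have [i iN ii'] := grid_index_neq j d'd.
apply: (@xi_val_separated_level1 R n g 1 _ _ (j * repunit g 1.-1) _ _ _ _ _ _ i) => //.
- exact: grid_index_window.
- exact: grid_index_window.
- by rewrite (@grid_index_ord n g 1 d j (Ordinal n2)) r0' addn0.
Qed.

Variable k : nat.
Hypothesis k2 : (2 <= k)%N.
Let k0 : (0 < k)%N := ltnW k2.

Let r := ramp R n g k.
Let r0 : 0 < r. Proof. exact: ramp_gt0. Qed.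
Let P := plateau R n g k.
Let P0 : 0 <= P. Proof. exact: plateau_ge0. Qed.
Let s (d : {ffun 'I_n -> 'I_(g ^ k)}) j := xi_val R n g k (grid_index d j).
Let b := beta_tail R n g 1 k.

Lemma grid_separated_level2 (d d' : {ffun 'I_n -> 'I_(g ^ k)}) j :
  d' != d -> plateau R n g k + 5 * ramp R n g k <=
    `|xi_val R n g k (grid_index d j) - xi_val R n g k (grid_index d' j)|.
Proof.
move=> d'd; have [i iN ii'] := grid_index_neq j d'd.
apply: (@xi_val_separated_level2 R n g k _ _ (j * repunit g k.-1) _ _ _ _ _ _ i) => //.
- exact: grid_index_window.
- exact: grid_index_window.
Qed.

(** Either the first [2 * r] is already free of bumps, or some bump is active there and its right
    end starts a hole: the next bump is at least [P + 5 * r] away, and one flank of it still has to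
    be subtracted. *)
Lemma theta_hole j y0 : exists2 y, y0 <= y <= y0 + P + 4 * r &
  forall z, y <= z <= y + 2 * r -> forall d : {ffun 'I_n -> 'I_(g ^ k)},
    theta g k (grid_point R d + const_mx (grid_shift R g j k)) z = 0.
Proof.
have [all0|] := pselect (forall z, y0 <= z <= y0 + 2 * r ->
    forall d : {ffun 'I_n -> 'I_(g ^ k)},
    theta g k (grid_point R d + const_mx (grid_shift R g j k)) z = 0).
  by exists y0 => //; rewrite lexx /=; move: P0 r0; lra.
move=> /existsNP[z /not_implyP[/andP[z1 z2] /existsNP[d td]]].
have : ~~ ((z <= s d j - r) || (s d j + P + r <= z)).
  by apply/negP => /(theta_far_eq0 n2 g6 g_even k0) t0; apply: td.
rewrite negb_or -!ltNge => /andP[sz zs].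
exists (s d j + P + r); first by move: r0; lra.
move=> w /andP[w1 w2] d'; apply: (theta_far_eq0 n2 g6 g_even k0).
have [->|d'd] := eqVneq d' d; first by rewrite -/(s d j) -/P -/r w1 orbT.
have := grid_separated_level2 j d'd; rewrite -/(s d j) -/(s d' j) -/P -/r ler_normr.
by move=> /orP[?|?]; apply/orP; [right|left]; rewrite -/(s d' j) -/P -/r; move: P0 r0; lra.
Qed.

Lemma lambda1_bounds : gR^-1 <= lambda R g (Ordinal n2) <= 1.
Proof.
have y0 : 0 < gR^-1 by rewrite invr_gt0.
have y1 : gR^-1 <= 6^-1 by rewrite lef_pV2 ?posrE.
apply/andP; split.
  rewrite lambda_tail //; have := beta_tail_ge R n2 g6 0 (isT : (0 < 1)%N).
  by rewrite beta1 expr1.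
apply: le_trans (@lambda_le R n g n2 g6 (Ordinal n2) isT) _.
have : gR^-1 ^+ 2 <= gR^-1 ^+ 1 by rewrite ler_wiXn2l //; lra.
rewrite !expr1 -/gR => y2.
apply: le_trans (_ : (1 + 36 / 35 * 6^-1) * 6^-1 <= _); last by lra.
by apply: ler_pM; have := exprn_ge0 2 (ltW y0); lra.
Qed.

Lemma psi_val_gap i : psi_val R n g k i + g%:R ^- beta n k <= psi_val R n g k i.+1.
Proof.
rewrite /psi_val -[X in _ + X]mul1r -mulrDl ler_pM2r ?invr_gt0 ?exprn_gt0 //.
by rewrite natr1 ler_nat (psiN_ltS n2 g6 g_even).
Qed.

(** The right side is at least what the outer argument gains when the second coordinate crosses the
    end of its cell, beyond the repeated digit [g - 2]. It exceeds the distance to the next hole,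
    since [g ^- beta n k] is at least [g ^ 4] flanks and lambda loses only a factor g. *)
Lemma gap_large : P + 4 * r <= lambda R g (Ordinal n2) * (g%:R ^- beta n k - (gR - 2) * b).
Proof.
have /andP[b0 b1] := beta_tail1_bounds R n2 g6 k0; have /andP[l0 l1] := lambda1_bounds.
rewrite -/b -/r in b0 b1.
have Ple := plateau_le R n2 g6 k0; rewrite -/gR -/P -/r in Ple.
have y0 : 0 < gR^-1 by rewrite invr_gt0.
(* The exponents differ by [n ^ k], which is at least 4 as both n and k are at least 2. *)
have Br : gR ^+ 4 * r <= g%:R ^- beta n k.
  have -> : g%:R ^- beta n k = gR ^+ ((n - 1) * beta n k).+1 * r.
    rewrite /r /ramp betaSl.
    have -> : (n * beta n k).+1 = (((n - 1) * beta n k).+1 + beta n k)%N.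
      by rewrite addSn -mulSnr subn1 prednK // ltnW.
    by rewrite exprD invfM mulrA divff ?mul1r // expf_neq0 // gt_eqF.
  rewrite ler_pM2r // ler_weXn2l //; first by move: gR6; lra.
  have b3 : (3 <= beta n k)%N.
    have := beta_geD 2 (k - 2) n2; rewrite (subnKC k2); apply: leq_trans.
    by rewrite betaS beta1 expn1 (leq_trans _ (leq_addr _ _)) // addSn ltnS.
  rewrite ltnS (leq_trans b3) // leq_pmull // subn_gt0 //.
have gb : (gR - 2) * b <= gR * (3 / 2 * r).
  by apply: ler_pM => //; move: gR6 b0; lra.
have X0 : (gR ^+ 4 - 3 / 2 * gR) * r <= g%:R ^- beta n k - (gR - 2) * b by lra.
have G3 : 36 * gR <= gR ^+ 3.
  rewrite (_ : gR ^+ 3 = gR * gR * gR); last by ring.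
  rewrite ler_pM2r //; have : 6 * 6 <= gR * gR by apply: ler_pM => //; lra.
  lra.
apply: le_trans (_ : gR^-1 * ((gR ^+ 4 - 3 / 2 * gR) * r) <= _); last first.
  apply: ler_pM => //; rewrite ?(ltW y0) // mulr_ge0 ?(ltW r0) //.
  have : gR * 2 <= gR * gR ^+ 3 by rewrite ler_pM2l //; move: gR6; lra.
  rewrite -exprS.
  by move: gR6; lra.
have -> : gR^-1 * ((gR ^+ 4 - 3 / 2 * gR) * r) = (gR ^+ 3 - 3 / 2) * r.
  by field; rewrite gt_eqF.
have : (gR - 1 - gR^-1 / 2) * r + 4 * r <= (gR ^+ 3 - 3 / 2) * r.
  by rewrite -mulrDl ler_pM2r //; move: gR6; lra.
by lra.
Qed.

End HighLevels.

(** * Points of a cell where two outer functions vanish *)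

Section GapPoints.
Variables (R : realType) (n m g k : nat).
Hypotheses (n2 : (2 <= n)%N) (g6 : (6 <= g)%N) (g_even : ~~ odd g).
Hypotheses (gm : g = m.+2) (k2 : (2 <= k)%N).

Let k0 : (0 < k)%N := ltnW k2.
Let gR : R := g%:R.
Let gR6 : 6 <= gR. Proof. by rewrite /gR ler_nat. Qed.
Let gR0 : 0 < gR. Proof. by apply: lt_le_trans gR6. Qed.
Let g1 : 0 < gR - 1. Proof. by move: gR6; lra. Qed.
Let G : R := gR ^+ k.
Let G0 : 0 < G. Proof. by rewrite exprn_gt0. Qed.
Let r := ramp R n g k.
Let r0 : 0 < r. Proof. exact: ramp_gt0. Qed.
Let P := plateau R n g k.
Let b := beta_tail R n g 1 k.
Let a := Defs.shift R g.
Let u := (gR - 1)^-1 / G.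
Let u0 : 0 < u. Proof. by rewrite divr_gt0 ?invr_gt0. Qed.
Let uG : 2 * u <= G^-1.
Proof.
rewrite /u mulrA -[leRHS]mul1r ler_pM2r ?invr_gt0 // ler_pdivrMr // mul1r.
by move: gR6; lra.
Qed.
Let i0 : 'I_n := Ordinal (ltnW n2).
Let i1 : 'I_n := Ordinal n2.
Let lam1 := lambda R g i1.
Let lam1_gt0 : 0 < lam1. Proof. exact: lambda_gt0. Qed.
Let psi_gap := gap_large R n2 g6 k2.

Lemma psi_gap_ivt i v : 0 <= v <= g%:R ^- beta n k - (gR - 2) * b ->
  exists2 z, (i%:R + (g - 2)%:R / (gR - 1)) / G <= z <= i.+1%:R / G &
    psi n g z = psi_val R n g k i + (g - 2)%:R * b + v.
Proof.
move=> /andP[v0 v1].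
have cg : (g - 2 < g - 1)%N by clear -g6; lia.
have cg0 : (0 < g - 1)%N by clear -g6; lia.
have e1 := psi_cell R n2 g6 g_even k i cg.
have e2 := psi_cell R n2 g6 g_even k i.+1 cg0.
have g2 : (g - 2)%:R = gR - 2 by rewrite natrB // (leq_trans _ g6).
rewrite !mul0r !addr0 in e2.
have lo : 0 <= (i%:R + (g - 2)%:R / (gR - 1)) / G.
  by rewrite divr_ge0 ?addr_ge0 ?divr_ge0 // ltW.
apply: (psi_ivt n2 g6 g_even lo); last first.
  rewrite e1 e2 lerDl v0 /=.
  apply: le_trans (psi_val_gap R n2 g6 g_even k i).
  by move: v1; rewrite g2 -/b; move: (psi_val _ _ _ _ _) => ?; lra.
rewrite ler_pM2r ?invr_gt0 // -natr1 lerD2l ler_pdivrMr // mul1r.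
by rewrite g2; lra.
Qed.

(* The supports of the bumps leave holes of length [2 * r]. Moving the second
   coordinate of [d] inside its cell brings the argument of the outer function
   [m - 1] to the start of a hole, and then the first coordinate, whose effect
   on that argument is at most [b <= 2 * r], does the same for [m]. *)
Lemma layer_gap e A (d : {ffun 'I_n -> 'I_(g ^ k)}) : 0 <= A ->
  (forall d : {ffun 'I_n -> 'I_(g ^ k)}, `|e (grid_point R d)| <= A) ->
  exists x, [/\ unit_cube x,
    forall i, `|grid_point R d i ord0 - x i ord0| <= gR ^- k &
    `|layer m g k e x| <= (m%:R - 1) * ((m%:R + 1)^-1 * A)].
Proof.
move=> A0 eA; have [m' mE] : exists m', m = m'.+1 by exists m.-1; clear -gm g6; lia.
have /andP[b0 b1] := beta_tail1_bounds R n2 g6 k0; rewrite -/b -/r in b0 b1.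
have /andP[l1 l2] := lambda1_bounds R n2 g6; rewrite -/i1 -/lam1 in l1 l2.
have gap : P + 4 * r <= lam1 * (g%:R ^- beta n k - (gR - 2) * b) := psi_gap.
have P0 : 0 <= P := plateau_ge0 R n2 g6 k.
have gap0 : 0 <= g%:R ^- beta n k - (gR - 2) * b.
  by rewrite -(pmulr_rge0 _ lam1_gt0); apply: le_trans gap; move: r0; lra.
pose pt (x0 x1 : R) : 'cV[R]_n := \col_i
  if i == i0 then x0 else if i == i1 then x1 else (d i)%:R / G.
pose rest j := \sum_(i < n | (i != i0) && (i != i1))
  lambda R g i * psi n g ((d i)%:R / G + j%:R * a).
have xi_pt x0 x1 j : xi g (pt x0 x1 + const_mx (j%:R * a)) =
    psi n g (x0 + j%:R * a) + lam1 * psi n g (x1 + j%:R * a) + rest j.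
  rewrite /xi (bigD1 i0) //= (bigD1 i1) //= !mxE eqxx {1}/lambda /= mul1r addrA.
  congr (_ + _); apply: eq_bigr => i /andP[/negbTE ii0 /negbTE ii1].
  by rewrite !mxE ii0 ii1.
have cell j c i : (d i)%:R / G + j%:R * a + (c%:R - j%:R) * u =
    ((grid_index d j i)%:R + c%:R / (gR - 1)) / G.
  by rewrite -grid_point_cell // /u mulrA.
have dG i : 0 <= (d i)%:R / G /\ (d i)%:R / G + G^-1 <= 1.
  split; first by rewrite divr_ge0 // ltW.
  rewrite -[X in _ + X]mul1r -mulrDl natr1 ler_pdivrMr // mul1r /G /gR -natrX.
  by rewrite ler_nat ltn_ord.
have gE c : (c <= g)%N -> (g - c)%:R = gR - c%:R by move=> cg; rewrite natrB.
have mg2 : m = (g - 2)%N by rewrite gm subn2.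
have mg3 : m' = (g - 3)%N by clear -gm mE; lia.
have mR : m%:R = gR - 2 by rewrite mg2 gE // (leq_trans _ g6).
have m'R : m'%:R = gR - 3 by rewrite mg3 gE // (leq_trans _ g6).
set V0 := psi_val R n g k (grid_index d m' i0).
set V1 := psi_val R n g k (grid_index d m' i1).
(* Lowest argument of the outer function [m']: the first coordinate has the repeated digit [m'], as
   at the grid point itself, and the second the repeated digit [g - 2], where its free range
   starts. *)
pose y0 := V0 + m'%:R * b + lam1 * (V1 + (g - 2)%:R * b) + rest m'.
have [y /andP[y0y yy0] hole1] := theta_hole n2 g6 g_even k2 m' y0.
rewrite -/P -/r in yy0 hole1.
have [|z1 /andP[z1l z1u] psiz1] := @psi_gap_ivt (grid_index d m' i1) ((y - y0) / lam1).
  rewrite divr_ge0 ?subr_ge0 ?(ltW lam1_gt0) //= ler_pdivrMr // mulrC.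
  by apply: le_trans gap; lra.
pose x1 := z1 - m'%:R * a.
pose y0' := psi_val R n g k (grid_index d m i0) + (g - 2)%:R * b
  + lam1 * psi n g (x1 + m%:R * a) + rest m.
have [y' /andP[y0y' yy0'] hole2] := theta_hole n2 g6 g_even k2 m y0'.
rewrite -/P -/r in yy0' hole2.
have [|z0 /andP[z0l z0u] psiz0] := @psi_gap_ivt (grid_index d m i0) (y' - y0').
  rewrite subr_ge0 y0y' /=; apply: le_trans (_ : P + 4 * r <= _); first by lra.
  apply: (le_trans gap); rewrite -[leRHS]mul1r ler_pM2r ?lt_neqAle //.
  rewrite gap0 andbT; apply/eqP => gap_eq0; move: gap; rewrite -gap_eq0 mulr0.
  by move: r0 P0; lra.
pose x0 := z0 - m%:R * a.
(* Relative to the repeated digit [m' = g - 3], the range from [g - 2] to the end of the cell is a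
   displacement between [u] and [2 * u]; for the first coordinate and [m = g - 2] it is between 0
   and [u]. *)
have z1b : (d i1)%:R / G + u <= x1 <= (d i1)%:R / G + 2 * u.
  have c1 := cell m' (g - 2)%N i1; have c2 := cell m' (g - 1)%N i1.
  rewrite !gE ?(leq_trans _ g6) // m'R in c1 c2.
  have e2 : (gR - 1) / (gR - 1) = 1 by rewrite divff // gt_eqF.
  rewrite e2 natr1 in c2; rewrite !gE ?(leq_trans _ g6) // in z1l.
  rewrite -c1 in z1l; rewrite -c2 in z1u; rewrite /x1 m'R.
  by apply/andP; split; move: z1l z1u; lra.
have z0b : (d i0)%:R / G <= x0 <= (d i0)%:R / G + u.
  have c1 := cell m (g - 2)%N i0; have c2 := cell m (g - 1)%N i0.
  rewrite !gE ?(leq_trans _ g6) // mR in c1 c2.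
  have e2 : (gR - 1) / (gR - 1) = 1 by rewrite divff // gt_eqF.
  rewrite e2 natr1 in c2; rewrite !gE ?(leq_trans _ g6) // in z0l.
  rewrite -c1 in z0l; rewrite -c2 in z0u; rewrite /x0 mR.
  by apply/andP; split; move: z0l z0u; lra.
exists (pt x0 x1).
have ptd i : (d i)%:R / G <= pt x0 x1 i ord0 <= (d i)%:R / G + G^-1.
  have Gi : 0 < G^-1 by rewrite invr_gt0.
  rewrite mxE; case: eqP => [->|_].
    by move: z0b u0 uG => /andP[? ?] ? ?; apply/andP; split; lra.
  case: eqP => [->|_].
    by move: z1b u0 uG => /andP[? ?] ? ?; apply/andP; split; lra.
  by apply/andP; split; lra.
split.
- move=> i; have /andP[p1 p2] := ptd i; have [d1 d2] := dG i.
  by apply/andP; split; lra.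
- move=> i; have /andP[p1 p2] := ptd i; rewrite mxE -/gR -/G.
  by rewrite distrC ger0_norm ?subr_ge0 //; lra.
have zero1 : outer_layer m g k e m' (xi g (pt x0 x1 + const_mx (m'%:R * a))) = 0.
  rewrite /outer_layer big1 ?mulr0 // => d' _; rewrite hole1 ?mulr0 //.
  rewrite xi_pt [x1 + _]subrK psiz1.
  (* A displacement of the first coordinate by at most [u] moves its repeated digit in the translate
     [m'] from [m'] to at most [m' + 1], which costs at most [b], less than the length of the
     hole. *)
  have /andP[q1 q2] : V0 + m'%:R * b <= psi n g (x0 + m'%:R * a) <= V0 + m'%:R * b + b.
    have m'g : (m' < g - 1)%N by clear -gm mE; lia.
    have m'g1 : (m'.+1 < g - 1)%N by clear -gm mE; lia.
    have lo := psi_cell R n2 g6 g_even k (grid_index d m' i0) m'g.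
    have hi := psi_cell R n2 g6 g_even k (grid_index d m' i0) m'g1.
    have c1 := cell m' m' i0; have c2 := cell m' m'.+1 i0.
    have e1 : m'.+1%:R - m'%:R = 1 :> R by rewrite -natr1 addrAC subrr add0r.
    rewrite subrr mul0r addr0 in c1; rewrite e1 mul1r in c2.
    have a0 : 0 < a by rewrite invr_gt0 mulr_gt0.
    have [d1 _] := dG i0; have /andP[x0l x0u] := z0b.
    have m'a : 0 <= m'%:R * a by rewrite mulr_ge0 // ltW.
    apply/andP; split.
      by rewrite -[leLHS]lo -c1; apply: psi_le => //; [exact: addr_ge0|rewrite lerD2r].
    have -> : V0 + m'%:R * b + b = V0 + m'.+1%:R * b by rewrite -natr1 mulrDl mul1r addrA.
    rewrite -[leRHS]hi -c2; apply: psi_le => //; last by lra.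
    by apply: addr_ge0 => //; lra.
  rewrite mulrDr [lam1 * (_ / _)]mulrCA divff ?mulr1 ?(gt_eqF lam1_gt0) //.
  rewrite -/V1; move: q1 q2; set w := psi n g _ => q1 q2.
  have -> : w + (lam1 * (V1 + (g - 2)%:R * b) + (y - y0)) + rest m' =
    w - (V0 + m'%:R * b) + y by rewrite /y0; ring.
  by apply/andP; split; lra.
have zero2 : outer_layer m g k e m (xi g (pt x0 x1 + const_mx (m%:R * a))) = 0.
  rewrite /outer_layer big1 ?mulr0 // => d' _; rewrite hole2 ?mulr0 //.
  rewrite xi_pt [x0 + _]subrK psiz0.
  set V := psi_val _ _ _ _ _.
  have -> : V + (g - 2)%:R * b + (y' - y0') + lam1 * psi n g (x1 + m%:R * a) + rest m = y'.
    by rewrite /y0' -/V; ring.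
  by rewrite lexx /=; move: r0; lra.
rewrite /layer /superpose big_ord_recr /= zero2 addr0.
have gen (F : nat -> R) : \sum_(j < m) F j = \sum_(j < m') F j + F m'.
  by rewrite mE big_ord_recr.
rewrite (gen (fun j => outer_layer m g k e j (xi g (pt x0 x1 + const_mx (j%:R * a))))).
rewrite zero1 addr0; apply: le_trans (ler_norm_sum _ _ _) _.
have -> : m%:R - 1 = m'%:R :> R by rewrite mR m'R; ring.
rewrite mulr_natl -[m' in leRHS]card_ord -sumr_const; apply: ler_sum => j _.
apply: outer_layer_le => // d1 d2 j1 d12.
apply: le_trans (grid_separated_level2 R n2 g6 g_even k2 j1 d12).
by rewrite -/P -/r; move: r0; lra.
Qed.

End GapPoints.

(** * Exact representation by the layer of level 1 *)

Section SupNorm.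
Variables (R : realType) (n : nat).
Implicit Types (e : 'cV[R]_n -> R).

Lemma unit_cube0 : unit_cube (0 : 'cV[R]_n).
Proof. by move=> i; rewrite mxE lexx ler01. Qed.

Lemma supnorm_cube e A : (forall x, unit_cube x -> `|e x| <= A) ->
  exists M, [/\ supnorm unit_cube e = M%:E, forall x, unit_cube x -> `|e x| <= M &
    forall A', (forall x, unit_cube x -> `|e x| <= A') -> M <= A'].
Proof.
move=> eA.
have ub A' : (forall x, unit_cube x -> `|e x| <= A') -> (supnorm unit_cube e <= A'%:E)%E.
  by move=> eA'; apply: ge_ereal_sup => _ [x xc <-]; rewrite lee_fin eA'.
have lb x : unit_cube x -> (`|e x|%:E <= supnorm unit_cube e)%E.
  by move=> xc; apply: ereal_sup_ubound; exists x.
have fin : supnorm unit_cube e \is a fin_num.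
  apply/fin_numPlt/andP; split.
    by apply: lt_le_trans (lb _ unit_cube0); rewrite ltNyr.
  by apply: le_lt_trans (ub _ eA) _; rewrite ltry.
exists (fine (supnorm unit_cube e)); rewrite fineK //; split=> // [x xc|A' eA'].
  by rewrite -lee_fin fineK // lb.
by rewrite -lee_fin fineK // ub.
Qed.

End SupNorm.

Section ExactRepresentation.
Variables (R : realType) (n m g : nat).
Hypotheses (n2 : (2 <= n)%N) (g6 : (6 <= g)%N) (g_even : ~~ odd g).
Hypothesis gm : g = m.+2.
Variables (delta : R) (f : 'cV[R]_n -> R) (ks : nat -> nat).
Hypotheses (delta0 : 0 < delta) (delta2 : 2 * delta < 1).
Hypothesis delta_m : delta * (m%:R + 1) < 2.
Hypothesis adm : admissible m g delta f ks.
Hypothesis f1 : forall x, unit_cube x -> `|f x| <= 1.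

Let gR : R := g%:R.
Let gR6 : 6 <= gR. Proof. by rewrite /gR ler_nat. Qed.
Let gR0 : 0 < gR. Proof. by apply: lt_le_trans gR6. Qed.
Let m10 : 0 < m%:R + 1 :> R. Proof. by rewrite natr1. Qed.
Let e := residual m g f ks.

Lemma floor_grid k (x : 'cV[R]_n) : unit_cube x ->
  exists d : {ffun 'I_n -> 'I_(g ^ k)},
    forall i, `|x i ord0 - grid_point R d i ord0| <= gR ^- k.
Proof.
move=> xc; have G0 : 0 < gR ^+ k by rewrite exprn_gt0.
have gk0 : (0 < g ^ k)%N by rewrite expn_gt0 (leq_trans _ g6).
(* The cap concerns the coordinate 1, whose integer part [g ^ k] is not an index of the grid; the
   last cell serves for it. *)
pose t i := minn (Num.truncn (x i ord0 * gR ^+ k)) (g ^ k).-1.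
have tlt i : (t i < g ^ k)%N by rewrite -[ltnRHS]prednK // ltnS geq_minr.
exists [ffun i => Ordinal (tlt i)] => i; rewrite mxE ffunE /=.
have /andP[x0 x1] := xc i; set z := x i ord0 in x0 x1 *.
have zG0 : 0 <= z * gR ^+ k by rewrite mulr_ge0 // ltW.
have /andP[lo hi] := truncn_itv zG0.
have [t1 t2] : (t i)%:R <= z * gR ^+ k /\ z * gR ^+ k <= (t i)%:R + 1.
  rewrite /t; case: leqP => tg; first by split; rewrite // natr1 ltW.
  split; first by apply: le_trans lo; rewrite ler_nat ltnW.
  by rewrite natr1 prednK // natrX ger_pMl.
have -> : z - (t i)%:R / g%:R ^+ k = (z * gR ^+ k - (t i)%:R) / gR ^+ k.
  by rewrite mulrBl mulfK // gt_eqF.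
rewrite normrM normfV [`|gR ^+ k|]gtr0_norm // -[leRHS]mul1r ler_pM2r ?invr_gt0 //.
by apply/ler_normlP; split; lra.
Qed.

Lemma residual_bounded r : exists A, forall x, unit_cube x -> `|e r x| <= A.
Proof.
elim: r => [|r [A eA]]; first by exists 1 => x; rewrite /e residual0; exact: f1.
have A0 : 0 <= A by apply: le_trans (eA _ (@unit_cube0 _ _)).
have eA' (d : {ffun 'I_n -> 'I_(g ^ ks r)}) : `|e r (grid_point R d)| <= A.
  by apply: eA; exact: grid_point_cube.
have [A' A'0 layerA'] := layer_bounded m n2 g6 A0 eA'.
exists (A + A') => x xc; rewrite /e residualS.
by apply: le_trans (ler_normB _ _) _; apply: lerD; [exact: eA|exact: layerA'].
Qed.

Lemma residual_modulus r : exists M, [/\ forall x, unit_cube x -> `|e r x| <= M,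
  forall A, (forall x, unit_cube x -> `|e r x| <= A) -> M <= A &
  forall x y, unit_cube x -> unit_cube y ->
    (forall i, `|x i ord0 - y i ord0| <= gR ^- ks r) ->
    `|e r x - e r y| <= delta * M].
Proof.
have [A eA] := residual_bounded r; have [M [supE eM Mle]] := supnorm_cube eA.
exists M; split => // x y xc yc xy.
have := (adm r).2 x y xc yc xy.
by rewrite -/(e r) supE -EFinM lee_fin.
Qed.

(** [M] is the norm of e_r. A point is reached from a zero of e_r in [c] oscillation steps, each
    costing at most [delta * M]: one step from level 2 on, two at level 1. So [M] is at most
    [c * delta * M]. *)
Lemma residual_eq0 r c : c * delta < 1 ->
  (forall M x, (forall A, (forall x, unit_cube x -> `|e r x| <= A) -> M <= A) ->
    (forall x y, unit_cube x -> unit_cube y ->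
      (forall i, `|x i ord0 - y i ord0| <= gR ^- ks r) ->
      `|e r x - e r y| <= delta * M) ->
    unit_cube x -> `|e r x| <= c * (delta * M)) ->
  forall x, unit_cube x -> e r x = 0.
Proof.
move=> c1 ecM x xc; have [M [eM Mle osc]] := residual_modulus r.
have M0 : 0 <= M by apply: le_trans (eM _ (@unit_cube0 _ _)).
have Mc : M <= c * (delta * M).
  by apply: (Mle (c * (delta * M))) => z zc; exact: (ecM M z Mle osc zc).
have : M * (1 - c * delta) <= 0 by rewrite mulrBr mulr1; lra.
rewrite pmulr_lle0 ?subr_gt0 // => M1.
by apply/eqP; rewrite -normr_le0 (le_trans (eM x xc)).
Qed.

Lemma ks_gt0 r : (0 < ks r)%N. Proof. by have [] := adm r. Qed.

Lemma residual_grid r (d : {ffun 'I_n -> 'I_(g ^ ks r)}) : (2 <= ks r)%N ->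
  e r.+1 (grid_point R d) = 0.
Proof.
move=> k2; rewrite /e residualS layer_grid ?subrr //; first exact: ks_gt0.
move=> d' j d'd; apply: le_trans (grid_separated_level2 R n2 g6 g_even k2 j d'd).
by rewrite lerD2l; have := ramp_gt0 R n g6 (ks r); lra.
Qed.

Lemma residual_eq0_level2 r : (2 <= ks r)%N -> (ks r.+1 <= ks r)%N ->
  forall x, unit_cube x -> e r.+1 x = 0.
Proof.
move=> k2 kk; apply: (@residual_eq0 _ 1); first by move: delta0 delta2; rewrite mul1r; lra.
move=> M x _ osc xc; have [d xd] := floor_grid (ks r) xc.
have := osc x (grid_point R d) xc (grid_point_cube R g6 d).
rewrite residual_grid // subr0 mul1r; apply => i; apply: le_trans (xd i) _.
rewrite lef_pV2 ?posrE ?exprn_gt0 // ler_weXn2l //.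
by move: gR6; lra.
Qed.

(* At level 1 the bumps of two grid points may overlap, but not if the second
   coordinate of one of them is neither [0] nor [(g - 1) / g]. Every grid point
   has a neighbour of this kind, hence a second oscillation in the bound. *)
Lemma residual_eq0_level1 r : ks r = 1%N -> ks r.+1 = 1%N ->
  forall x, unit_cube x -> e r.+1 x = 0.
Proof.
move=> k1 k1'; apply: (@residual_eq0 _ 2) => // M x _ osc xc.
rewrite k1' in osc; have [d xd] := floor_grid 1 xc.
pose i1 : 'I_n := Ordinal n2.
have [d' d'1 dd'] : exists2 d' : {ffun 'I_n -> 'I_(g ^ 1)}, (0 < d' i1 < g - 1)%N &
    forall i, `|grid_point R d i ord0 - grid_point R d' i ord0| <= gR ^- 1.
  pose v := if (d i1 == 0 :> nat) then 1%N else if (d i1 < g - 1)%N then d i1 : nat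
    else (g - 2)%N.
  have dlt : (d i1 < g)%N by apply: leq_trans (ltn_ord (d i1)) _; rewrite expn1.
  have [v0 vg vd dv] : [/\ (0 < v < g - 1)%N, (v < g)%N, (v <= (d i1).+1)%N
      & (d i1 <= v.+1)%N].
    rewrite /v; move: (nat_of_ord (d i1)) dlt => w wg; move: wg g6; clear => wg g6.
    by have [w0|w0] := eqVneq w 0%N; [|have [w1|w1] := ltnP w (g - 1)]; split; lia.
  have vlt : (v < g ^ 1)%N by rewrite expn1.
  exists [ffun i => if i == i1 then Ordinal vlt else d i].
    by rewrite ffunE eqxx.
  move=> i; rewrite !mxE ffunE; case: eqP => [->|_]; last first.
    by rewrite subrr normr0 invr_ge0 exprn_ge0 // ltW.
  have G0 : 0 < g%:R ^+ 1 :> R by rewrite exprn_gt0.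
  rewrite -mulrBl normrM normfV (gtr0_norm G0) -[leRHS]mul1r ler_pM2r ?invr_gt0 //=.
  have := vd; have := dv; rewrite -!(ler_nat R) -!natr1 => v1 v2.
  by apply/ler_normlP; split; lra.
have ed'0 : e r.+1 (grid_point R d') = 0.
  rewrite /e residualS k1 layer_grid ?subrr // => d1 j d1d'.
  exact: grid_separated_level1.
have s1 := osc _ _ xc (grid_point_cube R g6 d) xd.
have s2 := osc _ _ (grid_point_cube R g6 d) (grid_point_cube R g6 d') dd'.
rewrite ed'0 subr0 in s2.
have -> : e r.+1 x = (e r.+1 x - e r.+1 (grid_point R d)) + e r.+1 (grid_point R d).
  by rewrite subrK.
by apply: le_trans (ler_normD _ _) _; lra.
Qed.

Lemma residual_eq0_backward r : (2 <= ks r)%N ->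
  (forall x, unit_cube x -> e r.+1 x = 0) -> forall x, unit_cube x -> e r x = 0.
Proof.
move=> k2 eS0; have k0 := ks_gt0 r.
have e_layer x : unit_cube x -> e r x = layer m g (ks r) (e r) x.
  by move=> xc; have := eS0 x xc; rewrite /e residualS => /eqP; rewrite subr_eq0 => /eqP.
have [d0 _] := floor_grid (ks r) (@unit_cube0 R n).
pose E (d : {ffun 'I_n -> 'I_(g ^ ks r)}) := `|e r (grid_point R d)|.
pose ds := [arg max_(d > d0) E d]%O; have Eds d : E d <= E ds.
  by rewrite /ds; case: arg_maxP => // d1 _; apply.
have A0 : 0 <= E ds := normr_ge0 _.
have sep (d d' : {ffun 'I_n -> 'I_(g ^ ks r)}) j : d' != d ->
    plateau R n g (ks r) + 2 * ramp R n g (ks r) <=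
    `|xi_val R n g (ks r) (grid_index d j) - xi_val R n g (ks r) (grid_index d' j)|.
  move=> d'd; apply: le_trans (grid_separated_level2 R n2 g6 g_even k2 j d'd).
  by rewrite lerD2l; have := ramp_gt0 R n g6 (ks r); lra.
(* As e_r equals its own layer and each outer function has at most one active bump, the norm of e_r
   is attained on the grid. *)
have eE x : unit_cube x -> `|e r x| <= E ds.
  move=> xc; rewrite e_layer //; apply: le_trans (ler_norm_sum _ _ _) _.
  apply: le_trans (_ : \sum_(j < m.+1) (m%:R + 1)^-1 * E ds <= _).
    by apply: ler_sum => j _; apply: outer_layer_le.
  by rewrite sumr_const card_ord -[leLHS]mulr_natl -natr1 mulrA divff ?mul1r // gt_eqF.
have [x [xc xds xle]] := layer_gap n2 g6 g_even gm k2 ds A0 Eds.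
have [M [eM Mle osc]] := residual_modulus r.
have := osc _ _ (grid_point_cube R g6 ds) xc xds.
have := Mle _ eE; rewrite -e_layer // in xle => ME.
have dM : delta * M <= delta * E ds by rewrite ler_pM2l.
have := lerB_dist (e r (grid_point R ds)) (e r x); rewrite -/(E ds) => d1 d2.
have : E ds - (m%:R - 1) * ((m%:R + 1)^-1 * E ds) <= delta * E ds by lra.
have -> : E ds - (m%:R - 1) * ((m%:R + 1)^-1 * E ds) = E ds * 2 / (m%:R + 1).
  by field; rewrite gt_eqF.
rewrite ler_pdivrMr // => E2.
have : E ds * (2 - delta * (m%:R + 1)) <= 0 by rewrite mulrBr; lra.
rewrite pmulr_lle0 ?subr_gt0 // => E0 z zc.
by apply/eqP; rewrite -normr_le0 (le_trans (eE z zc)).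
Qed.

Hypothesis ks_bounded : exists K, forall r, (ks r <= K)%N.

Lemma layer1_exact x : unit_cube x -> f x = layer m g 1 f x.
Proof.
have e0 : e 0 = f by apply/funext => z; exact: residual0.
have [r kr] : exists r, (ks r.+1 <= ks r)%N.
  have [K ksK] := ks_bounded; apply: contrapT => /forallNP incr.
  have grow r : (r <= ks r)%N.
    elim: r => // r IHr; apply: leq_ltn_trans IHr _.
    by rewrite ltnNge; apply/negP; exact: incr.
  by have := leq_trans (grow K.+1) (ksK K.+1); rewrite ltnn.
have eS0 : forall z, unit_cube z -> e r.+1 z = 0.
  have [k2|k1] := leqP 2 (ks r); first exact: residual_eq0_level2.
  have := ks_gt0 r; have := ks_gt0 r.+1 => kS0 kr0.
  apply: residual_eq0_level1; first by apply/eqP; rewrite eqn_leq kr0 andbT.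
  by apply/eqP; rewrite eqn_leq kS0 andbT (leq_trans kr).
elim: r {kr} eS0 => [|r IHr] eS0 xc.
  have [k2|k1] := leqP 2 (ks 0).
    have f0 z : unit_cube z -> f z = 0.
      by rewrite -e0; exact: residual_eq0_backward.
    rewrite f0 // /layer /superpose big1 // => j _.
    rewrite /outer_layer big1 ?mulr0 // => d _.
    by rewrite f0 ?mul0r //; exact: grid_point_cube.
  have kE : ks 0 = 1%N by apply/eqP; rewrite eqn_leq ks_gt0 andbT.
  have := eS0 x xc; rewrite /e residualS -/e kE -/(e 0) e0.
  by move=> /eqP; rewrite subr_eq0 => /eqP.
apply: IHr => //; have [k2|k1] := leqP 2 (ks r.+1).
  exact: residual_eq0_backward.
have kE : ks r.+1 = 1%N by apply/eqP; rewrite eqn_leq ks_gt0 andbT.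
have [k2'|k1'] := leqP 2 (ks r).
  by apply: residual_eq0_level2 => //; rewrite kE ltnW.
by apply: residual_eq0_level1 => //; apply/eqP; rewrite eqn_leq ks_gt0 andbT.
Qed.

End ExactRepresentation.

(** * Networks *)

Section Networks.
Variable R : realType.

Lemma nonzerosE p q (A : 'M[R]_(p, q)) :
  nonzeros A = (\sum_i \sum_j (A i j != 0%R))%N.
Proof.
rewrite /nonzeros -sum1_card big_mkcond /= pair_bigA /=.
by apply: eq_bigr => -[i j] _ /=; rewrite inE /=; case: (A i j == 0).
Qed.

Lemma nonzeros_leD p q (A B : 'M[R]_(p, q)) :
  (nonzeros (A + B) <= nonzeros A + nonzeros B)%N.
Proof.
rewrite !nonzerosE -big_split /=; apply: leq_sum => i _.
rewrite -big_split /=; apply: leq_sum => j _; rewrite mxE.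
case: (eqVneq (A i j) 0) => [->|_]; last by case: eqP.
by rewrite add0r.
Qed.

Lemma nonzeros0 p q : nonzeros (0 : 'M[R]_(p, q)) = 0%N.
Proof. by rewrite nonzerosE big1 // => i _; rewrite big1 // => j _; rewrite mxE eqxx. Qed.

Lemma nonzeros_sum p q (I : finType) (P : pred I) (A : I -> 'M[R]_(p, q)) :
  (nonzeros (\sum_(i | P i) A i)%R <= \sum_(i | P i) nonzeros (A i))%N.
Proof.
elim/big_ind2: _ => [|x1 x2 y1 y2 h1 h2|//]; first by rewrite nonzeros0.
exact: leq_trans (nonzeros_leD _ _) (leq_add h1 h2).
Qed.

Lemma nonzero_sum_leq (I : finType) (P : pred I) (F : I -> R) :
  (((\sum_(i | P i) F i)%R != 0%R) <= \sum_(i | P i) (F i != 0%R))%N.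
Proof.
elim/big_ind2: _ => [|x1 x2 y1 y2|//]; first by rewrite eqxx.
case: (eqVneq x1 0) => [->|_]; case: (eqVneq y1 0) => [->|_] /=; rewrite ?add0r ?addr0;
  by case: eqP => //=; lia.
Qed.

Lemma nonzeros_row_mx0 p q1 q2 (A : 'M[R]_(p, q1)) :
  nonzeros (row_mx A (0 : 'M[R]_(p, q2))) = nonzeros A.
Proof.
rewrite !nonzerosE; apply: eq_bigr => i _; rewrite big_split_ord /=.
under eq_bigr do rewrite row_mxEl.
by rewrite [X in (_ + X)%N]big1 ?addn0 // => j _; rewrite row_mxEr mxE eqxx.
Qed.

(** Weights of a layer that reads selected entries of a larger input, transported to that input.
    Weights reading the same entry are added, so the number of nonzero weights cannot grow. *)
Definition col_push p q e (s : 'I_q -> 'I_e) (A : 'M[R]_(p, q)) : 'M[R]_(p, e) :=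
  \matrix_(i, c) \sum_(j | s j == c) A i j.

Lemma col_push_mul p q e (s : 'I_q -> 'I_e) (A : 'M[R]_(p, q)) (x : 'cV[R]_e) :
  col_push s A *m x = A *m rowsub s x.
Proof.
apply/matrixP => i z; rewrite !mxE.
rewrite (partition_big s predT) //=; apply: eq_bigr => c _; rewrite mxE mulr_suml.
by apply: eq_bigr => j /eqP sj; rewrite mxE sj.
Qed.

Lemma row_nonzeros_push q e (s : 'I_q -> 'I_e) (a : 'I_q -> R) :
  (\sum_c ((\sum_(j | s j == c) a j)%R != 0%R) <= \sum_j (a j != 0%R))%N.
Proof.
rewrite (partition_big s predT) //=; apply: leq_sum => c _.
exact: nonzero_sum_leq.
Qed.

Lemma nonzeros_push p q e (s : 'I_q -> 'I_e) (A : 'M[R]_(p, q)) :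
  (nonzeros (col_push s A) <= nonzeros A)%N.
Proof.
rewrite !nonzerosE; apply: leq_sum => i _.
apply: leq_trans (row_nonzeros_push s (A i)); apply: leq_sum => c _.
by rewrite mxE.
Qed.

Section Peel.
Variable d : nat.
Implicit Type N : relu_net R d.

Definition hd_units N : nat :=
  match N with OutputLayer _ _ => 0 | HiddenLayer k _ _ _ => k end.

Definition hd_weights N : 'M[R]_(hd_units N, d) :=
  match N with
  | OutputLayer _ _ => 0
  | HiddenLayer _ A _ _ => A
  end.

Definition hd_bias N : 'cV[R]_(hd_units N) :=
  match N with
  | OutputLayer _ _ => 0
  | HiddenLayer _ _ b _ => b
  end.

(* An output layer is kept, so that finished networks can wait for others. *)
Definition tl_net N : relu_net R (d + hd_units N) :=
  match N with
  | OutputLayer w b => OutputLayer (row_mx w 0) b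
  | HiddenLayer _ _ _ N' => N'
  end.

Lemma net_eval_peel N x : net_eval N x =
  net_eval (tl_net N) (col_mx x (map_mx relu (hd_weights N *m x + hd_bias N))).
Proof. by case: N => //= w b; rewrite mul_row_col mul0mx addr0. Qed.

Lemma net_size_peel N :
  (nonzeros (hd_weights N) + nonzeros (hd_bias N) + net_size (tl_net N))%N
  = net_size N.
Proof. by case: N => //= w b; rewrite !nonzeros0 nonzeros_row_mx0. Qed.

Lemma net_depth_peel N L : (net_depth N <= L.+2)%N -> (net_depth (tl_net N) <= L.+1)%N.
Proof. by case: N. Qed.

End Peel.

(* The hidden layers of a family of networks, run in parallel on inputs that
   are selected from a common input. The output layers are left to the user,
   so that they can be merged into the next layer at no cost. *)
Lemma parallel_hidden_layers (P : finType) L :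
  forall e (d : P -> nat) (s : forall p, 'I_(d p) -> 'I_e)
    (N : forall p, relu_net R (d p)),
  (forall p, net_depth (N p) <= L.+1)%N ->
  exists e' (T : relu_net R e' -> relu_net R e) (F : 'cV[R]_e -> 'cV[R]_e')
    (w : P -> 'rV[R]_e') (b : P -> R) (S0 : nat),
  [/\ forall N' x, net_eval (T N') x = net_eval N' (F x),
      forall N', net_depth (T N') = (L + net_depth N')%N,
      forall N', net_size (T N') = (S0 + net_size N')%N,
      (S0 + \sum_p (nonzeros (w p) + (b p != 0%R)) <= \sum_p net_size (N p))%N &
      forall x p, (w p *m F x) ord0 ord0 + b p = net_eval (N p) (rowsub (s p) x)].
Proof.
elim: L => [|L IHL] e d s N depN.
  have out p : exists wb : 'rV[R]_(d p) * R, N p = OutputLayer wb.1 wb.2.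
    have := depN p; case: (N p) => [w b _|k A b N' /=]; first by exists (w, b).
    by rewrite ltnS leqn0; case: N'.
  pose wb p := projT1 (cid (out p)).
  have NE p : N p = OutputLayer (wb p).1 (wb p).2 := projT2 (cid (out p)).
  exists e, id, id, (fun p => col_push (s p) (wb p).1), (fun p => (wb p).2), 0%N.
  split => // [|x p].
    rewrite add0n; apply: leq_sum => p _; rewrite NE /= leq_add2r.
    exact: nonzeros_push.
  by rewrite NE /= col_push_mul.
pose k p := hd_units (N p).
pose U : finType := {p : P & 'I_(k p)}.
pose A : 'M[R]_(#|U|, e) := \matrix_(v, c)
  col_push (s (tag (enum_val v))) (hd_weights (N (tag (enum_val v))))
    (tagged (enum_val v)) c.
pose B : 'cV[R]_#|U| := \col_v hd_bias (N (tag (enum_val v))) (tagged (enum_val v)) ord0.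
(* Selection map after one merged layer: the inputs of network [p] stay where they were, and its new
   units are found at their rank among the units of all the networks. *)
pose s' p (i : 'I_(d p + k p)) : 'I_(e + #|U|) :=
  match fintype.split i with
  | inl i' => lshift #|U| (s p i')
  | inr i' => rshift e (enum_rank (Tagged (fun p => 'I_(k p)) i' : U))
  end.
have [|e' [T [F [w [b [S0 [T_eval T_depth T_size S0_le F_eval]]]]]]] :=
  IHL (e + #|U|)%N (fun p => d p + k p)%N s' (fun p => tl_net (N p)).
  by move=> p; exact: net_depth_peel.
exists e', (fun N' => HiddenLayer A B (T N')),
  (fun x => F (col_mx x (map_mx relu (A *m x + B)))), w, b,
  (nonzeros A + nonzeros B + S0)%N.
split => // [N'|N'|N'||x p].
- by move=> x /=; rewrite T_eval.
- by rewrite /= T_depth.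
- by rewrite /= T_size !addnA.
- have reindexU (H : 'I_#|U| -> nat) : (\sum_v H v = \sum_(u : U) H (enum_rank u))%N.
    apply: reindex; exists enum_val => ? _; [exact: enum_rankK|exact: enum_valK].
  under [X in (_ <= X)%N]eq_bigr do rewrite -net_size_peel.
  rewrite [X in (_ <= X)%N]big_split /= -addnA.
  apply: leq_add => //.
  rewrite [X in (_ <= X)%N]big_split /=; apply: leq_add.
    rewrite nonzerosE reindexU; under [X in (_ <= X)%N]eq_bigr do rewrite nonzerosE.
    rewrite [leqRHS]sig_big_dep /=.
    apply: leq_sum => u _.
    apply: leq_trans (row_nonzeros_push (s (tag u)) (hd_weights (N (tag u)) (tagged u))).
    by apply: leq_sum => c _; rewrite mxE enum_rankK mxE.
  rewrite nonzerosE reindexU; under [X in (_ <= X)%N]eq_bigr do rewrite nonzerosE.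
  rewrite [leqRHS]sig_big_dep /=.
  apply: leq_sum => u _; rewrite !big_ord1 mxE enum_rankK.
  by [].
rewrite F_eval [RHS]net_eval_peel.
suff E : rowsub (s' p) (col_mx x (map_mx relu (A *m x + B))) =
    col_mx (rowsub (s p) x)
      (map_mx relu (hd_weights (N p) *m rowsub (s p) x + hd_bias (N p))).
  by rewrite E.
apply/matrixP => i j; rewrite [j]ord1 mxE /s' [RHS]mxE.
case: fintype.splitP => i' ii'; first by rewrite col_mxEu [RHS]mxE.
rewrite -col_push_mul col_mxEd mxE [RHS]mxE; congr relu.
rewrite mxE [RHS]mxE; congr (_ + _); last by rewrite mxE enum_rankK.
rewrite mxE [RHS]mxE; apply: eq_bigr => c _; congr (_ * _).
by rewrite mxE enum_rankK.
Qed.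

Lemma net_size0_eval d (N : relu_net R d) x : net_size N = 0%N -> net_eval N x = 0.
Proof.
elim: N x => [d' w b|d' k A b N IHN] x /=.
  move/eqP; rewrite addn_eq0 => /andP[w0 b0].
  have -> : b = 0 by apply/eqP; move: b0; rewrite eqb0 negbK.
  rewrite addr0 mxE big1 // => j _.
  move: w0; rewrite nonzerosE big_ord1 sum_nat_eq0 => /forallP/(_ j)/=.
  by rewrite eqb0 negbK => /eqP ->; rewrite mul0r.
by move/eqP; rewrite addn_eq0 => /andP[_ /eqP]; exact: IHN.
Qed.

Lemma nonzeros_eq0 p q (A : 'M[R]_(p, q)) : nonzeros A = 0%N -> A = 0.
Proof.
rewrite nonzerosE => /eqP; rewrite sum_nat_eq0 => /forallP A0.
apply/matrixP => i j; rewrite mxE; have := A0 i; rewrite /= sum_nat_eq0.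
by move=> /forallP/(_ j)/=; rewrite eqb0 negbK => /eqP.
Qed.

(** A nonzero value at input 0 requires a nonzero bias; this uses up the single weight, so nothing
    is connected to the input. *)
Lemma net_size1_eval d (N : relu_net R d) : (net_size N <= 1)%N ->
  net_eval N 0 = 0 \/ forall x, net_eval N x = net_eval N 0.
Proof.
elim: N => [d' w b|d' k A b N IHN] /=.
  have [->|b0] := eqVneq b 0; first by left; rewrite mulmx0 mxE addr0.
  rewrite addn1 ltnS leqn0 => /eqP/nonzeros_eq0 -> ; right => x.
  by rewrite !mul0mx.
have [Ab|Ab] := eqVneq (nonzeros A + nonzeros b)%N 0%N; last first.
  move=> sz; left; apply: net_size0_eval.
  by move: Ab sz; case: (_ + _)%N => //= z _; rewrite addSn ltnS leqn0 addn_eq0 => /andP[_ /eqP].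
rewrite Ab add0n => /IHN; move/eqP: Ab; rewrite addn_eq0.
move=> /andP[/eqP/nonzeros_eq0 -> /eqP/nonzeros_eq0 ->].
have z0 : map_mx relu (0 : 'cV[R]_k) = 0.
  by apply/matrixP => i j; rewrite !mxE /relu maxxx.
rewrite mul0mx addr0 z0.
have -> : col_mx (0 : 'cV[R]_d') (0 : 'cV[R]_k) = 0 by rewrite col_mx0.
by case=> [->|Nc]; [left|right => x; rewrite mul0mx addr0 z0 Nc].
Qed.

End Networks.

(** * The network of a superposition *)

Section Superposition.
Variables (R : realType) (n q Lin Lout : nat).
Variables (Nin : 'I_n -> 'I_q -> relu_net R 1) (Nout : 'I_q -> relu_net R 1).
Hypothesis depth_in : forall i j, (net_depth (Nin i j) <= Lin.+1)%N.
Hypothesis depth_out : forall j, (net_depth (Nout j) <= Lout.+1)%N.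

(* The sum of the inner networks is read by one ReLU unit, whose weights are
   those of their output layers. *)
Lemma superposition_network : exists N : relu_net R n,
  [/\ net_depth N = (Lin.+1 + Lout.+1)%N,
      (net_size N <= \sum_i \sum_j net_size (Nin i j) + \sum_j net_size (Nout j))%N &
      forall x, net_eval N x = \sum_j net_eval (Nout j)
        (const_mx (relu (\sum_i net_eval (Nin i j) (const_mx (x i ord0)))))].
Proof.
have [e1 [T1 [F1 [w1 [b1 [S1 [T1_eval T1_depth T1_size S1_le F1_eval]]]]]]] :=
  @parallel_hidden_layers R ('I_n * 'I_q)%type Lin n (fun=> 1%N)
    (fun p (_ : 'I_1) => p.1) (fun p => Nin p.1 p.2) (fun p => depth_in p.1 p.2).
have [e2 [T2 [F2 [w2 [b2 [S2 [T2_eval T2_depth T2_size S2_le F2_eval]]]]]]] :=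
  @parallel_hidden_layers R 'I_q Lout (e1 + q)%N (fun=> 1%N)
    (fun j (_ : 'I_1) => rshift e1 j) Nout depth_out.
pose wsum j := \sum_i w1 (i, j).
pose A : 'M[R]_(q, e1) := \matrix_(j, c) wsum j ord0 c.
pose B : 'cV[R]_q := \col_j \sum_i b1 (i, j).
(* The summing layer takes the place of the inner output layers: [Lin] hidden layers, the sums,
   [Lout] hidden layers and one output layer. *)
exists (T1 (HiddenLayer A B (T2 (OutputLayer (\sum_j w2 j) (\sum_j b2 j))))).
split => [||x].
- by rewrite T1_depth /= T2_depth addn1 addnS addSn.
- rewrite T1_size /= T2_size /=.
  have nzA : (nonzeros A <= \sum_j \sum_i nonzeros (w1 (i, j)))%N.
    rewrite nonzerosE; apply: leq_sum => j _.
    apply: leq_trans (nonzeros_sum predT (fun i => w1 (i, j))).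
    rewrite nonzerosE big_ord1; apply: leq_sum => c _.
    by rewrite mxE.
  have nzB : (nonzeros B <= \sum_j \sum_i (b1 (i, j) != 0%R))%N.
    rewrite nonzerosE; apply: leq_sum => j _; rewrite big_ord1 mxE.
    exact: nonzero_sum_leq.
  have nzw2 := nonzeros_sum predT w2.
  have nzb2 := nonzero_sum_leq predT b2.
  move: S1_le S2_le; rewrite !big_split /=.
  have -> : (\sum_p nonzeros (w1 p) = \sum_j \sum_i nonzeros (w1 (i, j)))%N.
    by rewrite exchange_big pair_bigA; apply: eq_bigr => -[].
  have -> : (\sum_p (b1 p != 0%R) = \sum_j \sum_i (b1 (i, j) != 0%R))%N.
    by rewrite exchange_big pair_bigA; apply: eq_bigr => -[].
  have -> : (\sum_p net_size (Nin p.1 p.2) = \sum_i \sum_j net_size (Nin i j))%N.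
    by rewrite pair_bigA.
  move: nzA nzB nzw2 nzb2.
  set u1 := nonzeros A; set u2 := nonzeros B; set u3 := nonzeros _.
  set u4 := nat_of_bool _; clear.
  move: (\sum_j \sum_i nonzeros (w1 (i, j)))%N => v1.
  move: (\sum_j \sum_i (b1 (i, j) != 0%R))%N => v2.
  move: (\sum_i nonzeros (w2 i))%N (\sum_i (b2 i != 0%R))%N => v3 v4.
  move: (\sum_i \sum_j net_size (Nin i j))%N (\sum_j net_size (Nout j))%N => v5 v6.
  by move: u1 u2 u3 u4 => u1 u2 u3 u4; lia.
rewrite T1_eval /= T2_eval /= mulmx_suml summxE -big_split /=.
apply: eq_bigr => j _; rewrite F2_eval; congr net_eval.
apply/matrixP => i z; rewrite [z]ord1 [LHS]mxE col_mxEd [LHS]mxE [RHS]mxE.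
congr relu.
have -> : (A *m F1 x + B) j 0 =
    \sum_i (w1 (i, j) *m F1 x) ord0 ord0 + \sum_i b1 (i, j).
  rewrite mxE; congr (_ + _); last by rewrite mxE.
  rewrite -summxE -mulmx_suml mxE [RHS]mxE; apply: eq_bigr => c _.
  by rewrite mxE; congr (_ * F1 x c _); apply: val_inj.
rewrite -big_split; apply: eq_bigr => i1 _ /=.
rewrite (F1_eval x (i1, j)) /=; congr net_eval.
by apply/matrixP => a c; rewrite !mxE [c]ord1.
Qed.

End Superposition.

Section ApproximationConstants.
Variables (R : realType) (c0 c1 c2 : R).
Hypothesis hY : univariate_approx c0 c1 c2.

(* A network with a single weight cannot follow 1 + x. *)
Lemma univariate_constants_ge : 0 < c1 -> 0 < c2 -> 1 / 2 <= c1 * Num.min c2 1.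
Proof.
move=> c10 c20.
have cont : {within unit_interval, continuous (fun x : R => 1 + x)}.
  apply: continuous_subspaceT => x.
  by apply: cvgD; [exact: cvg_cst|exact: cvg_id].
(* Truncating the modulus at 1, the oscillation of the function on the interval, brings the minimum
   of [c2] and 1 into the error for W = 1. *)
have modulus : is_modulus (fun x : R => 1 + x) (fun t => Num.min t 1).
  split=> [s s0|s s' s0 ss'| | |x x'].
  - by rewrite le_min s0 ler01.
  - by rewrite le_min !ge_min ss' lexx orbT.
  - by rewrite min_l.
  - apply/cvgrPdist_le => e e0; near=> s.
    rewrite sub0r normrN ger0_norm ?le_min ?ler01 ?andbT; last by near: s; exact: nbhs_right_ge.
    by rewrite ge_min; apply/orP; left; near: s; exact: nbhs_right_le.
  - rewrite /unit_interval /= !in_itv /= => /andP[x0 x1] /andP[x'0 x'1].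
    rewrite opprD addrACA subrr add0r le_min lexx /=.
    by apply/ler_normlP; split; lra.
have [N [Nsize _ Nerr]] := hY cont modulus (lexx 1).
have size1 : (net_size N <= 1)%N by rewrite -(ler_nat R).
rewrite expr1n invr1 mulr1 in Nerr.
have err x : 0 <= x <= 1 -> `|1 + x - net_eval N (const_mx x)| <= c1 * Num.min c2 1.
  move=> x01; rewrite -lee_fin; apply: le_trans Nerr; apply: ereal_sup_ubound.
  by exists x => //; rewrite /unit_interval /= in_itv.
have c_0 : const_mx 0 = 0 :> 'cV[R]_1 by apply/matrixP => i j; rewrite !mxE.
have := err 0; have := err 1; rewrite c_0 !lexx ler01 => /(_ isT) + /(_ isT).
(* A network vanishing at 0 is off by 1 there; a constant one is off by at least 1/2 at one of the
   two end points. *)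
case: (net_size1_eval size1) => [->|->].
  by rewrite addr0 subr0 normr1; lra.
by rewrite addr0 => /ler_normlP[h1 h2] /ler_normlP[h3 h4]; lra.
Unshelve. all: by end_near. Qed.

End ApproximationConstants.

Lemma three_separated (R : realType) (a b c l w D : R) : D <= `|a - b| -> D <= `|b - c| ->
  D <= `|c - a| -> l < a < l + w -> l < b < l + w -> l < c < l + w -> 0 <= D ->
  2 * D < w.
Proof.
rewrite !ler_normr => /orP[?|?] /orP[?|?] /orP[?|?] /andP[? ?] /andP[? ?] /andP[? ?] ?; lra.
Qed.

Lemma active_window (R : realType) (z y P r : R) : z - r < y -> y < z + P + r ->
  y - P - r < z < y - P - r + (P + 2 * r).
Proof. by move=> ? ?; apply/andP; split; lra. Qed.

(** * Lipschitz bounds for the outer functions *)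

Section OuterLipschitz.
Variables (R : realType) (n m g k : nat).
Hypotheses (n2 : (2 <= n)%N) (g6 : (6 <= g)%N) (g_even : ~~ odd g).
Hypothesis k0 : (0 < k)%N.

Let gR : R := g%:R.
Let gR6 : 6 <= gR. Proof. by rewrite /gR ler_nat. Qed.
Let gR0 : 0 < gR. Proof. by apply: lt_le_trans gR6. Qed.
Let m10 : 0 < m%:R + 1 :> R. Proof. by rewrite natr1. Qed.
Let r := ramp R n g k.
Let r0 : 0 < r. Proof. exact: ramp_gt0. Qed.
Let P := plateau R n g k.
Let s (d : {ffun 'I_n -> 'I_(g ^ k)}) j := xi_val R n g k (grid_index d j).
Let th (d : {ffun 'I_n -> 'I_(g ^ k)}) j y :=
  theta g k (grid_point R d + const_mx (grid_shift R g j k)) y.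

(** The grid values of active bumps lie in an open interval of length [P + 2 * r], less than
    [(g + 1) * r], and are pairwise at least [(g - 2) * r] apart. Three of them would need
    [2 * (g - 2) < g + 1], impossible for g >= 6. *)
Lemma card_active_theta j y : (#|[pred d | th d j y != 0%R]| <= 2)%N.
Proof.
rewrite leqNgt; apply/negP => /card_gt2P[d1 [d2 [d3 [[]]]]].
rewrite !inE => t1 t2 t3 [d12 d23 d31].
have act d : th d j y != 0 -> y - P - r < s d j < y - P - r + (P + 2 * r).
  move=> td; have : ~~ ((y <= s d j - r) || (s d j + P + r <= y)).
    by apply: contra td => h; apply/eqP; exact: (theta_far_eq0 n2 g6 g_even k0 h).
  by rewrite negb_or -!ltNge => /andP[]; exact: active_window.
have sep d d' : d != d' -> (gR - 2) * r <= `|s d j - s d' j|.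
  rewrite eq_sym => dd'; have [i iN ii'] := grid_index_neq j dd'.
  apply: (@xi_val_separated R n g k _ _ (j * repunit g k.-1) n2 g6 g_even k0 _ _ i) => //.
  - exact: grid_index_window.
  - exact: grid_index_window.
have G2 : 0 <= (gR - 2) * r.
  by rewrite mulr_ge0 ?subr_ge0 ?(ltW r0) // (le_trans _ gR6) // ler_nat.
have := three_separated (sep _ _ d12) (sep _ _ d23) (sep _ _ d31)
  (act _ t1) (act _ t2) (act _ t3) G2.
have := plateau_le R n2 g6 k0; rewrite -/P -/r -/gR.
have : 6 * r <= gR * r by rewrite ler_pM2r.
have : 0 < gR^-1 / 2 * r by apply: mulr_gt0 => //; rewrite divr_gt0 // invr_gt0.
lra.
Qed.

(** Two bumps at most are active at each of the two points, so four enter the difference, each with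
    Lipschitz constant [2 / r]. *)
Lemma outer_layer_lipschitz (e : 'cV[R]_n -> R) j y z :
  (forall d : {ffun 'I_n -> 'I_(g ^ k)}, `|e (grid_point R d)| <= 1) ->
  `|outer_layer m g k e j y - outer_layer m g k e j z| <=
    (m%:R + 1)^-1 * (8 / r) * `|y - z|.
Proof.
move=> e1; rewrite /outer_layer -mulrBr -sumrB normrM gtr0_norm ?invr_gt0 //.
rewrite -mulrA ler_pM2l ?invr_gt0 //.
apply: le_trans (ler_norm_sum _ _ _) _.
pose act := [predU [pred d | th d j y != 0%R] & [pred d | th d j z != 0%R]].
apply: le_trans (_ : \sum_(d in act) 2 / r * `|y - z| <= _).
  rewrite [leRHS]big_mkcond; apply: ler_sum => d _ /=; rewrite -mulrBr normrM.
  have [_|] := boolP (d \in act).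
    rewrite -[leRHS]mul1r; apply: ler_pM => //; exact: theta_lipschitz.
  rewrite !inE negb_or !negbK => /andP[/eqP ty /eqP tz].
  by rewrite -/(th d j y) -/(th d j z) ty tz subrr normr0 mulr0.
rewrite sumr_const -[leLHS]mulr_natl.
have act4 : (#|act| <= 4)%N.
  have card_le (X Y : pred {ffun 'I_n -> 'I_(g ^ k)}) : (#|[predU X & Y]| <= #|X| + #|Y|)%N.
    by rewrite -cardUI leq_addr.
  apply: leq_trans (card_le _ _) _.
  exact: (leq_add (card_active_theta j y) (card_active_theta j z)).
have L0 : 0 <= 2 / r * `|y - z| by rewrite mulr_ge0 // divr_ge0 // ltW.
apply: le_trans (_ : 4%:R * (2 / r * `|y - z|) <= _).
  by rewrite ler_wpM2r // ler_nat.
have -> : 8 / r * `|y - z| = 4%:R * (2 / r * `|y - z|) by ring.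
by [].
Qed.

End OuterLipschitz.

Section XiRange.
Variables (R : realType) (n g : nat).
Hypotheses (n2 : (2 <= n)%N) (g6 : (6 <= g)%N) (g_even : ~~ odd g).

Let gR : R := g%:R.
Let gR6 : 6 <= gR. Proof. by rewrite /gR ler_nat. Qed.
Let gR0 : 0 < gR. Proof. by apply: lt_le_trans gR6. Qed.

(** Halved, these values lie in [0, 3/4]. The margin 1/4 up to the end of [0, 1] is left for the
    error of the inner networks. *)
Lemma xi_range (x : 'cV[R]_n) j : unit_cube x -> (j < g - 1)%N ->
  0 <= xi g (x + const_mx (j%:R * Defs.shift R g)) <= 3 / 2.
Proof.
move=> xc jg.
have g1 : 0 < gR - 1 by move: gR6; lra.
have a0 : 0 < Defs.shift R g by rewrite invr_gt0 mulr_gt0.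
have ja : 0 <= j%:R * Defs.shift R g <= gR^-1.
  rewrite mulr_ge0 ?(ltW a0) //= /Defs.shift invfM mulrCA -[leRHS]mulr1.
  rewrite ler_pM2l ?invr_gt0 // ler_pdivrMr // mul1r.
  by rewrite lerBrDr natr1 ler_nat; clear -jg; lia.
(* A shift is at most 1/g, and 1 + 1/g is a grid point of level 1, where psi is the identity. *)
have psi1 : psi n g (1 + gR^-1) = 1 + gR^-1.
  have := psi_cell R n2 g6 g_even 1 g.+1 (_ : (0 < g - 1)%N).
  rewrite !mul0r !addr0 expr1 -natr1 mulrDl divff ?gt_eqF // mul1r => ->; last by lia.
  rewrite /psi_val psiN1 ?(leq_trans _ g6) // beta1 expr1 -natr1 mulrDl divff ?gt_eqF //.
  by rewrite mul1r.
have psi_b (i : 'I_n) : 0 <= psi n g (x i ord0 + j%:R * Defs.shift R g) <= 1 + gR^-1.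
  have /andP[x0 x1] := xc i; have /andP[j0 j1] := ja.
  have xj0 : 0 <= x i ord0 + j%:R * Defs.shift R g by rewrite addr_ge0.
  apply/andP; split.
    have /andP[+ _] := psi_bounds n2 g6 g_even 0 xj0; apply: le_trans.
    by rewrite /psi_val divr_ge0 // exprn_ge0.
  by rewrite -psi1; apply: psi_le => //; apply: lerD.
apply/andP; split.
  apply: sumr_ge0 => i _; rewrite !mxE; have /andP[p0 _] := psi_b i.
  by rewrite mulr_ge0 // ltW // lambda_gt0.
apply: le_trans (_ : \sum_(i < n) lambda R g i * (1 + gR^-1) <= _).
  apply: ler_sum => i _; rewrite !mxE ler_pM2l ?lambda_gt0 //.
  by have /andP[] := psi_b i.
rewrite -mulr_suml.
have L := sum_lambda_le_const R n2 g6.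
have y6 : gR^-1 <= 6^-1 by rewrite lef_pV2 ?posrE.
have y0 : 0 < gR^-1 by rewrite invr_gt0.
apply: le_trans (_ : 5 / 4 * (1 + 6^-1) <= _); last by lra.
apply: ler_pM => //; [|lra|lra].
by apply: le_trans (sum_lambda_ge1 R n2 g6).
Qed.

End XiRange.

Section Modulus.
Variable R : realType.

Lemma is_modulus_continuous (f omega : R -> R) :
  is_modulus f omega -> {within unit_interval, continuous f}.
Proof.
case=> w0 wmono w00 wlim wf; apply/subspace_continuousP => x Ax.
apply/cvgrPdist_le => e e0.
have [d d0 dw] : exists2 d : R, 0 < d & forall t, 0 < t -> t < d -> omega t <= e.
  move/cvgrPdist_le : wlim => /(_ e e0) [d /= d0 dH]; exists d => // t t0 td.
  have := dH t; rewrite /ball_ /= sub0r normrN gtr0_norm // => /(_ td t0).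
  by rewrite sub0r normrN ger0_norm // w0 // ltW.
rewrite near_withinE; near=> y => Ay.
apply: le_trans (wf _ _ Ax Ay) _.
have [->|xy] := eqVneq x y; first by rewrite subrr normr0 w00 ltW.
apply: dw; first by rewrite normr_gt0 subr_eq0.
near: y; have /cvgrPdist_lt := @cvg_id R (nbhs x); exact.
Unshelve. all: by end_near. Qed.

Lemma is_modulus_holder (f : R -> R) (c a : R) : 0 <= c -> 0 < a ->
  (forall x y, unit_interval x -> unit_interval y -> `|f x - f y| <= c * `|x - y| `^ a) ->
  is_modulus f (fun t => c * t `^ a).
Proof.
move=> c0 a0 fc; split => //.
- by move=> t _; rewrite mulr_ge0 // powR_ge0.
- move=> s t s0 st; apply: ler_wpM2l => //; apply: ge0_ler_powR; rewrite ?nnegrE //.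
  + exact: ltW.
  + exact: le_trans st.
- by rewrite powR0 ?mulr0 // gt_eqF.
- rewrite -[X in _ --> X](mulr0 c); apply: cvgM; first exact: cvg_cst.
  exact: powR_cvg0.
Qed.

End Modulus.

(** * Depth, size and error of the network *)

Section NetworkOfSuperposition.
Variables (R : realType) (n m g : nat).
Hypotheses (n2 : (2 <= n)%N) (g6 : (6 <= g)%N) (g_even : ~~ odd g).
Hypothesis gm : g = m.+2.
Variables (c0 c1 c2 : R).
Hypotheses (c1_gt0 : 0 < c1) (c2_gt0 : 0 < c2).
Hypothesis hY : univariate_approx c0 c1 c2.

Let gR : R := g%:R.
Let gR6 : 6 <= gR. Proof. by rewrite /gR ler_nat. Qed.
Let gR0 : 0 < gR. Proof. by apply: lt_le_trans gR6. Qed.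
Let m10 : 0 < m%:R + 1 :> R. Proof. by rewrite natr1. Qed.

Lemma approx_pointwise (f omega : R -> R) W : is_modulus f omega -> 1 <= W ->
  exists N : relu_net R 1, [/\ (net_size N)%:R <= W, (net_depth N)%:R <= c0 * W &
    forall x, 0 <= x <= 1 -> `|f x - net_eval N (const_mx x)| <= c1 * omega (c2 * W ^- 2)].
Proof.
move=> fo W1; have [N [Ns Nd Ne]] := hY (is_modulus_continuous fo) fo W1.
exists N; split => // x x01; rewrite -lee_fin; apply: le_trans Ne.
by apply: ereal_sup_ubound; exists x => //; rewrite /unit_interval /= in_itv.
Qed.

Definition outer_lip : R := (m%:R + 1)^-1 * (8 / ramp R n g 1).

Definition inner_err (W : R) : R := c1 * (2 * (c2 * W ^- 2) `^ holder_exp R g).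

Lemma outer_lip_ge0 : 0 <= outer_lip.
Proof.
by rewrite mulr_ge0 ?invr_ge0 ?(ltW m10) // divr_ge0 // ltW // ramp_gt0.
Qed.

(** The halving turns the Hoelder constant 4 of psi into 2. The factor lambda stays in the bound so
    that the errors can be summed over [i]. *)
Lemma inner_network (i : 'I_n) (j : 'I_m.+1) W : 1 <= W ->
  exists N : relu_net R 1, [/\ (net_size N)%:R <= W, (net_depth N)%:R <= c0 * W &
    forall x, 0 <= x <= 1 ->
      `|lambda R g i * psi n g (x + j%:R * Defs.shift R g) / 2
        - net_eval N (const_mx x)| <= lambda R g i * inner_err W].
Proof.
move=> W1; have l0 := lambda_gt0 R n2 g6 i.
have a0 : 0 <= j%:R * Defs.shift R g.
  by rewrite mulr_ge0 // invr_ge0 mulr_ge0 ?(ltW gR0) //; move: gR6; lra.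
pose F (x : R) := lambda R g i * psi n g (x + j%:R * Defs.shift R g) / 2.
have modF : is_modulus F (fun t => lambda R g i * 2 * t `^ holder_exp R g).
  apply: is_modulus_holder; [by rewrite mulr_ge0 // ltW|exact: holder_exp_gt0|].
  move=> x y; rewrite /unit_interval /= !in_itv /= => /andP[x0 x1] /andP[y0 y1].
  have xy1 : `|x - y| <= 1 by apply/ler_normlP; split; lra.
  have -> : F x - F y = lambda R g i / 2 *
      (psi n g (x + j%:R * Defs.shift R g) - psi n g (y + j%:R * Defs.shift R g)).
    by rewrite /F; ring.
  have xyE : (x + j%:R * Defs.shift R g) - (y + j%:R * Defs.shift R g) = x - y by ring.
  have := psi_holder n2 g6 g_even (addr_ge0 x0 a0) (addr_ge0 y0 a0).
  rewrite xyE => /(_ xy1) psi_xy.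
  rewrite normrM gtr0_norm ?divr_gt0 //.
  have -> : lambda R g i * 2 * `|x - y| `^ holder_exp R g =
    lambda R g i / 2 * (4 * `|x - y| `^ holder_exp R g) by field.
  by rewrite ler_pM2l ?divr_gt0.
have [N [Ns Nd Ne]] := approx_pointwise modF W1.
exists N; split => // x /Ne; rewrite /F => /le_trans; apply.
by rewrite /inner_err le_eqVlt; apply/orP; left; apply/eqP; ring.
Qed.

Lemma outer_network (f : 'cV[R]_n -> R) (j : 'I_m.+1) W :
  (forall d : {ffun 'I_n -> 'I_(g ^ 1)}, `|f (grid_point R d)| <= 1) -> 1 <= W ->
  exists N : relu_net R 1, [/\ (net_size N)%:R <= W, (net_depth N)%:R <= c0 * W &
    forall y, 0 <= y <= 1 ->
      `|outer_layer m g 1 f j (2 * y) - net_eval N (const_mx y)| <=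
        c1 * (2 * outer_lip * (c2 * W ^- 2))].
Proof.
move=> f1 W1.
pose F (y : R) := outer_layer m g 1 f j (2 * y).
have modF : is_modulus F (fun t => 2 * outer_lip * t `^ 1).
  apply: is_modulus_holder => //; first by rewrite mulr_ge0 // outer_lip_ge0.
  move=> x y _ _; rewrite powRr1 //.
  have := outer_layer_lipschitz m n2 g6 g_even (isT : (0 < 1)%N) j (2 * x) (2 * y) f1.
  have -> : `|2 * x - 2 * y| = 2 * `|x - y| by rewrite -mulrBr normrM gtr0_norm.
  move=> /le_trans; apply.
  by rewrite le_eqVlt; apply/orP; left; apply/eqP; rewrite /outer_lip; ring.
have [N [Ns Nd Ne]] := approx_pointwise modF W1.
exists N; split => // y /Ne; rewrite powRr1 //.
by rewrite mulr_ge0 ?(ltW c2_gt0) // invr_ge0 exprn_ge0 // (le_trans _ W1).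
Qed.

(** The sums are approximations of nonnegative numbers, so passing them through a ReLU unit cannot
    increase the error. *)
Lemma relu_dist (x y : R) : 0 <= y -> `|relu x - y| <= `|x - y|.
Proof.
move=> y0; have N1 := ler_norm (x - y); have N2 := ler_norm (y - x).
rewrite [`|y - x|]distrC in N2; move: N1 N2; set N := `|x - y| => N1 N2.
by apply/ler_normlP; rewrite /relu /Num.max; case: (ltP x 0) => ?; split; lra.
Qed.

(** The factor 5 / 4 bounds the sum of the lambda_i. The inner error is amplified by the Lipschitz
    constant of an outer function, doubled since the outer networks undo the halving; the error of
    the outer networks is added. *)
Lemma network_of_layer1 (f : 'cV[R]_n -> R) Win Wout :
  (forall x, unit_cube x -> `|f x| <= 1) ->
  (forall x, unit_cube x -> f x = layer m g 1 f x) ->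
  1 <= Win -> 1 <= Wout -> 5 / 4 * inner_err Win <= 1 / 4 ->
  exists N : relu_net R n,
    [/\ (net_depth N)%:R <= c0 * Win + c0 * Wout,
        (net_size N)%:R <= n%:R * (m%:R + 1) * Win + (m%:R + 1) * Wout &
        forall x, unit_cube x -> `|f x - net_eval N x| <=
          (m%:R + 1) * (2 * outer_lip * (5 / 4 * inner_err Win)
                        + c1 * (2 * outer_lip * (c2 * Wout ^- 2)))].
Proof.
move=> f1 f_rep Win1 Wout1 err_small.
have f1' (d : {ffun 'I_n -> 'I_(g ^ 1)}) : `|f (grid_point R d)| <= 1.
  by apply: f1; exact: grid_point_cube.
pose Nin i j := projT1 (cid (@inner_network i j Win Win1)).
have NinP i j := projT2 (cid (@inner_network i j Win Win1)).
pose Nout j := projT1 (cid (outer_network j f1' Wout1)).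
have NoutP j := projT2 (cid (outer_network j f1' Wout1)).
have depth_gt0 p (N : relu_net R p) : (0 < net_depth N)%N by case: N.
have i0 : 'I_n := Ordinal (ltnW n2).
(* The integer part is positive because a network of depth at most [c0 * Win] exists and every
   network has depth at least 1. *)
have DinS : (Num.truncn (c0 * Win)).-1.+1 = Num.truncn (c0 * Win).
  rewrite prednK //; have [_ d _] := NinP i0 ord0.
  by apply: leq_trans (depth_gt0 _ (Nin i0 ord0)) _; rewrite truncn_ge_nat ?(le_trans _ d).
have DoutS : (Num.truncn (c0 * Wout)).-1.+1 = Num.truncn (c0 * Wout).
  rewrite prednK //; have [_ d _] := NoutP ord0.
  by apply: leq_trans (depth_gt0 _ (Nout ord0)) _; rewrite truncn_ge_nat ?(le_trans _ d).
have c0Win : 0 <= c0 * Win by have [_ d _] := NinP i0 ord0; apply: le_trans d.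
have c0Wout : 0 <= c0 * Wout by have [_ d _] := NoutP ord0; apply: le_trans d.
have [||N [Nd Ns Ne]] := @superposition_network R n m.+1
  (Num.truncn (c0 * Win)).-1 (Num.truncn (c0 * Wout)).-1 Nin Nout _ _.
  by move=> i j; rewrite DinS truncn_ge_nat //; have [] := NinP i j.
  by move=> j; rewrite DoutS truncn_ge_nat //; have [] := NoutP j.
exists N; split.
- by rewrite Nd DinS DoutS natrD; apply: lerD; rewrite truncn_le.
- apply: le_trans (_ : (\sum_i \sum_j net_size (Nin i j) + \sum_j net_size (Nout j))%:R <= _).
    by rewrite ler_nat.
  rewrite natrD; apply: lerD.
    rewrite natr_sum; apply: le_trans (_ : \sum_(i < n) (m%:R + 1) * Win <= _).
      apply: ler_sum => i _; rewrite natr_sum.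
      apply: le_trans (_ : \sum_(j < m.+1) Win <= _).
        by apply: ler_sum => j _; have [] := NinP i j.
      by rewrite sumr_const card_ord -[leLHS]mulr_natl natr1.
    by rewrite sumr_const card_ord -[leLHS]mulr_natl mulrA.
  rewrite natr_sum; apply: le_trans (_ : \sum_(j < m.+1) Wout <= _).
    by apply: ler_sum => j _; have [] := NoutP j.
  by rewrite sumr_const card_ord -[leLHS]mulr_natl natr1.
move=> x xc; rewrite f_rep // Ne /layer /superpose -sumrB.
apply: le_trans (ler_norm_sum _ _ _) _.
set err := 2 * outer_lip * _ + _.
apply: le_trans (_ : \sum_(j < m.+1) err <= _); last first.
  by rewrite sumr_const card_ord -[leLHS]mulr_natl natr1.
apply: ler_sum => j _.
set z := xi g (x + const_mx (j%:R * Defs.shift R g)).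
have jg : (j < g - 1)%N by rewrite gm; have := ltn_ord j; clear; lia.
have /andP[z0 z1] := xi_range n2 g6 g_even xc jg; rewrite -/z in z0 z1.
set y := \sum_i net_eval (Nin i j) _.
have inner0 : 0 <= inner_err Win.
  by rewrite mulr_ge0 ?(ltW c1_gt0) // mulr_ge0 // powR_ge0.
have y_err : `|y - z / 2| <= 5 / 4 * inner_err Win.
  have -> : y - z / 2 = - \sum_(i < n) (lambda R g i *
      psi n g (x i ord0 + j%:R * Defs.shift R g) / 2
      - net_eval (Nin i j) (const_mx (x i ord0))).
    rewrite sumrB opprB /z /xi mulr_suml; congr (_ - _).
    by apply: eq_bigr => i _; rewrite !mxE.
  rewrite normrN; apply: le_trans (ler_norm_sum _ _ _) _.
  apply: le_trans (_ : \sum_(i < n) lambda R g i * inner_err Win <= _).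
    by apply: ler_sum => i _; have [_ _] := NinP i j; apply; exact: xc.
  by rewrite -mulr_suml ler_wpM2r // sum_lambda_le_const.
have ry_err := le_trans (relu_dist y (divr_ge0 z0 (ler0n R 2))) y_err.
(* 3/4 plus the error 1/4: the outer networks are evaluated only where their error is controlled. *)
have ry : 0 <= relu y <= 1.
  have ry0 : 0 <= relu y by rewrite /relu le_max lexx orbT.
  rewrite ry0 /=; move: ry_err => /ler_normlP[_]; lra.
have [_ _ /(_ _ ry)] := NoutP j; rewrite -/(Nout j) => out_err.
have lip := outer_layer_lipschitz m n2 g6 g_even (isT : (0 < 1)%N) j z (2 * relu y) f1'.
rewrite -/outer_lip in lip.
have zE : `|z - 2 * relu y| = 2 * `|relu y - z / 2|.
  have -> : z - 2 * relu y = - (2 * (relu y - z / 2)) by field.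
  by rewrite normrN normrM gtr0_norm.
rewrite zE in lip.
have lip2 : outer_lip * (2 * `|relu y - z / 2|) <= outer_lip * (2 * (5 / 4 * inner_err Win)).
  by rewrite ler_wpM2l ?outer_lip_ge0 // ler_pM2l.
have := ler_normD (outer_layer m g 1 f j z - outer_layer m g 1 f j (2 * relu y))
  (outer_layer m g 1 f j (2 * relu y) - net_eval (Nout j) (const_mx (relu y))).
rewrite addrA subrK => /le_trans; apply.
by move: out_err lip lip2; rewrite /err; lra.
Qed.

End NetworkOfSuperposition.

(** * The constants of the error bound *)

Section Constants.
Variables (R : realType) (n : nat).
Hypothesis n2 : (2 <= n)%N.

Let N : R := n%:R.
Let N2 : 2 <= N. Proof. by rewrite /N ler_nat. Qed.
Let N0 : 0 < N. Proof. by apply: lt_le_trans N2. Qed.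

Lemma hexp_ge1 : 1 <= hexp R n.
Proof.
have l2 : 0 < ln 2 :> R by rewrite ln_gt0 // ltr1n.
rewrite /hexp /log2 ler_pdivlMr // mul1r -lerBlDl ler_pdivlMr //.
have -> : 2 - 1 = 1 :> R by ring.
rewrite mul1r ler_ln ?posrE //; move: N2; rewrite -/N; lra.
Qed.

(** Since ln (2 n + 2) = ln 2 + ln (n + 1), the Hoelder exponent is 1 / (1 + log2 (n + 1)). A budget
    proportional to the power [- hexp R n] of epsilon thus gives an inner error linear in
    epsilon. *)
Lemma holder_expE : holder_exp R (2 * n + 2) = (2 * hexp R n)^-1.
Proof.
have l2 : 0 < ln 2 :> R by rewrite ln_gt0 // ltr1n.
have lg : 0 < ln (2 * n + 2)%:R :> R by rewrite ln_gt0 // ltr1n addn2.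
have N1 : 0 < N + 1 by move: N2; lra.
have gE : ln (2 * n + 2)%:R = ln 2 + ln (N + 1) :> R.
  by rewrite -lnM ?posrE // mulrDr mulr1 natrD natrM.
rewrite gE in lg; rewrite /hexp /log2 /holder_exp gE -/N; field.
by rewrite !gt_eqF.
Qed.

(** [(2 n + 2) ^ (n + 1)] is the inverse of the flank of level 1, the scale of the outer Lipschitz
    constant. The exponent 2 n^C is at least 2 n, hence at least n + 2, and the spare factor 2 n + 2
    is at least 6. *)
Lemma growth_ge C : 1 <= C -> 6 * (2 * n + 2)%:R ^+ n.+1 <= growth n C :> R.
Proof.
move=> C1; have gE : (2 * n + 2)%:R = 2 * N + 2 :> R by rewrite natrD natrM.
have NC : N <= N `^ C.
  by rewrite -[leLHS]powRr1 ?(ltW N0) // ler_powR //; move: N2; lra.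
apply: le_trans (_ : (2 * N + 2) `^ (2 * n)%:R <= _); last first.
  apply: ler_powR; first by move: N2; lra.
  by rewrite natrM ler_pM2l.
rewrite powR_mulrn; last by move: N2; lra.
rewrite gE; apply: le_trans (_ : (2 * N + 2) ^+ n.+2 <= _).
  by rewrite [leRHS]exprS ler_wpM2r ?exprn_ge0 //; move: N2; lra.
by rewrite ler_weXn2l //; [move: N2; lra|clear -n2; lia].
Qed.

Variables (c1 c2 C eps : R) (r : int).
Hypotheses (c1_gt0 : 0 < c1) (c2_gt0 : 0 < c2) (C_ge1 : 1 <= C).
Hypothesis c12 : 1 / 2 <= c1 * Num.min c2 1.
Hypotheses (eps0 : 0 < eps) (eps1 : eps < 1) (r1 : 1 <= r).

Let rr : R := r%:~R.
Let rr1 : 1 <= rr. Proof. by rewrite ler1z. Qed.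
Let G : R := growth n C.
Let P : R := (2 * n + 2)%:R ^+ n.+1.
Let P0 : 0 < P. Proof. by rewrite exprn_gt0 // ltr0n addn2. Qed.
Let P1 : 1 <= P. Proof. by rewrite exprn_ege1 // ler1n addn2. Qed.
Let GP : 6 * P <= G. Proof. exact: growth_ge. Qed.
Let X : R := (4 * N + 2) / N * rr * G.
Let Y : R := (2 * N + 5) * c1.

Let rG : 6 * P <= rr * G.
Proof.
by apply: le_trans GP _; rewrite ler_peMl //; apply: le_trans GP; rewrite mulr_ge0 // ltW.
Qed.

Let X_ge : 24 * P <= X.
Proof.
rewrite /X -mulrA (_ : 24 = 4 * 6); last by ring.
rewrite -mulrA; apply: ler_pM => //; first by rewrite mulr_ge0 // ltW.
by rewrite ler_pdivlMr //; lra.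
Qed.

Let X0 : 0 < X. Proof. by apply: lt_le_trans X_ge; rewrite mulr_gt0. Qed.
Let Y0 : 0 < Y. Proof. by rewrite mulr_gt0 //; move: N2; lra. Qed.

Let win : R := tconst3 c1 c2 C n r * eps `^ (- hexp R n).
Let wout : R := tconst4 c1 c2 C n r * eps `^ (- (1 / 2)).

Let winE : win = (X * Y / eps) `^ hexp R n * c2 `^ (1 / 2).
Proof.
have X0' := ltW X0; have Y0' := ltW Y0; have XY0 : 0 <= X * Y := mulr_ge0 X0' Y0'.
have e0 : 0 <= eps^-1 by rewrite invr_ge0 ltW.
rewrite (powRM _ XY0 e0) (powRM _ X0' Y0') -(powR_inv1 (ltW eps0)) -powRrM mulN1r.
by rewrite /win /tconst3 /const3 -/Y; ring.
Qed.

Lemma win_ge1 : 1 <= win.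
Proof.
have c1_2 : 1 / 2 <= c1.
  by apply: le_trans c12 _; rewrite ler_piMr ?(ltW c1_gt0) // ge_min lexx orbT.
have Y1 : 9 * c1 <= Y by rewrite /Y ler_pM2r //; move: N2; lra.
have XY : 24 * Y <= X * Y.
  by rewrite ler_pM2r //; apply: le_trans X_ge; move: P1; lra.
have XYe : 24 * Y <= X * Y / eps.
  apply: le_trans XY _; rewrite ler_pdivlMr // ler_piMr ?(ltW eps1) //.
  by rewrite ltW // mulr_gt0.
have H : 24 * Y <= (X * Y / eps) `^ hexp R n.
  by apply: (le_trans XYe); apply: (le1r_powR _ hexp_ge1); lra.
have c2r : Num.min c2 1 <= c2 `^ (1 / 2).
  have [c2le|c2ge] := leP c2 1.
    apply: le_trans (_ : c2 `^ 1 <= _); first by rewrite powRr1 ?(ltW c2_gt0).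
    by rewrite ger_powR ?c2_gt0 //; lra.
  by apply: le_trans (_ : c2 `^ 0 <= _); [rewrite powRr0|rewrite ler_powR ?(ltW c2ge) //; lra].
have mn0 : 0 <= Num.min c2 1 by rewrite le_min (ltW c2_gt0) ler01.
rewrite winE; apply: le_trans (_ : 24 * Y * Num.min c2 1 <= _).
  apply: le_trans (_ : 24 * 9 * (c1 * Num.min c2 1) <= _); first by move: c12; lra.
  by rewrite mulrA ler_wpM2r //; move: Y1; lra.
by apply: ler_pM => //; move: Y0; lra.
Qed.

Lemma inner_err_win :
  inner_err (2 * n + 2) c1 c2 win = 2 * eps / (X * (2 * N + 5)).
Proof.
have h0 : 0 < hexp R n by apply: lt_le_trans hexp_ge1.
have Z0 : 0 < X * Y / eps by rewrite divr_gt0 // mulr_gt0.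
have Zh0 := powR_gt0 (hexp R n) Z0; have ch0 := powR_gt0 (1 / 2) c2_gt0.
rewrite /inner_err.
have -> : c2 * win ^- 2 = (X * Y / eps) `^ (- (2 * hexp R n)).
  rewrite powRN [2 * hexp R n]mulrC powRrM powR_mulrn ?(ltW Zh0) // winE exprMn.
  rewrite -[c2 `^ _ ^+ 2]powR_mulrn ?(ltW ch0) // -powRrM mul1r mulVf // powRr1 ?(ltW c2_gt0) //.
  by rewrite invfM mulrCA divff ?mulr1 // gt_eqF.
rewrite holder_expE -powRrM mulNr divff; last by rewrite gt_eqF // mulr_gt0.
rewrite powR_inv1 ?(ltW Z0) // /Y.
field; rewrite !gt_eqF //=; move: N2; lra.
Qed.

Let woutE : wout ^+ 2 = (8 * N + 4) * (c1 * c2 / N * rr * G) / eps.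
Proof.
have sq (x : R) : 0 <= x -> x `^ (1 / 2) ^+ 2 = x.
  by move=> x0; rewrite -powR_mulrn ?powR_ge0 // -powRrM mul1r mulVf // powRr1.
have G0 : 0 < G by apply: lt_le_trans GP; rewrite mulr_gt0.
rewrite /wout /tconst4 /const4 powRN !exprMn exprVn !sq //.
- exact: ltW.
- rewrite !mulr_ge0 ?invr_ge0 ?(ltW c1_gt0) ?(ltW c2_gt0) ?(ltW N0) ?(ltW G0) //.
  exact: le_trans rr1.
Qed.

Let wout_gt0 : 0 < wout.
Proof.
have G0 : 0 < G by apply: lt_le_trans GP; rewrite mulr_gt0.
have rr0 : 0 < rr by apply: lt_le_trans rr1.
apply: mulr_gt0; last exact: powR_gt0.
apply: mulr_gt0; apply: powR_gt0; first by rewrite -/N; move: N2; lra.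
by rewrite !mulr_gt0 ?invr_gt0.
Qed.

Lemma wout_ge1 : 1 <= wout.
Proof.
rewrite -(@ler_sqr _ 1 wout) ?nnegrE ?(ltW wout_gt0) // expr1n woutE.
rewrite ler_pdivlMr // mul1r.
have c12' : 1 / 2 <= c1 * c2.
  by apply: le_trans c12 _; rewrite ler_pM2l // ge_min lexx.
have NN : 8 <= (8 * N + 4) / N by rewrite ler_pdivlMr //; lra.
apply: le_trans (_ : 8 * ((1 / 2) * (6 * P)) <= _); first by move: P1 eps1; lra.
rewrite (_ : _ * (_ * _) = (8 * N + 4) / N * (c1 * c2 * (rr * G))); last by ring.
have P00 := ltW P0.
by apply: ler_pM => //; [rewrite !mulr_ge0|apply: ler_pM => //; rewrite mulr_ge0].
Qed.

Lemma inner_err_small : 5 / 4 * inner_err (2 * n + 2) c1 c2 win <= 1 / 4.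
Proof.
rewrite inner_err_win mulrA ler_pdivrMr; last by rewrite mulr_gt0 //; move: N2; lra.
have : 24 * 9 <= X * (2 * N + 5).
  by apply: ler_pM => //; [apply: le_trans X_ge; move: P1|move: N2]; lra.
by move: eps1; lra.
Qed.

(** After substitution epsilon factors out, multiplied by two constants, at most 10/9 for the inner
    and 2 for the outer networks, and by [P / (rr * G)], at most 1/6. *)
Lemma total_error_le (L : R) : L * (2 * N + 1) = 8 * P ->
  (2 * N + 1) * (2 * L * (5 / 4 * inner_err (2 * n + 2) c1 c2 win)
                 + c1 * (2 * L * (c2 * wout ^- 2))) <= eps.
Proof.
move=> LE; rewrite inner_err_win woutE.
have rG0 : 0 < rr * G by apply: lt_le_trans rG; rewrite mulr_gt0.
rewrite [leLHS](_ : _ = (40 * (N / (4 * N + 2)) / (2 * N + 5) + 16 * (N / (8 * N + 4)))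
    * (P / (rr * G)) * eps); last first.
  rewrite mulrDr.
  rewrite (_ : (2 * N + 1) * (2 * L * (5 / 4 * _)) =
    2 * (L * (2 * N + 1)) * (5 / 4) * (2 * eps / (X * (2 * N + 5)))); last by ring.
  rewrite (_ : (2 * N + 1) * (c1 * (2 * L * _)) =
    2 * (L * (2 * N + 1)) * c1 * (c2 / ((8 * N + 4) * (c1 * c2 / N * rr * G) / eps))); last by ring.
  rewrite LE /X -[_ * rr * G]mulrA -[c1 * c2 / N * rr * G]mulrA.
  move: rG0; set Q := rr * G => Q0; clear LE.
  field; rewrite !gt_eqF //=; move: N2; lra.
rewrite -[leRHS]mul1r ler_pM2r //.
have a1 : N / (4 * N + 2) <= 1 / 4 by rewrite ler_pdivrMr; move: N2; lra.
have a2 : N / (8 * N + 4) <= 1 / 8 by rewrite ler_pdivrMr; move: N2; lra.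
have a0 : 0 <= N / (4 * N + 2) by rewrite divr_ge0; move: N2; lra.
have a3 : (2 * N + 5)^-1 <= 9^-1 by rewrite lef_pV2 ?posrE; move: N2; lra.
have a30 : 0 <= (2 * N + 5)^-1 by rewrite invr_ge0; move: N2; lra.
have b : P / (rr * G) <= 1 / 6 by rewrite ler_pdivrMr //; move: rG; lra.
have b0 : 0 <= P / (rr * G) by rewrite divr_ge0 ?(ltW P0) // ltW.
have u : 40 * (N / (4 * N + 2)) / (2 * N + 5) <= 10 * 9^-1.
  by apply: ler_pM => //; [rewrite mulr_ge0|lra].
have u0 : 0 <= 16 * (N / (8 * N + 4)) by rewrite mulr_ge0 // divr_ge0; move: N2; lra.
have u1 : 0 <= 40 * (N / (4 * N + 2)) / (2 * N + 5) by rewrite mulr_ge0 // mulr_ge0.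
apply: le_trans (_ : (10 * 9^-1 + 2) * (1 / 6) <= _); last by lra.
by apply: ler_pM => //; [rewrite addr_ge0|lra].
Qed.

End Constants.

Lemma supnorm_leP (R : realType) (T : Type) (D : set T) (f : T -> R) (c : R) :
  (supnorm D f <= c%:E)%E <-> forall x, D x -> `|f x| <= c.
Proof.
split=> [fc x Dx|fc].
  by rewrite -lee_fin; apply: le_trans fc; apply: ereal_sup_ubound; exists x.
by apply: ge_ereal_sup => _ [x Dx <-]; rewrite lee_fin fc.
Qed.

Unset Implicit Arguments.

Theorem theorem4p1 (R : realType) (n m gam : nat)
    (hn : (2 <= n)%N) (hm : m = (2 * n)%N) (hgam : gam = (2 * n + 2)%N)
    (delta eta : R)
    (hdelta0 : 0 < delta)
    (hdelta1 : delta < 1 - n%:R / (m%:R - n%:R + 1))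
    (heta0 : (m%:R - n%:R + 1) / (m%:R + 1) * delta + 2 * n%:R / (m%:R + 1)
             <= eta)
    (heta1 : eta < 1)
    (C : R) (hC : 0 < C)
    (c0 c1 c2 : R) (hc0 : 0 < c0) (hc1 : 0 < c1) (hc2 : 0 < c2)
    (hY : univariate_approx c0 c1 c2)
    (f : 'cV[R]_n -> R)
    (hf : KC m gam delta C f)
    (hf1 : (supnorm unit_cube f <= 1%:E)%E)
    (eps : R) (heps0 : 0 < eps) (heps1 : eps < 1) :
  exists N : relu_net R n,
    [/\ (net_depth N)%:R
          <= c0 * tconst3 c1 c2 C n (rsteps eta eps) * eps `^ (- hexp R n)
             + c0 * tconst4 c1 c2 C n (rsteps eta eps) * eps `^ (- (1 / 2)),
        (net_size N)%:R
          <= n%:R * (2 * n%:R + 1) * tconst3 c1 c2 C n (rsteps eta eps)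
               * eps `^ (- hexp R n)
             + (2 * n%:R + 1) * tconst4 c1 c2 C n (rsteps eta eps)
               * eps `^ (- (1 / 2)) &
        (supnorm unit_cube (fun x => (f x - net_eval N x)%R)
         <= eps%:E)%E].
Proof.
have N2 : 2 <= n%:R :> R by rewrite ler_nat.
have mE : m%:R = 2 * n%:R :> R by rewrite hm natrM.
have g6 : (6 <= gam)%N by rewrite hgam; clear -hn; lia.
have g_even : ~~ odd gam by rewrite hgam oddD oddM.
have gm : gam = m.+2 by rewrite hgam hm addn2.
(* For m = 2n the bound on delta is 1 / (n + 1), which yields both inequalities needed for the exact
   representation. *)
have deltaN : delta * (n%:R + 1) < 1.
  rewrite -ltr_pdivlMr; last by move: N2; lra.
  apply: lt_le_trans hdelta1 _; rewrite mE le_eqVlt; apply/orP; left; apply/eqP.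
  by field; rewrite !gt_eqF //; move: N2; lra.
have delta2 : 2 * delta < 1 by move: deltaN N2 hdelta0; clear; nra.
have delta_m : delta * (m%:R + 1) < 2 by rewrite mE; move: deltaN hdelta0; lra.
have eta0 : 0 < eta.
  apply: lt_le_trans heta0; rewrite mE addrC ltr_wpDr //.
    by rewrite mulr_ge0 ?(ltW hdelta0) // divr_ge0; move: N2; lra.
  by rewrite divr_gt0; move: N2; lra.
have r1 : 1 <= rsteps eta eps.
  rewrite -gtz0_ge1 ceil_gt0 divr_gt0 // ln_gt0 ?invf_gt1 //.
  by rewrite ltr_pdivlMr //; move: heps1; lra.
have f1 := (supnorm_leP unit_cube f 1).1 hf1.
case: hf => _ [ks [adm ksC]].
have C1 : 1 <= C by apply: le_trans (ksC 0%N); rewrite ler1n; have [] := adm 0%N.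
have bnd : exists K, forall r, (ks r <= K)%N.
  by exists (Num.truncn C) => r; rewrite truncn_ge_nat // ltW.
have f_rep := layer1_exact hn g6 g_even gm hdelta0 delta2 delta_m adm f1 bnd.
have c12 := univariate_constants_ge hY hc1 hc2.
have Win1 := win_ge1 hn hc1 hc2 C1 c12 heps0 heps1 r1.
have Wout1 := wout_ge1 hn hc1 hc2 C1 c12 heps0 heps1 r1.
have small := inner_err_small hn hc1 hc2 C1 heps0 heps1 r1.
(* At level 1 the inverse flank is [gam ^ beta n 2], and [beta n 2] is n + 1. *)
have LE : outer_lip R n m gam * (2 * n%:R + 1) = 8 * (2 * n + 2)%:R ^+ n.+1.
  rewrite /outer_lip mE /ramp /beta !big_ord_recl big_ord0 /= expn0 expn1 addn0 add1n hgam.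
  by rewrite invrK [LHS]mulrC mulVKf // gt_eqF //; move: N2; lra.
move: (total_error_le hn hc1 hc2 C1 heps0 r1 LE) => err.
rewrite -hgam in small err; rewrite -mE in err.
have [N [Nd Ns Ne]] := network_of_layer1 hn g6 g_even gm hc1 hc2 hY f1 f_rep Win1 Wout1 small.
exists N; split.
- by move: Nd; rewrite !mulrA.
- by move: Ns; rewrite mE !mulrA.
- by apply/supnorm_leP => x /Ne /le_trans; apply.
Qed.
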